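(* Let $d\in\mathbb N$, $\alpha\in(0,2)$, $m\ge0$, and $v,a>0$ be such that $\mathcal H_{m,\alpha}=\Phi_{m,\alpha}(-\Delta)-v\mathbf 1_{B_a}$ has a ground state $\varphi$. Let $\chi:[0,\infty)\to\mathbb R$ be such that $\varphi(x)=\chi(|x|)$. Then $\chi$ is non-increasing on $[0,\infty)$.
   Context: $B_a$ is the ball of radius $a$ centred at the origin in $\mathbb R^d$. $\Phi_{m,\alpha}(z)=(z+m^{2/\alpha})^{\alpha/2}-m$, $z>0$, and $\Phi_{m,\alpha}(-\Delta)$ is the self-adjoint operator on $L^2(\mathbb R^d)$ given by the Fourier multiplier $\Phi_{m,\alpha}(|\xi|^2)$, so that $\Phi_{m,\alpha}(-\Delta)=(-\Delta+m^{2/\alpha})^{\alpha/2}-m$. $\mathcal H_{m,\alpha}=\Phi_{m,\alpha}(-\Delta)+V$ with $V=-v\mathbf 1_{B_a}$ is self-adjoint on $L^2(\mathbb R^d)$ with essential spectrum $[0,\infty)$. $\mathcal H_{m,\alpha}$ has a ground state if its discrete spectrum is non-empty; then $\lambda=\min\mathrm{Spec}_{\rm d}(\mathcal H_{m,\alpha})$ is a simple eigenvalue (the ground state eigenvalue), and the ground state $\varphi$ is the unique corresponding eigenfunction that is strictly positive with $\|\varphi\|_{L^2}=1$; it is taken in its continuous version, and it is rotationally symmetric. Standing assumption: $v$ is such that the ground state exists. *)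

(* Defs.v *)
From HB Require Import structures.
From mathcomp Require Import all_boot all_order all_algebra.
From mathcomp Require Import all_classical all_reals all_analysis.
From mathcomp Require Import complex.

Set Implicit Arguments.
Unset Strict Implicit.
Unset Printing Implicit Defensive.

Import Order.TTheory GRing.Theory Num.Theory.
Import numFieldNormedType.Exports.

Local Open Scope classical_set_scope.
Local Open Scope ring_scope.

(** * Lebesgue measure on R^d, with R^d the row vectors ['rV[R]_d] *)

Definition rV_display : measure_display -> measure_display.
Proof. exact. Qed.

Section measurable_rV.
Context {R : realType} (d : nat).

Definition rV_coord (i : 'I_d) (x : 'rV[R]_d) : measurableTypeR R := x ord0 i.

Let rV_set0 : g_sigma_preimage rV_coord set0.
Proof. exact: sigma_algebra0. Qed.

Let rV_setC A : g_sigma_preimage rV_coord A -> g_sigma_preimage rV_coord (~` A).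
Proof. exact: sigma_algebraC. Qed.

Let rV_bigcup (F : (set 'rV[R]_d)^nat) :
  (forall i, g_sigma_preimage rV_coord (F i)) ->
  g_sigma_preimage rV_coord (\bigcup_i F i).
Proof. exact: sigma_algebra_bigcup. Qed.

(* The sigma-algebra generated by the coordinates, i.e. the Borel sets. *)
HB.instance Definition _ := @isMeasurable.Build
  (rV_display default_measure_display) 'rV[R]_d
  (g_sigma_preimage rV_coord) rV_set0 rV_setC rV_bigcup.

End measurable_rV.

Section lebesgue_rV.
Context {R : realType}.

Lemma measurable_rV_coord d (i : 'I_d) :
  measurable_fun [set: 'rV[R]_d] (rV_coord i).
Proof.
move=> _ Y mY; rewrite setTI; apply: sub_sigma_algebra => /=.
rewrite -bigcup_seq/=; exists i => /=; first by rewrite mem_index_enum.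
by exists Y => //; rewrite setTI.
Qed.

Lemma measurable_fun_rV d0 (T : measurableType d0) d (f : T -> 'rV[R]_d) :
  (forall i, measurable_fun [set: T] (rV_coord i \o f)) ->
  measurable_fun [set: T] f.
Proof.
move=> mf _ A mA; rewrite setTI.
have : preimage_set_system setT f (g_sigma_preimage (@rV_coord R d)) (f @^-1` A).
  by exists A => //; rewrite setTI.
rewrite -g_sigma_preimage_comp.
move: (f @^-1` A); apply: smallest_sub; first exact: sigma_algebra_measurable.
case: d => [|n] in f mf A mA *; first by rewrite big_ord0.
rewrite -bigcup_mkord_ord; apply: bigcup_sub => i Ii.
by move=> B [C mC <-]; exact: mf.
Qed.

Definition cons_rV d (p : measurableTypeR R * 'rV[R]_d) : 'rV[R]_d.+1 :=
  \row_i (if unlift ord0 i is Some j then p.2 ord0 j else p.1).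

Definition uncons_rV d (x : 'rV[R]_d.+1) : measurableTypeR R * 'rV[R]_d :=
  (x ord0 ord0, \row_j x ord0 (lift ord0 j)).

Lemma cons_rVK d : cancel (@cons_rV d) (@uncons_rV d).
Proof.
move=> [t y]; rewrite /uncons_rV /cons_rV !mxE unlift_none; congr pair.
by apply/rowP => j; rewrite !mxE liftK.
Qed.

Lemma uncons_rVK d : cancel (@uncons_rV d) (@cons_rV d).
Proof.
by move=> x; apply/rowP => i; rewrite mxE; case: unliftP => [j|] -> //=; rewrite mxE.
Qed.

Lemma measurable_cons_rV d : measurable_fun setT (@cons_rV d).
Proof.
apply: measurable_fun_rV => i; rewrite /cons_rV.
case: (unliftP ord0 i) => [j|] ->.
  rewrite (_ : _ \o _ = @rV_coord R d j \o snd); last first.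
    by apply/funext => p; rewrite /rV_coord /= mxE liftK.
  by apply: measurableT_comp; [exact: measurable_rV_coord|exact: measurable_snd].
rewrite (_ : _ \o _ = fst); first exact: measurable_fst.
by apply/funext => p; rewrite /rV_coord /= mxE unlift_none.
Qed.

Lemma measurable_uncons_rV d : measurable_fun setT (@uncons_rV d).
Proof.
apply/measurable_fun_pairP; split; first exact: measurable_rV_coord.
apply: measurable_fun_rV => i.
rewrite (_ : _ \o _ = @rV_coord R d.+1 (lift ord0 i)).
  exact: measurable_rV_coord.
by apply/funext => x; rewrite /rV_coord /= mxE.
Qed.

HB.instance Definition _ d := isMeasurableFun.Build _ _ _ _
  (@cons_rV d) (@measurable_cons_rV d).

Section lebesgue_cons.
Variables (d : nat) (mu : {sigma_finite_measure set 'rV[R]_d -> \bar R}).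

Definition lebesgue_cons : set 'rV[R]_d.+1 -> \bar R :=
  pushforward (@lebesgue_measure R \x mu)%E (@cons_rV d).

Let lebesgue_cons0 : lebesgue_cons set0 = 0%E.
Proof. exact: measure0. Qed.

Let lebesgue_cons_ge0 A : (0 <= lebesgue_cons A)%E.
Proof. exact: measure_ge0. Qed.

Let lebesgue_cons_sigma_additive : semi_sigma_additive lebesgue_cons.
Proof. exact: measure_semi_sigma_additive. Qed.

HB.instance Definition _ := isMeasure.Build _ _ _ lebesgue_cons
  lebesgue_cons0 lebesgue_cons_ge0 lebesgue_cons_sigma_additive.

Let lebesgue_cons_sigma_finite : sigma_finite setT lebesgue_cons.
Proof.
have /sigma_finiteP[F [FT ndF Foo]] := sigma_finiteT (@lebesgue_measure R).
have /sigma_finiteP[G [GT ndG Goo]] := sigma_finiteT mu.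
exists (fun n => @uncons_rV d @^-1` (F n `*` G n)) => [|n].
  rewrite -preimage_bigcup; apply/esym/seteqP; split => // x _ /=.
  have [i _ Fi] : (\bigcup_i F i) (uncons_rV x).1 by rewrite -FT.
  have [j _ Gj] : (\bigcup_i G i) (uncons_rV x).2 by rewrite -GT.
  exists (maxn i j) => //; split.
    by apply: (subsetPset _ _ (ndF _ _ (leq_maxl i j))).
  by apply: (subsetPset _ _ (ndG _ _ (leq_maxr i j))).
have [[mFn Fnoo] [mGn Gnoo]] := (Foo n, Goo n).
have mFG : measurable (F n `*` G n) by exact: measurableX.
split; first by rewrite -[X in measurable X]setTI; exact: measurable_uncons_rV.
rewrite /lebesgue_cons /pushforward -comp_preimage.
rewrite (_ : _ \o _ = id); last by apply/funext => p /=; rewrite cons_rVK.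
by rewrite preimage_id product_measure1E// lte_mul_pinfty// ge0_fin_numE.
Qed.

HB.instance Definition _ := Measure_isSigmaFinite.Build _ _ _ lebesgue_cons
  lebesgue_cons_sigma_finite.

End lebesgue_cons.

(* Iterated product of the one-dimensional Lebesgue measure. *)
Fixpoint lebesgue_rV d : {sigma_finite_measure set 'rV[R]_d -> \bar R} :=
  if d is d'.+1 then lebesgue_cons (lebesgue_rV d') else dirac (0 : 'rV[R]_0).

Lemma lebesgue_rV_box d (A : 'I_d -> set (measurableTypeR R)) :
  (forall i, measurable (A i)) ->
  lebesgue_rV d [set x | forall i, A i (x ord0 i)] =
  (\prod_(i < d) lebesgue_measure (A i))%E.
Proof.
elim: d A => [|d IHd] A mA.
  rewrite big_ord0 /= diracE mem_set//=; by case.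
set B := [set y : 'rV[R]_d | forall i, A (lift ord0 i) (y ord0 i)].
have mB : measurable B.
  rewrite (_ : B = \bigcap_(i in [set: 'I_d])
      (@rV_coord R d i @^-1` A (lift ord0 i))).
    apply: fin_bigcap_measurable; [exact: finite_finset|move=> i _].
    by rewrite -[X in measurable X]setTI; exact: measurable_rV_coord.
  by apply/seteqP; split => y /= Ay i; [move=> _; exact: Ay|exact: Ay].
rewrite big_ord_recl /= /lebesgue_cons /pushforward.
rewrite (_ : _ @^-1` _ = A ord0 `*` B); last first.
  apply/seteqP; split=> [[t y] /= Aty|[t y] /= [At Ay] i].
    split => [|i]; first by have := Aty ord0; rewrite mxE unlift_none.
    by have := Aty (lift ord0 i); rewrite mxE liftK.
  by rewrite mxE; case: unliftP => [j|] ->.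
rewrite product_measure1E//; congr (_ * _)%E.
exact: (IHd (fun i => A (lift ord0 i))).
Qed.

End lebesgue_rV.

(** * Square-integrable complex functions on R^d *)

Section euclidean.
Context {R : realType} {d : nat}.
Implicit Types x y : 'rV[R]_d.

Definition dotp x y : R := \sum_(i < d) x ord0 i * y ord0 i.

(* The library norm [`|x|] on ['rV[R]_d] is the sup norm. *)
Definition enorm x : R := Num.sqrt (dotp x x).

End euclidean.

Section complex_functions.
Context {R : realType} {d : nat}.
Local Open Scope complex_scope.

Local Notation mu := (@lebesgue_rV R d).
Local Notation fct := ('rV[R]_d -> R[i]).
Implicit Types f g u w : fct.

Definition aeq f g := {ae mu, forall x, f x = g x}.

Definition cmeasurable f :=
  measurable_fun setT (fun x => complex.Re (f x)) /\
  measurable_fun setT (fun x => complex.Im (f x)).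

Definition cLnorm (p : R) f : \bar R :=
  Lnorm mu p%:E (fun x => (Normc.normc (f x))%:E).

Definition inL (p : R) f := cmeasurable f /\ (cLnorm p f < +oo)%E.

Definition cintegral f : R[i] :=
  (\int[mu]_x complex.Re (f x))%R +i* (\int[mu]_x complex.Im (f x))%R.

Definition expi (t : R) : R[i] := cos t +i* sin t.

(* Unitary normalisation, for which -Delta becomes multiplication by
   |xi|^2. *)
Definition fourier_integral f : fct := fun xi =>
  ((Num.sqrt (2 * pi)) ^- d)%:C *
  cintegral (fun x => expi (- dotp x xi) * f x).

(* [g] is the Fourier-Plancherel transform of [f]: its graph is the closure
   in L^2 x L^2 of the graph of the Fourier integral on the intersection of
   L^1 and L^2. *)
Definition is_fourier f g :=
  [/\ inL 2 f, inL 2 g &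
      exists f_ : nat -> fct,
        [/\ forall n, inL 1 (f_ n) /\ inL 2 (f_ n),
            cLnorm 2 (fun x => f_ n x - f x) @[n --> \oo] --> 0%E &
            cLnorm 2 (fun xi => fourier_integral (f_ n) xi - g xi)
              @[n --> \oo] --> 0%E]].

(** * Linear operators on L^2(R^d) and their spectra *)

(* An unbounded operator is given by its graph: [T u w] means that [u] is in
   the domain of [T] and [T u = w], where [u] and [w] stand for their classes
   modulo almost everywhere equality. *)
Definition operator := fct -> fct -> Prop.
Implicit Types T : operator.

(* [multiplier b] is the operator whose Fourier symbol is [b]; its domain is
   the set of the [u] in L^2 such that [b] times the transform of [u] is in
   L^2. *)
Definition multiplier (b : 'rV[R]_d -> R) : operator := fun u w =>
  exists2 uh, is_fourier u uh & is_fourier w (fun xi => (b xi)%:C * uh xi).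

Definition add_potential T (V : 'rV[R]_d -> R) : operator := fun u w =>
  inL 2 w /\ exists2 w0, T u w0 & aeq w (fun x => w0 x + (V x)%:C * u x).

(* [T - z] is a bijection from its domain onto L^2, with bounded inverse. *)
Definition resolvent_set T : set R[i] := [set z |
  (forall u, T u (fun x => z * u x) -> aeq u (cst 0)) /\
  exists M : R, forall g, inL 2 g ->
    exists2 u, T u (fun x => z * u x + g x) &
               (cLnorm 2 u <= M%:E * cLnorm 2 g)%E].

Definition spectrum T : set R[i] := ~` resolvent_set T.

Definition eigenfunction T (z : R[i]) u :=
  T u (fun x => z * u x) /\ ~ aeq u (cst 0).

Definition finite_multiplicity T (z : R[i]) :=
  exists n (e : 'I_n -> fct), forall u, T u (fun x => z * u x) ->
    exists c : 'I_n -> R[i], aeq u (fun x => \sum_(i < n) c i * e i x).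

Definition isolated_in (S : set R[i]) (z : R[i]) :=
  S z /\ exists2 e : R, 0 < e &
    forall z', S z' -> Normc.normc (z' - z) < e -> z' = z.

(* The isolated eigenvalues of finite multiplicity. *)
Definition discrete_spectrum T : set R[i] := [set z |
  [/\ isolated_in (spectrum T) z,
      exists u, eigenfunction T z u &
      finite_multiplicity T z]].

End complex_functions.

(** * The operator (-Delta + m^(2/alpha))^(alpha/2) - m - v 1_{B_a} *)

Section hamiltonian.
Context {R : realType} {d : nat}.
Local Open Scope complex_scope.

Definition Phi (m alpha z : R) : R := (z + m `^ (2 / alpha)) `^ (alpha / 2) - m.

Definition kinetic (m alpha : R) : @operator R d :=
  multiplier (fun xi => Phi m alpha (enorm xi ^+ 2)).

Definition well (v a : R) (x : 'rV[R]_d) : R :=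
  - v * \1_[set y | enorm y < a] x.

Definition hamiltonian (m alpha v a : R) : @operator R d :=
  add_potential (kinetic m alpha) (well v a).

(* The spectrum of a self-adjoint operator is real, so only the real points of
   the discrete spectrum are compared. *)
Definition ground_state_eigenvalue (T : @operator R d) (lambda : R) :=
  discrete_spectrum T lambda%:C /\
  forall lambda' : R, discrete_spectrum T lambda'%:C -> lambda <= lambda'.

Definition ground_state (T : @operator R d) (phi : 'rV[R]_d -> R) :=
  exists2 lambda : R, ground_state_eigenvalue T lambda &
    [/\ eigenfunction T lambda%:C (fun x => (phi x)%:C),
        cLnorm 2 (fun x => (phi x)%:C) = 1%E,
        continuous phi &
        forall x, 0 < phi x].

End hamiltonian.

(* Main.v *)
From HB Require Import structures.
Require Import Defs.
From mathcomp Require Import all_boot all_order all_algebra.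
From mathcomp Require Import all_classical all_reals all_analysis.
From mathcomp Require Import measurable_realfun lebesgue_integral_under.
From mathcomp Require Import complex ring lra.

(** Let [phi] be the ground state and let [refl c] be the reflection in the
    hyperplane [x_0 = c] with [c > 0]. The claim is that
    [phi (refl c x) <= phi x] on the side [x_0 < c] of the origin. For
    [c = (r + s) / 2] and [x = (r, 0)] this reads [chi s <= chi r], since
    [refl c x = (s, 0)].

    The claim is proved by polarisation, applied to the weak form of the
    eigenvalue equation. Let [N], called [bad_set], be the set of the points
    with [x_0 < c] at which the claim fails, and let [u], called [refl_test],
    be [phi o refl c] on [N], minus [phi o refl c] on the mirror image of [N],
    and zero elsewhere. Then:

    - [int phi u = 0], because [phi * u] is odd;
    - [int (l + v 1_B) phi u >= 0], because moreover a centred ball [B]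
      contains the mirror image of each of its points that lies beyond the
      hyperplane;
    - [<exp (t Delta) phi, u> > 0] for every [t > 0] unless [N] is null
      (lemma [heat_form_refl_test_gt0]): summing the integrand over the
      reflections of the two points and their exchange reduces this to an
      inequality between the values of [phi] at four points, which holds
      because the heat kernel is larger between points on the same side.

    The symbol is a Bernstein function (lemma [Phi_levy]): with a positive
    weight [w], [Phi m alpha z] is the integral of
    [w x * (1 - exp (- t z))], [t = exp x]. So the kinetic energy
    [<Phi(-Delta) phi, u>] is the integral of
    [w x * (int phi u - <exp (t Delta) phi, u>)], which is negative unless [N]
    is null, whereas the eigenvalue equation [Phi(-Delta) phi = (l + v 1_B) phi]
    makes it nonnegative. Hence [N] is null, and it is empty because [phi] is
    continuous.

    The kinetic operator is defined by a Fourier multiplier, and these pairings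
    have to be computed on the Fourier side. Fubini and the transform of the
    Gaussian give, for integrable functions, Parseval's identity with the
    weight [exp (- s |xi|^2)], with the heat form on the other side
    (lemma [gauss_parseval]); it passes to the Plancherel transforms because
    both sides are continuous in [L^2]. The relation [fourier_dual] records
    this identity against all transform pairs. A function [u] in [L^2] has a
    dual partner because the spectral point [l] is isolated: at a real point
    [z] near [l] the resolvent solves [H g = z g + u], and all the other terms
    of that equation have one (lemma [resolvent_fourier_dual]). Sending [s] to
    zero requires the strong continuity of the heat semigroup only at [phi] and
    [1_B phi], which are nonnegative and lower semicontinuous (lemma
    [cvg_heat_form]). *)

Set Implicit Arguments.
Unset Strict Implicit.
Unset Printing Implicit Defensive.

Import Order.TTheory GRing.Theory Num.Theory.
Import numFieldNormedType.Exports.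

Local Open Scope classical_set_scope.
Local Open Scope ring_scope.

(** * Integrals of real functions *)

Section real_integrals.
Context d (T : measurableType d) (R : realType) (mu : {measure set T -> \bar R}).
Implicit Types f g k : T -> R.

Lemma Rdominated_cvg (f_ : nat -> T -> R) f g :
  (forall n, measurable_fun setT (f_ n)) ->
  (forall x, f_ n x @[n --> \oo] --> f x) ->
  mu.-integrable setT (EFin \o g) ->
  (forall n x, `|f_ n x| <= g x) ->
  mu.-integrable setT (EFin \o f) /\
  (\int[mu]_x f_ n x) @[n --> \oo] --> \int[mu]_x f x.
Proof.
move=> mf cf ig fg.
have mf' : measurable_fun setT f.
  apply: (measurable_fun_cvg (h := f_)) => // x _; exact: cf.
have [|||||i _ c] := @dominated_convergence _ _ _ mu _ measurableT
  (fun n => EFin \o f_ n) (EFin \o f) (EFin \o g).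
- by move=> n; exact/measurable_EFinP.
- exact/measurable_EFinP.
- by apply: aeW => x _; apply: cvg_EFin; [exact: nearW|exact: cf].
- by [].
- by apply: aeW => x n _; rewrite lee_fin.
split => //; apply: fine_cvg; rewrite fineK; first exact: c.
exact: integrable_fin_num.
Qed.

Lemma le_integrableR f g : measurable_fun setT f ->
  (forall x, `|f x| <= g x) -> mu.-integrable setT (EFin \o g) ->
  mu.-integrable setT (EFin \o f).
Proof.
move=> mf fg; apply: le_integrable => //; first exact/measurable_EFinP.
by move=> x _ /=; rewrite lee_fin (le_trans (fg x))// ler_norm.
Qed.

Lemma integrable_measurableR f : mu.-integrable setT (EFin \o f) ->
  measurable_fun setT f.
Proof. by move=> /measurable_int/measurable_EFinP. Qed.

Lemma integrableRD f g : mu.-integrable setT (EFin \o f) ->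
  mu.-integrable setT (EFin \o g) ->
  mu.-integrable setT (EFin \o (fun x => f x + g x)).
Proof. by move=> fi gi; exact: (integrableD measurableT fi gi). Qed.

Lemma integrableRZ (k : R) f : mu.-integrable setT (EFin \o f) ->
  mu.-integrable setT (EFin \o (fun x => k * f x)).
Proof. by move=> fi; exact: (integrableZl measurableT k fi). Qed.

Lemma integrableRB f g : mu.-integrable setT (EFin \o f) ->
  mu.-integrable setT (EFin \o g) ->
  mu.-integrable setT (EFin \o (fun x => f x - g x)).
Proof. by move=> fi gi; exact: (integrableB measurableT fi gi). Qed.

Lemma integrableRM_bounded (k f : T -> R) : measurable_fun setT k ->
  (forall x, `|k x| <= 1) -> mu.-integrable setT (EFin \o f) ->
  mu.-integrable setT (EFin \o (fun x => k x * f x)).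
Proof.
move=> mk k1 fi; apply: (@le_integrableR _ (fun x => `|f x|)).
- by apply: measurable_funM => //; exact: integrable_measurableR.
- by move=> x; rewrite normrM ler_piMl.
- exact: integrable_norm.
Qed.

End real_integrals.

(** * The Fourier transform of a Gaussian on the line *)

Section gaussian_fourier.
Context {R : realType}.
Local Notation leb := (@lebesgue_measure R).

(** The fundamental theorem of calculus on [-n, n], where the boundary terms
    tend to zero. *)
Lemma Rintegral_derive_eq0 (F f : R -> R) :
  (forall x : R, is_derive x (1 : R) F (f x)) -> continuous f ->
  leb.-integrable setT (EFin \o f) ->
  F n%:R @[n --> \oo] --> (0 : R) -> F (- n%:R) @[n --> \oo] --> (0 : R) ->
  \int[leb]_x f x = 0.
Proof.
move=> dF cf intf Fy FNy.
pose A n : set R := [set` `[- n%:R, n%:R]].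
have mA n : measurable (A n) by exact: measurable_itv.
have [||||_] := @Rdominated_cvg _ _ R leb (fun n => f \_ (A n)) f (fun x => `|f x|).
- move=> n; apply/(measurable_restrictT _ (mA n)).
  apply: measurable_funTS; exact: (@integrable_measurableR _ _ _ leb).
- move=> x; apply: cvg_near_cst.
  near=> n; rewrite patchE ifT// inE /A /= in_itv/= -ler_norml.
  by near: n; exact: nbhs_infty_ger.
- exact: integrable_norm.
- by move=> n x; rewrite patchE; case: ifPn => // _; rewrite normr0.
move=> /cvg_lim <-//; apply/cvg_lim => //.
have : (F n%:R - F (- n%:R)) @[n --> \oo] --> (0 : R).
  by rewrite -[X in _ --> X](subr0 0); exact: cvgB.
apply: cvg_trans.
apply: near_eq_cvg; near=> n.
rewrite -Rintegral_mkcond /Rintegral (@continuous_FTC2 _ f F)//.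
- rewrite ltrNl; apply: (@lt_trans _ _ 0); rewrite ?oppr_lt0 ltr0n//.
    by near: n; exists 1%N.
  by near: n; exists 1%N.
- exact: continuous_subspaceT.
- have cF : continuous F.
    by move=> x; apply/differentiable_continuous/derivable1_diffP; case: (dF x).
  split; first by move=> x _; case: (dF x).
  + exact/cvg_at_right_filter/cF.
  + exact/cvg_at_left_filter/cF.
- by move=> x _; rewrite derive1E; case: (dF x).
Unshelve. all: by end_near. Qed.

Let gauss (s t : R) : R := expR (- (s * t ^+ 2)).

Lemma integrable_gauss s : 0 < s -> leb.-integrable setT (EFin \o gauss s).
Proof.
move=> s0; pose sg := Num.sqrt (2 * s)^-1.
have sg0 : sg != 0 by rewrite sqrtr_eq0 -ltNge invr_gt0 mulr_gt0.
have := integrable_normal_pdf 0 sg.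
rewrite normal_pdfE// => /(integrableZl measurableT (normal_peak sg)^-1).
apply: eq_integrable => // x _ /=; rewrite /normal_fun -EFinM.
rewrite mulrA mulVf ?mul1r ?gt_eqF ?normal_peak_gt0//.
rewrite /gauss subr0 sqr_sqrtr; last by rewrite invr_ge0 mulr_ge0// ltW.
by congr (expR _)%:E; field; rewrite gt_eqF.
Qed.

Lemma Rintegral_gauss s : 0 < s ->
  \int[leb]_t gauss s t = Num.sqrt (pi / s).
Proof.
move=> s0; pose sg := Num.sqrt (2 * s)^-1.
have sg0 : sg != 0 by rewrite sqrtr_eq0 -ltNge invr_gt0 mulr_gt0.
have h x : gauss s x = (normal_peak sg)^-1 * normal_pdf 0 sg x.
  rewrite normal_pdfE// /normal_fun.
  rewrite mulrA mulVf ?mul1r ?gt_eqF ?normal_peak_gt0//.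
  rewrite /gauss subr0 sqr_sqrtr; last by rewrite invr_ge0 mulr_ge0// ltW.
  by congr (expR _); field; rewrite gt_eqF.
under eq_Rintegral do rewrite h.
rewrite RintegralZl//; last exact: integrable_normal_pdf.
rewrite [X in _ * X]/Rintegral integral_normal_pdf /= mulr1 /normal_peak invrK.
congr Num.sqrt; rewrite sqr_sqrtr; last by rewrite invr_ge0 mulr_ge0// ltW.
by rewrite -mulr_natr; field; rewrite gt_eqF.
Qed.

(** Half of the Gaussian decay absorbs the factor [t]; the constant comes from
    [|t| <= 1 / (2 s) + (s / 2) t^2] and [1 + x <= exp x]. *)
Let abs_gauss_le s t : 0 < s ->
  `|t| * gauss s t <= (1 + (2 * s)^-1) * gauss (s / 2) t.
Proof.
move=> s0.
have -> : gauss s t = gauss (s / 2) t * gauss (s / 2) t.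
  by rewrite /gauss -expRD; congr expR; field.
rewrite mulrA ler_wpM2r ?expR_ge0// /gauss expRN ler_pdivrMr ?expR_gt0//.
have h := expR_ge1Dx (s / 2 * t ^+ 2).
apply: (@le_trans _ _ ((1 + (2 * s)^-1) * (1 + s / 2 * t ^+ 2))); last first.
  by rewrite ler_wpM2l// addr_ge0// invr_ge0 mulr_ge0// ltW.
have h1 : `|t| <= (2 * s)^-1 + s / 2 * t ^+ 2.
  rewrite -subr_ge0 -(real_normK (num_real t)).
  rewrite (_ : _ - _ = (2 * s)^-1 * (1 - s * `|t|) ^+ 2).
    by rewrite mulr_ge0 ?sqr_ge0// invr_ge0 mulr_ge0// ltW.
  by field; rewrite gt_eqF.
apply: (le_trans h1); rewrite -subr_ge0.
rewrite (_ : _ - _ = 1 + (2 * s)^-1 * (s / 2 * t ^+ 2)); last by ring.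
have s1 := ltW s0.
have s2 : 0 <= (2 * s)^-1 by rewrite invr_ge0 mulr_ge0.
by rewrite addr_ge0// mulr_ge0// mulr_ge0 ?sqr_ge0 ?divr_ge0.
Qed.

Lemma continuous_gauss s : continuous (gauss s).
Proof.
move=> x; rewrite /gauss; apply: continuous_comp; last exact: continuous_expR.
by apply: cvgN; apply: cvgM; [exact: cvg_cst|exact: exprn_continuous].
Qed.

Lemma integrable_abs_gauss s : 0 < s ->
  leb.-integrable setT (EFin \o (fun t => `|t| * gauss s t)).
Proof.
move=> s0; apply: (@le_integrableR _ _ _ leb _
    (fun t => (1 + (2 * s)^-1) * gauss (s / 2) t)).
- apply: measurable_funM; first exact: (measurableT_comp (@normr_measurable R setT)).
  by apply: continuous_measurable_fun; exact: continuous_gauss.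
- by move=> x; rewrite ger0_norm ?abs_gauss_le// mulr_ge0// expR_ge0.
- have s20 : 0 < s / 2 by rewrite divr_gt0.
  apply: (integrableZl measurableT _ (integrable_gauss s20)).
Qed.

Let wave s th z t : R := gauss s t * cos (th + z * t).
Let dwave s th z t : R := - (t * (gauss s t * sin (th + z * t))).

Let is_derive_wave s th t (z : R) :
  is_derive z (1 : R) (wave s th ^~ t) (dwave s th z t).
Proof.
have h : is_derive z (1 : R) (fun z => th + z * t) t.
  by apply: is_derive_eq; rewrite /GRing.scale /=; ring.
apply: is_derive_eq; rewrite /dwave /GRing.scale /=; ring.
Qed.

Let is_derive_time s th z (t : R) :
  is_derive t (1 : R) (fun t => gauss s t * sin (th + z * t))
    (2 * s * dwave s th z t + z * wave s th z t).
Proof.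
rewrite /gauss.
apply: is_derive_eq; rewrite /dwave /wave /GRing.scale /= /gauss; ring.
Qed.

Lemma cvg_gauss s : 0 < s -> gauss s n%:R @[n --> \oo] --> (0 : R).
Proof.
move=> s0; rewrite /gauss.
apply: (@squeeze_cvgr _ _ _ _ (cst 0) (fun n => s^-1 * n.+1%:R^-1 * 2)).
- near=> n; apply/andP; split; first exact: expR_ge0.
  have n1 : (1 : R) <= n%:R by rewrite ler1n; near: n; exists 1%N.
  rewrite (_ : _ * 2 = (s * (n.+1%:R / 2))^-1); last first.
    by rewrite invfM invf_div; ring.
  rewrite expRN lef_pV2 ?posrE ?expR_gt0 ?mulr_gt0//.
  apply: le_trans (expR_ge1Dx _).
  apply: (@le_trans _ _ (s * n%:R ^+ 2)); last by rewrite lerDr.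
  rewrite ler_wpM2l ?(ltW s0)// -natr1 ler_pdivrMr//.
  nra.
- exact: cvg_cst.
- rewrite -[X in _ --> X](mulr0 (s^-1 * 2)).
  rewrite (_ : (fun n => _) = (fun n => s^-1 * 2 * n.+1%:R^-1)).
    by apply: cvgM; [exact: cvg_cst|exact: cvg_harmonic].
  by apply/funext => n; ring.
Unshelve. all: by end_near. Qed.

(** As a function [F] of the frequency [z], the integral satisfies
    [F' = - (z / 2 s) F]: differentiate under the integral sign, then integrate
    by parts in [t]. Hence [F z * exp (z^2 / 4 s)] is constant. *)
Lemma Rintegral_gauss_cos s th z : 0 < s ->
  \int[leb]_t (expR (- (s * t ^+ 2)) * cos (th + z * t)) =
  cos th * (Num.sqrt (pi / s) * expR (- (z ^+ 2 / (4 * s)))).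
Proof.
move=> s0; pose F z := \int[leb]_t wave s th z t.
have cgauss := @continuous_gauss s.
have cphase z' : continuous (fun t : R => th + z' * t).
  by move=> t; apply: cvgD; [exact: cvg_cst|apply: cvgM; [exact: cvg_cst|exact: cvg_id]].
have cwave z' : continuous (wave s th z').
  move=> t; apply: cvgM; first exact: cgauss.
  by apply: continuous_comp; [exact: cphase|exact: continuous_cos].
have cdwave z' : continuous (dwave s th z').
  move=> t; apply: cvgN; apply: cvgM; first exact: cvg_id.
  apply: cvgM; first exact: cgauss.
  by apply: continuous_comp; [exact: cphase|exact: continuous_sin].
have iwave z' : leb.-integrable setT (EFin \o wave s th z').
  apply: (@le_integrableR _ _ _ leb _ (gauss s)).
  - exact: continuous_measurable_fun.
  - move=> t; rewrite /wave normrM ger0_norm ?expR_ge0// ler_piMr ?expR_ge0//.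
    by rewrite ler_norml cos_geN1 cos_le1.
  - exact: integrable_gauss.
have dwave_le z' t : `|dwave s th z' t| <= `|t| * gauss s t.
  rewrite normrN normrM ler_wpM2l// normrM ger0_norm ?expR_ge0//.
  by rewrite ler_piMr ?expR_ge0// ler_norml sin_geN1 sin_le1.
have idwave z' : leb.-integrable setT (EFin \o dwave s th z').
  apply: (@le_integrableR _ _ _ leb _ (fun t => `|t| * gauss s t)) => //.
  - exact: continuous_measurable_fun.
  - exact: integrable_abs_gauss.
have dF z' : is_derive z' (1 : R) F (\int[leb]_t dwave s th z' t).
  have I : `]z' - 1, z' + 1[%classic z'.
    by rewrite /= in_itv /= ltrBlDr !ltrDl ltr01.
  have E x t : partial1of2 (wave s th) x t = dwave s th x t.
    by rewrite partial1of2E; case: (is_derive_wave s th t x).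
  have := @cvg_differentiation_under_integral R _ _ leb (wave s th) setT
    measurableT z' (z' - 1) (z' + 1) I (fun x _ => iwave x)
    (fun x t _ _ => match is_derive_wave s th t x with DeriveDef h _ => h end)
    (fun t => `|t| * gauss s t)
    (fun t => mulr_ge0 (normr_ge0 t) (expR_ge0 _)) (integrable_abs_gauss s0).
  have G_ub (x t : R) : `]z' - 1, z' + 1[%classic x -> setT t ->
      `|partial1of2 (wave s th) x t| <= `|t| * gauss s t.
    by move=> _ _; rewrite E.
  move=> /(_ G_ub) h.
  rewrite (_ : partial1of2 (wave s th) z' = dwave s th z') in h; last first.
    by apply/funext => t; rewrite E.
  apply: DeriveDef; first by apply/cvg_ex; eexists; under eq_fun do rewrite scaler1; exact: h.
  by apply/cvg_lim => //; under eq_fun do rewrite scaler1; exact: h.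
have byparts z' : \int[leb]_t dwave s th z' t = - (z' / (2 * s)) * F z'.
  have small (e : nat -> R) : (forall n, e n ^+ 2 = n%:R ^+ 2) ->
      gauss s (e n) * sin (th + z' * e n) @[n --> \oo] --> (0 : R).
    move=> en; apply: norm_cvg0.
    apply: (@squeeze_cvgr _ _ _ _ (cst 0) (fun n => gauss s n%:R)).
    - apply: nearW => n; rewrite normr_ge0 /= normrM ger0_norm ?expR_ge0//.
      by rewrite /gauss en ler_piMr ?expR_ge0// ler_norml sin_geN1 sin_le1.
    - exact: cvg_cst.
    - exact: cvg_gauss.
  have : \int[leb]_t (2 * s * dwave s th z' t + z' * wave s th z' t) = 0.
    apply: (@Rintegral_derive_eq0 (fun t => gauss s t * sin (th + z' * t))).
    - by move=> t; exact: is_derive_time.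
    - move=> t; apply: cvgD; apply: cvgM; [exact: cvg_cst|exact: cdwave|exact: cvg_cst|exact: cwave].
    - by apply: integrableRD; apply: integrableRZ.
    - exact: small.
    - by apply: small => n; rewrite sqrrN.
  rewrite RintegralD//; last 2 first.
    - exact: (integrableZl measurableT _ (idwave z')).
    - exact: (integrableZl measurableT _ (iwave z')).
  rewrite !RintegralZl// => /eqP; rewrite addr_eq0 => /eqP h.
  apply: (@mulfI _ (2 * s)); first by rewrite mulf_neq0// gt_eqF.
  by rewrite h /F; field; rewrite gt_eqF.
pose H z := F z * expR (z ^+ 2 / (4 * s)).
have dH (x : R) : is_derive x (1 : R) H 0.
  have := dF x; rewrite byparts => ?.
  rewrite /H; apply: is_derive_eq.
  rewrite /GRing.scale /=; field; rewrite gt_eqF//.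
have HE : H z = H 0.
  exact: is_derive_0_is_cst.
have : F z = F 0 * expR (- (z ^+ 2 / (4 * s))).
  rewrite expRN; apply: (canRL (mulfK _)); first by rewrite gt_eqF ?expR_gt0.
  by rewrite -[LHS]/(H z) HE /H expr0n mul0r expR0 mulr1.
rewrite /F /wave => ->.
rewrite mulrA; congr (_ * _).
under eq_Rintegral do rewrite mul0r addr0.
by rewrite RintegralZr ?Rintegral_gauss 1?mulrC//; exact: integrable_gauss.
Qed.

End gaussian_fourier.

(** * Fubini and changes of variables *)

Section real_fubini.
Context d1 d2 (T1 : measurableType d1) (T2 : measurableType d2) (R : realType).
Variables (m1 : {sigma_finite_measure set T1 -> \bar R})
          (m2 : {sigma_finite_measure set T2 -> \bar R}).
Implicit Types f : T1 * T2 -> R.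
Local Notation m := (m1 \x m2)%E.

Lemma Rfubini1 f : m.-integrable setT (EFin \o f) ->
  (forall x, m2.-integrable setT (EFin \o (fun y => f (x, y)))) ->
  m1.-integrable setT (EFin \o (fun x => \int[m2]_y f (x, y))) /\
  \int[m]_p f p = \int[m1]_x \int[m2]_y f (x, y).
Proof.
move=> fi fix1.
have E x : fubini_F m2 (EFin \o f) x = (\int[m2]_y f (x, y))%:E.
  by rewrite /fubini_F /Rintegral fineK//; apply: integrable_fin_num (fix1 x).
split.
  apply: eq_integrable (integrable_fubini_F fi) => // x _; exact: E.
rewrite [LHS]/Rintegral -integral12_prod_meas1//; congr fine.
by apply: eq_integral => x _; rewrite E.
Qed.

Lemma Rfubini2 f : m.-integrable setT (EFin \o f) ->
  (forall y, m1.-integrable setT (EFin \o (fun x => f (x, y)))) ->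
  \int[m]_p f p = \int[m2]_y \int[m1]_x f (x, y).
Proof.
move=> fi fiy.
rewrite [LHS]/Rintegral -integral21_prod_meas1//; congr fine.
apply: eq_integral => y _; rewrite /fubini_G /Rintegral fineK//.
by apply: integrable_fin_num (fiy y).
Qed.

(** Absolute values decide integrability on a product, whichever factor is
    integrated first. *)
Lemma integrable_prod1 f (g : T1 -> R) : measurable_fun setT f ->
  m1.-integrable setT (EFin \o g) ->
  (forall x, \int[m2]_y `|f (x, y)|%:E <= (g x)%:E)%E ->
  m.-integrable setT (EFin \o f).
Proof.
move=> mf gi fg; apply/integrable12ltyP; first exact/measurable_EFinP.
apply: (@le_lt_trans _ _ (\int[m1]_x (g x)%:E)%E); last first.
  have /integrableP[_] := gi; apply: le_lt_trans.
  by apply: (le_trans (lee_abs _)); apply: le_abse_integral => //; apply: measurable_int gi.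
apply: ge0_le_integral => //.
- by move=> x _; apply: integral_ge0.
- apply: (measurable_fun_fubini_tonelli_F (abse \o (EFin \o f))) => //=.
  by apply: (measurableT_comp (@abse_measurable R setT)); exact/measurable_EFinP.
- exact: measurable_int gi.
- by move=> x _; exact: fg.
Qed.

Lemma integrable_prod2 f (g : T2 -> R) : measurable_fun setT f ->
  m2.-integrable setT (EFin \o g) ->
  (forall y, \int[m1]_x `|f (x, y)|%:E <= (g y)%:E)%E ->
  m.-integrable setT (EFin \o f).
Proof.
move=> mf gi fg; apply/integrable21ltyP; first exact/measurable_EFinP.
apply: (@le_lt_trans _ _ (\int[m2]_x (g x)%:E)%E); last first.
  have /integrableP[_] := gi; apply: le_lt_trans.
  by apply: (le_trans (lee_abs _)); apply: le_abse_integral => //; apply: measurable_int gi.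
apply: ge0_le_integral => //.
- by move=> x _; apply: integral_ge0.
- apply: (measurable_fun_fubini_tonelli_G (abse \o (EFin \o f))) => //=.
  by apply: (measurableT_comp (@abse_measurable R setT)); exact/measurable_EFinP.
- exact: measurable_int gi.
- by move=> x _; exact: fg.
Qed.

Lemma integrable_tensor (a : T1 -> R) (b : T2 -> R) :
  m1.-integrable setT (EFin \o a) -> m2.-integrable setT (EFin \o b) ->
  m.-integrable setT (EFin \o (fun p => a p.1 * b p.2)).
Proof.
move=> ai bi; have ma := integrable_measurableR ai.
have mb := integrable_measurableR bi.
apply: (@integrable_prod1 _ (fun x => `|a x| * \int[m2]_y `|b y|)).
- by apply: measurable_funM; [exact: measurableT_comp|exact: measurableT_comp].
- have := integrableRZ (\int[m2]_y `|b y|) (integrable_norm ai).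
  by under eq_fun do rewrite /= mulrC.
- move=> x /=; under eq_integral do rewrite normrM EFinM.
  rewrite ge0_integralZl//; last by apply/measurable_EFinP; exact: measurableT_comp.
  rewrite EFinM /Rintegral fineK//.
  exact: integrable_fin_num (integrable_norm bi).
Qed.

End real_fubini.

Section affine_change_of_variables.
Context {R : realType}.
Local Notation leb := (@lebesgue_measure R).

Definition affine (k b : R) (t : measurableTypeR R) : measurableTypeR R :=
  k * t + b.

Lemma measurable_affine k b : measurable_fun setT (affine k b).
Proof. by apply: measurable_funD => //; apply: measurable_funM. Qed.

(** Uniqueness of the measure that is the length on intervals: the rescaled
    pushforward has this property. *)
Lemma lebesgue_measure_affine (k b : R) (A : set (measurableTypeR R)) :
  k != 0 -> measurable A ->
  (leb A = `|k|%:E * leb [set t | A (affine k b t)])%E.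
Proof.
move=> k0 mA.
pose nk : {nonneg R} := NngNum (normr_ge0 k).
apply: (@lebesgue_measure_unique R (mscale nk (pushforward leb (affine k b)))) => //.
  exact: measurable_affine.
move=> mF X [[x y] _ <-] /=.
rewrite /mscale /= /pushforward.
have [k_gt0|k_lt0|/eqP] := ltgtP 0 k; last by rewrite eq_sym (negbTE k0).
- rewrite (_ : _ @^-1` _ = [set` `](x - b) / k, (y - b) / k]]); last first.
    apply/seteqP; split => t; rewrite /affine /= !in_itv /=;
      rewrite ltr_pdivrMr// ler_pdivlMr// [t * k]mulrC; lra.
  rewrite !lebesgue_measure_itv /= !lte_fin ltr_pM2r ?invr_gt0// ltrD2r.
  case: ifPn => _; last by rewrite mule0.
  rewrite -!EFinD -EFinM (gtr0_norm k_gt0); congr _%:E; field.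
  by rewrite gt_eqF.
- rewrite (_ : _ @^-1` _ = [set` `[(y - b) / k, (x - b) / k[]); last first.
    apply/seteqP; split => t; rewrite /affine /= !in_itv /=;
      rewrite ler_ndivrMr// ltr_ndivlMr// [t * k]mulrC; lra.
  rewrite !lebesgue_measure_itv /= !lte_fin ltr_nM2r ?invr_lt0// ltrD2r.
  case: ifPn => _; last by rewrite mule0.
  rewrite -!EFinD -EFinM (ltr0_norm k_lt0); congr _%:E; field.
  by rewrite lt_eqF.
Qed.

Lemma ge0_integral_affine (k b : R) (f : R -> \bar R) :
  k != 0 -> measurable_fun [set: R] f -> (forall t, 0 <= f t)%E ->
  (\int[leb]_t f (k * t + b)%R = (`|k|^-1)%:E * \int[leb]_t f t)%E.
Proof.
move=> k0 mf f0.
pose nk : {nonneg R} := NngNum (normr_ge0 k).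
rewrite [in RHS](eq_measure_integral (mscale nk (pushforward leb (affine k b)))); first last.
- by move=> mF A mA _; exact: (lebesgue_measure_affine b k0 mA).
- move=> mF.
rewrite ge0_integral_mscale// (ge0_integral_pushforward (@measurable_affine k b))//.
rewrite preimage_setT muleA -EFinM mulVf ?normr_eq0// mul1e//.
- exact: measurable_affine.
Qed.

End affine_change_of_variables.

(** * Integration over the coordinates of R^n *)

Section integral_rV.
Context {R : realType}.
Local Notation leb := (@lebesgue_measure R).
Local Notation mu := (@lebesgue_rV R _).

Lemma ge0_integral_rV_cons n (f : 'rV[R]_n.+1 -> \bar R) :
  measurable_fun setT f -> (forall x, 0 <= f x)%E ->
  (\int[mu]_x f x = \int[leb]_t \int[mu]_y f (cons_rV (t, y)))%E.
Proof.
move=> mf f0.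
rewrite -[LHS]/(\int[pushforward (leb \x mu)%E (@cons_rV R n)]_x f x)%E.
rewrite (ge0_integral_pushforward (@measurable_cons_rV R n))//.
rewrite preimage_setT fubini_tonelli1//.
- by apply: (measurableT_comp mf); exact: measurable_cons_rV.
- by move=> p; exact: f0.
Qed.

Lemma ge0_integral_rV_prod n (f : 'I_n -> R -> R) :
  (forall i, measurable_fun setT (f i)) -> (forall i t, 0 <= f i t) ->
  (\int[mu]_x (\prod_(i < n) f i (x ord0 i))%:E =
   \prod_(i < n) \int[leb]_t (f i t)%:E)%E.
Proof.
elim: n f => [|n IH] f mf f0.
  rewrite big_ord0 integral_dirac//=; last first.
    by under eq_fun do rewrite big_ord0; exact: measurable_cst.
  by rewrite diracE mem_set// big_ord0 mule1.
have mp : measurable_fun setT (fun x : 'rV[R]_n.+1 => \prod_(i < n.+1) f i (x ord0 i)).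
  apply: measurable_prod => i _.
  exact: (measurableT_comp (mf i) (@measurable_rV_coord R _ i)).
rewrite ge0_integral_rV_cons; last 2 first.
- exact/measurable_EFinP.
- by move=> x; rewrite lee_fin prodr_ge0.
rewrite big_ord_recl -IH//.
rewrite -ge0_integralZr//; last 3 first.
- by apply/measurable_EFinP; exact: mf.
- by move=> x _; rewrite lee_fin.
- by apply: integral_ge0 => y _; rewrite lee_fin prodr_ge0.
apply: eq_integral => t _.
rewrite -ge0_integralZl//; last 3 first.
- apply/measurable_EFinP; apply: measurable_prod => i _.
  exact: (measurableT_comp (mf (lift ord0 i)) (@measurable_rV_coord R _ i)).
- by move=> y _; rewrite lee_fin prodr_ge0.
- by rewrite lee_fin.
apply: eq_integral => y _; rewrite -EFinM big_ord_recl /cons_rV !mxE unlift_none.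
by congr (_ * _)%:E; apply: eq_bigr => i _; rewrite mxE liftK.
Qed.


Lemma Rintegral_rV_cons n (f : 'rV[R]_n.+1 -> R) :
  mu.-integrable setT (EFin \o f) ->
  (forall t, mu.-integrable setT (EFin \o (fun y => f (cons_rV (t, y))))) ->
  \int[mu]_x f x = \int[leb]_t \int[mu]_y f (cons_rV (t, y)).
Proof.
move=> fi fit; have mf := integrable_measurableR fi.
have mcons := @measurable_cons_rV R n.
have ci : (leb \x mu)%E.-integrable setT (EFin \o (f \o @cons_rV R n)).
  apply/integrableP; split; first by apply/measurable_EFinP; exact: measurableT_comp.
  have /integrableP[_] := fi; apply: le_lt_trans.
  rewrite -[X in (_ <= X)%E]/(\int[pushforward (leb \x mu)%E (@cons_rV R n)]_x `|(f x)%:E|)%E.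
  rewrite (ge0_integral_pushforward mcons) ?preimage_setT//.
  by apply: measurableT_comp => //; exact/measurable_EFinP.
rewrite -(Rfubini1 ci fit).2 [LHS]/Rintegral.
rewrite -[X in fine X = _]/(\int[pushforward (leb \x mu)%E (@cons_rV R n)]_x (f x)%:E)%E.
rewrite (integral_pushforward mcons)//; first exact/measurable_EFinP.
Qed.

Lemma measurable_rV_coordR n (i : 'I_n) :
  measurable_fun [set: 'rV[R]_n] (fun x => x ord0 i : R).
Proof. exact: measurable_rV_coord. Qed.

Lemma measurable_box n (A : 'I_n -> set (measurableTypeR R)) :
  (forall i, measurable (A i)) ->
  measurable [set x : 'rV[R]_n | forall i, A i (x ord0 i)].
Proof.
move=> mA.
rewrite (_ : [set x | _] =
    \bigcap_(i in [set: 'I_n]) (fun x : 'rV[R]_n => x ord0 i : R) @^-1` A i).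
  apply: fin_bigcap_measurable; [exact: finite_finset|move=> i _].
  by rewrite -[X in measurable X]setTI; apply: measurable_rV_coordR => //; exact: mA.
by apply/seteqP; split => x /= Ax i; [move=> _; exact: Ax|exact: Ax].
Qed.

Lemma measurable_dotp d (T : measurableType d) n (f g : T -> 'rV[R]_n) :
  measurable_fun setT f -> measurable_fun setT g ->
  measurable_fun setT (fun x => dotp (f x) (g x)).
Proof.
move=> mf mg; rewrite /dotp.
apply: measurable_sum => i; apply: measurable_funM.
- exact: (measurableT_comp (measurable_rV_coordR i)).
- exact: (measurableT_comp (measurable_rV_coordR i)).
Qed.

Lemma measurable_subrV d (T : measurableType d) n (f g : T -> 'rV[R]_n) :
  measurable_fun setT f -> measurable_fun setT g ->
  measurable_fun setT (fun x => f x - g x).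
Proof.
move=> mf mg; apply: measurable_fun_rV => i.
rewrite (_ : _ \o _ = (fun x => f x ord0 i - g x ord0 i)); last first.
  by apply/funext => x; rewrite /rV_coord /= !mxE.
apply: measurable_funB.
- exact: (measurableT_comp (measurable_rV_coordR i)).
- exact: (measurableT_comp (measurable_rV_coordR i)).
Qed.

Lemma dotp_cons n (z : 'rV[R]_n.+1) t y :
  dotp z (cons_rV (t, y)) = z ord0 ord0 * t + dotp (uncons_rV z).2 y.
Proof.
rewrite /dotp big_ord_recl !mxE unlift_none /=; congr (_ + _).
by apply: eq_bigr => i _; rewrite !mxE liftK.
Qed.

End integral_rV.

(** * The heat kernel *)

Section heat_kernel.
Context {R : realType}.
Local Notation leb := (@lebesgue_measure R).
Local Notation mu := (@lebesgue_rV R _).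

(** The Gauss-Weierstrass kernel [(4 pi s)^(-1/2) exp (- z^2 / 4 s)], with the
    normalisation in the shape in which the inverse Fourier transform of
    [exp (- s xi^2)] produces it. *)
Definition heat1 (s z : R) : R :=
  (2 * pi)^-1 * (Num.sqrt (pi / s) * expR (- (z ^+ 2 / (4 * s)))).

Definition heat n (s : R) (z : 'rV[R]_n) : R := \prod_(i < n) heat1 s (z ord0 i).

Lemma heat1_gt0 s z : 0 < s -> 0 < heat1 s z.
Proof.
by move=> s0; rewrite !mulr_gt0 ?invr_gt0 ?expR_gt0 ?sqrtr_gt0 ?divr_gt0 ?mulr_gt0 ?pi_gt0.
Qed.

Lemma heat_gt0 n s (z : 'rV[R]_n) : 0 < s -> 0 < heat s z.
Proof. by move=> s0; apply: prodr_gt0 => i _; exact: heat1_gt0. Qed.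

Lemma heat_ge0 n s (z : 'rV[R]_n) : 0 < s -> 0 <= heat s z.
Proof. by move=> s0; exact/ltW/heat_gt0. Qed.

Lemma measurable_heat1 s : measurable_fun setT (heat1 s).
Proof.
apply: measurable_funM => //; apply: measurable_funM => //.
apply: measurableT_comp => //; apply: measurableT_comp => //.
by apply: measurable_funM => //; exact: measurable_funX.
Qed.

Lemma measurable_heat n s : measurable_fun setT (@heat n s).
Proof.
apply: measurable_prod => i _.
exact: (measurableT_comp (measurable_heat1 s) (measurable_rV_coordR i)).
Qed.

Lemma heatE n s (z : 'rV[R]_n) :
  heat s z = ((2 * pi)^-1 * Num.sqrt (pi / s)) ^+ n *
             expR (- (dotp z z / (4 * s))).
Proof.
rewrite /heat /dotp mulr_suml -sumrN expR_sum.
rewrite (_ : _ ^+ n = \prod_(i < n) ((2 * pi)^-1 * Num.sqrt (pi / s))); last first.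
  by rewrite prodr_const card_ord.
by rewrite -big_split /=; apply: eq_bigr => i _; rewrite /heat1 mulrA.
Qed.

Lemma heat_cons n s (z : 'rV[R]_n.+1) :
  heat s z = heat1 s (z ord0 ord0) * heat s (uncons_rV z).2.
Proof.
by rewrite /heat big_ord_recl; congr (_ * _); apply: eq_bigr => i _; rewrite mxE.
Qed.

Lemma integral_heat1 s : 0 < s -> (\int[leb]_z (heat1 s z)%:E = 1)%E.
Proof.
move=> s0; have s4 : 0 < (4 * s)^-1 by rewrite invr_gt0 mulr_gt0.
have ig := integrable_gauss s4.
rewrite -[LHS]fineK; last first.
  apply: integrable_fin_num => //.
  apply: eq_integrable (integrableRZ ((2 * pi)^-1 * Num.sqrt (pi / s)) ig) => // z _ /=.
  by rewrite /heat1 -mulrA [_ / (4 * s)]mulrC.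
rewrite -[fine _]/(Rintegral _ _ _) (_ : heat1 s = fun z => (2 * pi)^-1 * Num.sqrt (pi / s) * expR (- ((4 * s)^-1 * z ^+ 2))); last first.
  by apply/funext => z; rewrite /heat1 -mulrA [_ / (4 * s)]mulrC.
rewrite RintegralZl// Rintegral_gauss// -mulrA -sqrtrM; last first.
  by rewrite divr_ge0 ?pi_ge0// ltW.
rewrite (_ : pi / s * _ = (2 * pi) ^+ 2); last by field; rewrite gt_eqF.
rewrite sqrtr_sqr ger0_norm ?mulr_ge0 ?pi_ge0// mulVf//.
by rewrite mulf_neq0// gt_eqF ?pi_gt0.
Qed.

Lemma integral_heat n s (x : 'rV[R]_n) : 0 < s ->
  (\int[mu]_y (heat s (x - y))%:E = 1)%E.
Proof.
move=> s0.
transitivity (\int[mu]_y (\prod_(i < n) heat1 s (-1 * (y ord0 i) + x ord0 i))%:E)%E.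
  apply: eq_integral => y _; congr _%:E; apply: eq_bigr => i _.
  by rewrite !mxE mulN1r addrC.
rewrite (ge0_integral_rV_prod (f := fun i t => heat1 s (-1 * t + x ord0 i))).
- rewrite big1// => i _.
  rewrite (@ge0_integral_affine R (-1) (x ord0 i) (fun t => (heat1 s t)%:E))//.
  + by rewrite integral_heat1// normrN1 invr1 mule1.
  + by apply/measurable_EFinP; exact: measurable_heat1.
  + by move=> t; rewrite lee_fin ltW// heat1_gt0.
- by move=> i; exact: (measurableT_comp (measurable_heat1 s) (measurable_affine _ _)).
- by move=> i t; rewrite ltW// heat1_gt0.
Qed.

Lemma heatC n s (x y : 'rV[R]_n) : heat s (x - y) = heat s (y - x).
Proof.
by apply: eq_bigr => i _; rewrite /heat1 !mxE -opprB sqrrN.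
Qed.

Definition gauss_rV n (s : R) (xi : 'rV[R]_n) : R := expR (- (s * dotp xi xi)).

Lemma measurable_gauss_rV n s : measurable_fun setT (@gauss_rV n s).
Proof.
apply: measurableT_comp => //; apply: measurableT_comp => //.
by apply: measurable_funM => //; exact: measurable_dotp.
Qed.

Lemma integrable_gauss_rV n s : 0 < s ->
  (mu : {measure set 'rV[R]_n -> \bar R}).-integrable setT (EFin \o gauss_rV s).
Proof.
move=> s0; apply/integrableP; split.
  by apply/measurable_EFinP; exact: measurable_gauss_rV.
rewrite (_ : (fun _ => _) = (fun x : 'rV[R]_n =>
   (\prod_(i < n) expR (- (s * x ord0 i ^+ 2)))%:E)); last first.
  apply/funext => x /=; rewrite ger0_norm ?expR_ge0//; congr _%:E.
  by rewrite /gauss_rV /dotp mulr_sumr -sumrN expR_sum.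
rewrite (ge0_integral_rV_prod (f := fun=> fun t : R => expR (- (s * t ^+ 2)))).
- have ig := integrable_fin_num measurableT (integrable_gauss s0).
  by rewrite ltey_eq; apply/orP; left; apply/prode_fin_num.
- by move=> _; exact: (integrable_measurableR (integrable_gauss s0)).
- by move=> _ t; exact: expR_ge0.
Qed.

Lemma abs_gauss_cos_le n s (xi : 'rV[R]_n) th : `|gauss_rV s xi * cos th| <= gauss_rV s xi.
Proof.
rewrite normrM ger0_norm ?expR_ge0// ler_piMr ?expR_ge0//.
by rewrite ler_norml cos_geN1 cos_le1.
Qed.

Lemma integrable_gauss_cos_rV n s th (z : 'rV[R]_n) : 0 < s ->
  mu.-integrable setT (EFin \o (fun xi => gauss_rV s xi * cos (th + dotp z xi))).
Proof.
move=> s0; apply: (@le_integrableR _ _ _ _ _ (gauss_rV s)).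
- apply: measurable_funM; first exact: measurable_gauss_rV.
  apply: (measurableT_comp (continuous_measurable_fun (@continuous_cos R))).
  by apply: measurable_funD => //; exact: measurable_dotp.
- by move=> xi; exact: abs_gauss_cos_le.
- exact: integrable_gauss_rV.
Qed.

(** Carrying an arbitrary phase [th] makes the induction on the dimension go
    through without splitting the cosine of a sum. *)
Lemma Rintegral_gauss_cos_rV n s th (z : 'rV[R]_n) : 0 < s ->
  \int[mu]_xi (gauss_rV s xi * cos (th + dotp z xi)) =
  (2 * pi) ^+ n * (cos th * heat s z).
Proof.
move=> s0; elim: n th z => [|n IH] th z.
  rewrite /Rintegral integral_dirac//; last first.
    exact: measurable_int (integrable_gauss_cos_rV th z s0).
  rewrite diracE mem_set// mul1e /= expr0 mul1r /heat big_ord0 mulr1.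
  by rewrite /gauss_rV /dotp !big_ord0 mulr0 oppr0 expR0 mul1r addr0.
rewrite Rintegral_rV_cons; first last.
- move=> t; have := integrableRZ (expR (- (s * t ^+ 2)))
    (integrable_gauss_cos_rV (th + z ord0 ord0 * t) (uncons_rV z).2 s0).
  apply: eq_integrable => // y _ /=; congr _%:E.
  rewrite mulrA dotp_cons addrA; congr (_ * _).
  rewrite /gauss_rV -expRD; congr expR; rewrite dotp_cons cons_rVK /=.
  by rewrite mxE unlift_none /=; ring.
- exact: integrable_gauss_cos_rV.
transitivity (\int[leb]_t ((2 * pi) ^+ n * heat s (uncons_rV z).2 *
    (expR (- (s * t ^+ 2)) * cos (th + z ord0 ord0 * t)))).
  apply: eq_Rintegral => t _.
  transitivity (expR (- (s * t ^+ 2)) * \int[mu]_y (gauss_rV s y * cos ((th + z ord0 ord0 * t) + dotp (uncons_rV z).2 y))).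
    rewrite -RintegralZl//; last exact: integrable_gauss_cos_rV.
    apply: eq_Rintegral => y _.
    rewrite mulrA dotp_cons addrA; congr (_ * _).
    rewrite /gauss_rV -expRD; congr expR; rewrite dotp_cons cons_rVK /=.
    by rewrite mxE unlift_none /=; ring.
  by rewrite IH; ring.
rewrite RintegralZl//; last first.
  apply: (@le_integrableR _ _ _ leb _ (fun t => expR (- (s * t ^+ 2)))).
  - apply: measurable_funM; first exact: (integrable_measurableR (integrable_gauss s0)).
    apply: (measurableT_comp (continuous_measurable_fun (@continuous_cos R))).
    by apply: measurable_funD => //; apply: measurable_funM.
  - move=> t; rewrite normrM ger0_norm ?expR_ge0// ler_piMr ?expR_ge0//.
    by rewrite ler_norml cos_geN1 cos_le1.
  - exact: integrable_gauss.
rewrite Rintegral_gauss_cos// heat_cons [_ ^+ n.+1]exprS [heat1 _ _]/heat1.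
have : 2 * pi != 0 :> R by rewrite mulf_neq0// gt_eqF ?pi_gt0.
move: (2 * pi) (expR _) (heat _ _) => p e h p0; by field.
Qed.

End heat_kernel.

(** * Square integrability and the heat form *)

Section square_integrable.
Context d (T : measurableType d) (R : realType) (mu : {measure set T -> \bar R}).
Implicit Types f g : T -> R.

Definition sqint f := measurable_fun setT f /\
  mu.-integrable setT (EFin \o (fun x => f x ^+ 2)).

Lemma sqint_mul f g : sqint f -> sqint g ->
  mu.-integrable setT (EFin \o (fun x => f x * g x)).
Proof.
move=> [mf f2] [mg g2].
apply: (@le_integrableR _ _ _ _ _ (fun x => f x ^+ 2 + g x ^+ 2)).
- exact: measurable_funM.
- by move=> x; rewrite ler_norml; apply/andP; split; nra.
- exact: integrableRD.
Qed.

Lemma sqintZ k f : sqint f -> sqint (fun x => k * f x).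
Proof.
move=> [mf f2]; split; first exact: measurable_funM.
by under eq_fun do rewrite exprMn; exact: integrableRZ.
Qed.

Lemma sqintD f g : sqint f -> sqint g -> sqint (fun x => f x + g x).
Proof.
move=> [mf f2] [mg g2]; split; first exact: measurable_funD.
apply: (@le_integrableR _ _ _ _ _ (fun x => 2 * (f x ^+ 2 + g x ^+ 2))).
- by apply: measurable_funX; exact: measurable_funD.
- by move=> x; rewrite ger0_norm ?sqr_ge0//; have := sqr_ge0 (f x - g x); lra.
- by apply: integrableRZ; exact: integrableRD.
Qed.

Lemma sqintB f g : sqint f -> sqint g -> sqint (fun x => f x - g x).
Proof.
move=> fi /(sqintZ (-1)) gi; have := sqintD fi gi.
by under eq_fun do rewrite mulN1r.
Qed.

Lemma sqint_bounded (k f : T -> R) : measurable_fun setT k ->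
  (forall x, `|k x| <= 1) -> sqint f -> sqint (fun x => k x * f x).
Proof.
move=> mk k1 [mf f2]; split; first exact: measurable_funM.
apply: (@le_integrableR _ _ _ _ _ (fun x => f x ^+ 2)) => //.
- by apply: measurable_funX; exact: measurable_funM.
- move=> x; rewrite ger0_norm ?sqr_ge0// exprMn ler_piMl ?sqr_ge0//.
  by rewrite -(real_normK (num_real (k x))) expr_le1.
Qed.

(** Used with a free parameter [e] in place of the Cauchy-Schwarz inequality:
    it integrates termwise, and [e] is chosen at the end. *)
Lemma young (e a b : R) : 0 < e -> 2 * `|a * b| <= e^-1 * a ^+ 2 + e * b ^+ 2.
Proof.
move=> e0; rewrite normrM -(real_normK (num_real a)) -(real_normK (num_real b)) -subr_ge0.
rewrite (_ : _ - _ = e^-1 * (`|a| - e * `|b|) ^+ 2).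
  by rewrite mulr_ge0 ?sqr_ge0// invr_ge0 ltW.
by field; rewrite gt_eqF.
Qed.

End square_integrable.

Section heat_form.
Context {R : realType} {n : nat}.
Local Notation mu := (@lebesgue_rV R n).
Local Notation mu2 := (mu \x mu)%E.
Implicit Types f g : 'rV[R]_n -> R.

(** The quadratic form [<exp(s Delta) f, g>] of the heat semigroup. *)
Definition heat_form (s : R) f g : R :=
  \int[mu2]_p (heat s (p.1 - p.2) * (f p.1 * g p.2)).

Lemma measurable_heat_diff s :
  measurable_fun setT (fun p : 'rV[R]_n * 'rV[R]_n => heat s (p.1 - p.2)).
Proof.
apply: (measurableT_comp (@measurable_heat R n s)).
by apply: measurable_subrV; [exact: measurable_fst|exact: measurable_snd].
Qed.

Let mfst f : measurable_fun setT f ->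
  measurable_fun setT (fun p : 'rV[R]_n * 'rV[R]_n => f p.1).
Proof. by move=> mf; exact: (measurableT_comp mf measurable_fst). Qed.

Let msnd f : measurable_fun setT f ->
  measurable_fun setT (fun p : 'rV[R]_n * 'rV[R]_n => f p.2).
Proof. by move=> mf; exact: (measurableT_comp mf measurable_snd). Qed.

Let integral_heatZ s x (c : R) : 0 < s -> 0 <= c ->
  (\int[mu]_y (heat s (x - y) * c)%:E = c%:E)%E.
Proof.
move=> s0 c0; under eq_integral do rewrite mulrC EFinM.
rewrite ge0_integralZl//; first by rewrite integral_heat// mule1.
- apply/measurable_EFinP; apply: (measurableT_comp (@measurable_heat R n s)).
  exact: measurable_subrV.
- by move=> y _; rewrite lee_fin heat_ge0.
Qed.

Let integral_heatZ' s y (c : R) : 0 < s -> 0 <= c ->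
  (\int[mu]_x (heat s (x - y) * c)%:E = c%:E)%E.
Proof.
by move=> s0 c0; under eq_integral do rewrite heatC; exact: integral_heatZ.
Qed.

(** Tonelli, because the kernel has mass one in each of its variables. *)
Lemma heat_marginal1 s f : 0 < s -> measurable_fun setT f -> (forall x, 0 <= f x) ->
  mu.-integrable setT (EFin \o f) ->
  mu2.-integrable setT
    (EFin \o (fun p => heat s (p.1 - p.2) * f p.1)) /\
  \int[mu2]_p (heat s (p.1 - p.2) * f p.1) = \int[mu]_x f x.
Proof.
move=> s0 mf f0 fi.
have mh : measurable_fun setT (fun p : 'rV[R]_n * 'rV[R]_n => heat s (p.1 - p.2) * f p.1).
  by apply: measurable_funM; [exact: measurable_heat_diff|exact: mfst].
split.
  apply: (integrable_prod1 mh fi) => x /=.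
  under eq_integral do rewrite ger0_norm ?mulr_ge0 ?heat_ge0//.
  by rewrite integral_heatZ.
rewrite /Rintegral fubini_tonelli1//; last 2 first.
- exact/measurable_EFinP.
- by move=> p; rewrite lee_fin mulr_ge0 ?heat_ge0.
by congr fine; apply: eq_integral => x _; rewrite /fubini_F /= integral_heatZ.
Qed.

Lemma heat_marginal2 s f : 0 < s -> measurable_fun setT f -> (forall x, 0 <= f x) ->
  mu.-integrable setT (EFin \o f) ->
  mu2.-integrable setT
    (EFin \o (fun p => heat s (p.1 - p.2) * f p.2)) /\
  \int[mu2]_p (heat s (p.1 - p.2) * f p.2) = \int[mu]_x f x.
Proof.
move=> s0 mf f0 fi.
have mh : measurable_fun setT (fun p : 'rV[R]_n * 'rV[R]_n => heat s (p.1 - p.2) * f p.2).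
  by apply: measurable_funM; [exact: measurable_heat_diff|exact: msnd].
split.
  apply: (integrable_prod2 mh fi) => y /=.
  under eq_integral do rewrite ger0_norm ?mulr_ge0 ?heat_ge0//.
  by rewrite integral_heatZ'.
rewrite /Rintegral fubini_tonelli2//; last 2 first.
- exact/measurable_EFinP.
- by move=> p; rewrite lee_fin mulr_ge0 ?heat_ge0.
by congr fine; apply: eq_integral => y _; rewrite /fubini_G /= integral_heatZ'.
Qed.

Let sqr_marginals s f g : 0 < s -> sqint mu f -> sqint mu g ->
  [/\ mu2.-integrable setT (EFin \o (fun p => heat s (p.1 - p.2) * f p.1 ^+ 2)),
  mu2.-integrable setT (EFin \o (fun p => heat s (p.1 - p.2) * g p.2 ^+ 2)),
  \int[mu2]_p (heat s (p.1 - p.2) * f p.1 ^+ 2) = \int[mu]_x (f x ^+ 2) &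
  \int[mu2]_p (heat s (p.1 - p.2) * g p.2 ^+ 2) = \int[mu]_x (g x ^+ 2)].
Proof.
move=> s0 [mf f2] [mg g2].
have [||i1 e1] := @heat_marginal1 s (fun x => f x ^+ 2) s0 _ _ f2.
- exact: measurable_funX.
- by move=> x; exact: sqr_ge0.
have [||i2 e2] := @heat_marginal2 s (fun x => g x ^+ 2) s0 _ _ g2.
- exact: measurable_funX.
- by move=> x; exact: sqr_ge0.
by [].
Qed.

Lemma integrable_heat_form s f g : 0 < s -> sqint mu f -> sqint mu g ->
  mu2.-integrable setT
    (EFin \o (fun p => heat s (p.1 - p.2) * (f p.1 * g p.2))).
Proof.
move=> s0 fi gi; have [i1 i2 _ _] := sqr_marginals s0 fi gi.
apply: (@le_integrableR _ _ R mu2 _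
  (fun p : 'rV[R]_n * 'rV[R]_n => heat s (p.1 - p.2) * f p.1 ^+ 2 + heat s (p.1 - p.2) * g p.2 ^+ 2)).
- apply: measurable_funM; first exact: measurable_heat_diff.
  by apply: measurable_funM; [apply: mfst; case: fi|apply: msnd; case: gi].
- move=> p; rewrite normrM ger0_norm ?heat_ge0// -mulrDr ler_wpM2l ?heat_ge0//.
  by rewrite ler_norml; apply/andP; split; nra.
- exact: integrableRD.
Qed.

Lemma heat_formDl s f1 f2 g : 0 < s -> sqint mu f1 -> sqint mu f2 -> sqint mu g ->
  heat_form s (fun x => f1 x + f2 x) g = heat_form s f1 g + heat_form s f2 g.
Proof.
move=> s0 i1 i2 ig; rewrite /heat_form -RintegralD//; [|exact: integrable_heat_form..].
by apply: eq_Rintegral => p _; ring.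
Qed.

Lemma heat_formDr s f g1 g2 : 0 < s -> sqint mu f -> sqint mu g1 -> sqint mu g2 ->
  heat_form s f (fun x => g1 x + g2 x) = heat_form s f g1 + heat_form s f g2.
Proof.
move=> s0 i1 i2 ig; rewrite /heat_form -RintegralD//; [|exact: integrable_heat_form..].
by apply: eq_Rintegral => p _; ring.
Qed.

Lemma heat_formZl s k f g : 0 < s -> sqint mu f -> sqint mu g ->
  heat_form s (fun x => k * f x) g = k * heat_form s f g.
Proof.
move=> s0 i1 ig; rewrite /heat_form -RintegralZl//; last exact: integrable_heat_form.
by apply: eq_Rintegral => p _; ring.
Qed.

Lemma heat_formZr s k f g : 0 < s -> sqint mu f -> sqint mu g ->
  heat_form s f (fun x => k * g x) = k * heat_form s f g.
Proof.
move=> s0 i1 ig; rewrite /heat_form -RintegralZl//; last exact: integrable_heat_form.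
by apply: eq_Rintegral => p _; ring.
Qed.

Lemma heat_form_young s f g (e : R) : 0 < s -> 0 < e -> sqint mu f -> sqint mu g ->
  2 * `|heat_form s f g| <=
  e^-1 * \int[mu]_x (f x ^+ 2) + e * \int[mu]_x (g x ^+ 2).
Proof.
move=> s0 e0 fi gi; have [i1 i2 <- <-] := sqr_marginals s0 fi gi.
have fg := integrable_heat_form s0 fi gi.
apply: (@le_trans _ _ (2 * \int[mu2]_p `|heat s (p.1 - p.2) * (f p.1 * g p.2)|)).
  by rewrite ler_wpM2l//; exact: le_normr_Rintegral.
rewrite -!RintegralZl//; last exact: integrable_norm.
rewrite -RintegralD//; [|exact: integrableRZ..].
apply: le_Rintegral => //.
- by apply: integrableRZ; exact: integrable_norm.
- by apply: integrableRD; exact: integrableRZ.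
- move=> p _; rewrite normrM [`|heat _ _|]ger0_norm ?heat_ge0//.
  have := young (f p.1) (g p.2) e0; have := heat_ge0 (p.1 - p.2) s0.
  move: (heat _ _) `|_ * _| e^-1 => h c e' h0 H.
  have := ler_wpM2l h0 H; lra.
Qed.

(** Since the kernel is stochastic, [<f, g> - <exp(s Delta) f, g>] is the
    integral of [(f y - f x) g y] against it, and [<f, f> - <exp(s Delta) f, f>]
    controls the first factor. *)
Lemma heat_form_approx s f g (e : R) : 0 < s -> 0 < e -> sqint mu f -> sqint mu g ->
  2 * `|\int[mu]_x (f x * g x) - heat_form s f g| <=
  e^-1 * (2 * (\int[mu]_x (f x ^+ 2) - heat_form s f f)) +
  e * \int[mu]_x (g x ^+ 2).
Proof.
move=> s0 e0 fi gi; have [i1 i2 e1 e2] := sqr_marginals s0 fi gi.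
have [_ i2' _ e2'] := sqr_marginals s0 fi fi.
have fg := integrable_heat_form s0 fi gi.
have ff := integrable_heat_form s0 fi fi.
(* By stochasticity the integral of [f * g] is one against the kernel too. *)
have [dg edg] : mu2.-integrable setT
    (EFin \o (fun p => heat s (p.1 - p.2) * (f p.2 * g p.2))) /\
    \int[mu2]_p (heat s (p.1 - p.2) * (f p.2 * g p.2)) = \int[mu]_x (f x * g x).
  have fgi := sqint_mul fi gi; have mfg := integrable_measurableR fgi.
  have mp : measurable_fun setT (fun p : 'rV[R]_n * 'rV[R]_n => heat s (p.1 - p.2) * (f p.2 * g p.2)).
    by apply: measurable_funM; [exact: measurable_heat_diff|exact: (msnd mfg)].
  have ip : mu2.-integrable setT
    (EFin \o (fun p => heat s (p.1 - p.2) * (f p.2 * g p.2))).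
    apply: (integrable_prod2 mp (integrable_norm fgi)) => y /=.
    under eq_integral do rewrite normrM ger0_norm ?heat_ge0//.
    by rewrite integral_heatZ'.
  split=> //; rewrite (Rfubini2 ip) => [|y].
    apply: eq_Rintegral => y _ /=; rewrite RintegralZr//=.
      rewrite /Rintegral; under eq_integral do rewrite heatC.
      by rewrite integral_heat// mul1r.
    apply/integrableP; split.
      apply/measurable_EFinP; apply: (measurableT_comp (@measurable_heat R n s)).
      exact: measurable_subrV.
    under eq_integral do rewrite /= ger0_norm ?heat_ge0//.
    under eq_integral do rewrite heatC.
    by rewrite integral_heat// ltry.
  apply/integrableP; split.
    apply/measurable_EFinP; apply: measurable_funM => //=.
    apply: (measurableT_comp (@measurable_heat R n s)).
    exact: measurable_subrV.
  under eq_integral do rewrite /= normrM ger0_norm ?heat_ge0//.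
  by rewrite integral_heatZ'// ltry.
have H : \int[mu]_x (f x * g x) - heat_form s f g =
    \int[mu2]_p (heat s (p.1 - p.2) * ((f p.2 - f p.1) * g p.2)).
  rewrite -edg /heat_form -RintegralB//.
  by apply: eq_Rintegral => p _; ring.
have [id Ed] : mu2.-integrable setT
    (EFin \o (fun p => heat s (p.1 - p.2) * (f p.2 - f p.1) ^+ 2)) /\
    \int[mu2]_p (heat s (p.1 - p.2) * (f p.2 - f p.1) ^+ 2) =
    2 * (\int[mu]_x (f x ^+ 2) - heat_form s f f).
  have E (p : 'rV[R]_n * 'rV[R]_n) : heat s (p.1 - p.2) * (f p.2 - f p.1) ^+ 2 =
     (heat s (p.1 - p.2) * f p.1 ^+ 2 + heat s (p.1 - p.2) * f p.2 ^+ 2) -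
     2 * (heat s (p.1 - p.2) * (f p.1 * f p.2)) by ring.
  split.
    under eq_fun do rewrite E.
    by apply: integrableRB; [exact: integrableRD|exact: integrableRZ].
  under eq_Rintegral do rewrite E.
  rewrite RintegralB//; [|exact: integrableRD|exact: integrableRZ].
  by rewrite RintegralD// RintegralZl// e1 e2' /heat_form; ring.
have iH : mu2.-integrable setT
    (EFin \o (fun p => heat s (p.1 - p.2) * ((f p.2 - f p.1) * g p.2))).
  have := integrableRB dg fg; apply: eq_integrable => // p _ /=.
  by congr _%:E; ring.
rewrite H -Ed -e2.
apply: (@le_trans _ _ (2 * \int[mu2]_p `|heat s (p.1 - p.2) * ((f p.2 - f p.1) * g p.2)|)).
  by rewrite ler_wpM2l//; exact: le_normr_Rintegral.
rewrite -!RintegralZl//; last exact: integrable_norm.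
rewrite -RintegralD//; [|exact: integrableRZ..].
apply: le_Rintegral => //.
- by apply: integrableRZ; exact: integrable_norm.
- by apply: integrableRD; exact: integrableRZ.
- move=> p _; rewrite normrM [`|heat _ _|]ger0_norm ?heat_ge0//.
  have := young (f p.2 - f p.1) (g p.2) e0; have := heat_ge0 (p.1 - p.2) s0.
  move: (heat _ _) `|_ * _| e^-1 => h c e' h0 H'.
  have := ler_wpM2l h0 H'; lra.
Qed.

End heat_form.

(** * Parseval with a Gaussian weight *)

Section pair_measure.
Context {R : realType} {n : nat}.
Local Notation mu := (@lebesgue_rV R n).

(** Lebesgue measure on pairs of points, declared sigma-finite so that it can
    in turn be a factor of a product. *)
Definition pair_measure : set ('rV[R]_n * 'rV[R]_n) -> \bar R := (mu \x mu)%E.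

HB.instance Definition _ := Measure.on pair_measure.

Let pair_measure_sigma_finite : sigma_finite setT pair_measure.
Proof.
have /sigma_finiteP[F [FT Fnd Foo]] := sigma_finiteT mu.
exists (fun k => F k `*` F k) => [|k].
  apply/esym/seteqP; split => // -[x y] _ /=.
  have [i _ Fi] : (\bigcup_i F i) x by rewrite -FT.
  have [j _ Fj] : (\bigcup_i F i) y by rewrite -FT.
  exists (maxn i j) => //; split.
    by apply: (subsetPset _ _ (Fnd _ _ (leq_maxl i j))).
  by apply: (subsetPset _ _ (Fnd _ _ (leq_maxr i j))).
have [mF Ffin] := Foo k; split; first exact: measurableX.
by rewrite [pair_measure _]product_measure1E// lte_mul_pinfty// ge0_fin_numE.
Qed.

HB.instance Definition _ := Measure_isSigmaFinite.Build _ _ _ pair_measure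
  pair_measure_sigma_finite.

End pair_measure.

Section cosine_transform.
Context {R : realType} {n : nat}.
Local Notation mu := (@lebesgue_rV R n).
Local Notation mu2 := (mu \x mu)%E.
Local Notation V := 'rV[R]_n.
Implicit Types (a b : V -> R) (th : R) (x xi : V).

Definition cos_transform a xi : R := \int[mu]_x (cos (dotp x xi) * a x).

Definition sin_transform a xi : R := \int[mu]_x (sin (dotp x xi) * a x).

Lemma dotp_ge0 x : 0 <= dotp x x.
Proof. by rewrite /dotp sumr_ge0// => i _; rewrite -expr2 sqr_ge0. Qed.

Lemma dotpBl x y xi : dotp (x - y) xi = dotp x xi - dotp y xi.
Proof.
by rewrite /dotp -sumrB; apply: eq_bigr => i _; rewrite !mxE mulrBl.
Qed.

Lemma measurable_cosR : measurable_fun setT (@cos R).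
Proof. exact: (continuous_measurable_fun (@continuous_cos R)). Qed.

Lemma normr_cos_le1 (t : R) : `|cos t| <= 1.
Proof. by rewrite ler_norml cos_geN1 cos_le1. Qed.

Lemma integrable_cosM th a xi : mu.-integrable setT (EFin \o a) ->
  mu.-integrable setT (EFin \o (fun x => cos (th + dotp x xi) * a x)).
Proof.
move=> ai; apply: integrableRM_bounded => //.
- apply: (measurableT_comp measurable_cosR); apply: measurable_funD => //.
  exact: measurable_dotp.
- by move=> x; exact: normr_cos_le1.
Qed.

(** Fubini, with the Gaussian weight integrated first. *)
Lemma gauss_cos_tensor s th a b : 0 < s ->
  mu.-integrable setT (EFin \o a) -> mu.-integrable setT (EFin \o b) ->
  let J := (fun p : V * (V * V) =>
    gauss_rV s p.1 * (cos (th + dotp (p.2.1 - p.2.2) p.1) * (a p.2.1 * b p.2.2))) in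
  [/\ mu.-integrable setT (EFin \o (fun xi => \int[mu2]_q J (xi, q))),
      mu2.-integrable setT (EFin \o (fun q => heat s (q.1 - q.2) * (a q.1 * b q.2))) &
  \int[mu]_xi \int[mu2]_q J (xi, q) =
  (2 * pi) ^+ n * (cos th * heat_form s a b)].
Proof.
move=> s0 ai bi J.
pose M : {sigma_finite_measure set (V * V)%type -> \bar R} := pair_measure.
have ma := integrable_measurableR ai; have mb := integrable_measurableR bi.
have abi : mu2.-integrable setT (EFin \o (fun q => a q.1 * b q.2)).
  exact: integrable_tensor.
have mab := integrable_measurableR abi.
have mxi : measurable_fun [set: V * (V * V)] fst by exact: measurable_fst.
have mx : measurable_fun [set: V * (V * V)] (fun p => p.2.1).
  exact: (measurableT_comp measurable_fst measurable_snd).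
have my : measurable_fun [set: V * (V * V)] (fun p => p.2.2).
  exact: (measurableT_comp measurable_snd measurable_snd).
have mphase : measurable_fun [set: V * (V * V)]
    (fun p => th + dotp (p.2.1 - p.2.2) p.1).
  by apply: measurable_funD => //; apply: measurable_dotp => //; exact: measurable_subrV.
have Ji : (mu \x M)%E.-integrable setT (EFin \o J).
  have := @integrable_tensor _ _ V (V * V)%type R mu M (gauss_rV s) (fun q => a q.1 * b q.2) (@integrable_gauss_rV R n s s0) abi.
  apply: le_integrable => //.
    apply/measurable_EFinP; apply: measurable_funM.
      exact: (measurableT_comp (@measurable_gauss_rV R n s)).
    apply: measurable_funM; first exact: (measurableT_comp measurable_cosR).
    exact: (measurableT_comp mab measurable_snd).
  move=> p _ /=; rewrite lee_fin !normrM ler_wpM2l// ler_piMl ?mulr_ge0//.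
  exact: normr_cos_le1.
have Jxi xi : mu2.-integrable setT (EFin \o (fun q => J (xi, q))).
  have h : mu2.-integrable setT (EFin \o (fun q =>
      cos (th + dotp (q.1 - q.2) xi) * (a q.1 * b q.2))).
    apply: integrableRM_bounded => //.
      apply: (measurableT_comp measurable_cosR); apply: measurable_funD => //.
      by apply: measurable_dotp => //; exact: measurable_subrV.
    by move=> q; exact: normr_cos_le1.
  exact: (integrableRZ (gauss_rV s xi) h).
have Jq q : mu.-integrable setT (EFin \o (fun xi => J (xi, q))).
  have := integrableRZ (a q.1 * b q.2) (integrable_gauss_cos_rV th (q.1 - q.2) s0).
  apply: eq_integrable => // xi _ /=; congr _%:E; rewrite /J /=; ring.
have [i1 e1] := Rfubini1 Ji (Jxi : forall xi, M.-integrable setT (EFin \o (fun q => J (xi, q)))); have e2 := Rfubini2 Ji Jq.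
have H q : \int[mu]_xi J (xi, q) =
    (2 * pi) ^+ n * cos th * (heat s (q.1 - q.2) * (a q.1 * b q.2)).
  transitivity (\int[mu]_xi (a q.1 * b q.2 *
      (gauss_rV s xi * cos (th + dotp (q.1 - q.2) xi)))).
    by apply: eq_Rintegral => xi _; rewrite /J /=; ring.
  rewrite RintegralZl//; last exact: integrable_gauss_cos_rV.
  rewrite Rintegral_gauss_cos_rV//; ring.
have hi : mu2.-integrable setT (EFin \o (fun q => heat s (q.1 - q.2) * (a q.1 * b q.2))).
  pose K := ((2 * pi)^-1 * Num.sqrt (pi / s)) ^+ n.
  have K0 : 0 <= K by rewrite exprn_ge0// mulr_ge0 ?sqrtr_ge0// invr_ge0 mulr_ge0 ?pi_ge0.
  apply: (@le_integrableR _ _ R mu2 _ (fun q : V * V => K * `|a q.1 * b q.2|)).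
  - by apply: measurable_funM => //; exact: measurable_heat_diff.
  - move=> q; rewrite normrM ger0_norm ?heat_ge0// ler_wpM2r// heatE -/K.
    rewrite ler_piMr// -expR0 ler_expR oppr_le0 divr_ge0 ?dotp_ge0//.
    by rewrite mulr_ge0// ltW.
  - by apply: integrableRZ; exact: integrable_norm.
split => //.
transitivity (\int[M]_q \int[mu]_xi J (xi, q)); first by rewrite -e2 e1.
 under eq_Rintegral do rewrite H.
by rewrite [LHS](@RintegralZl _ _ R M setT _ ((2 * pi) ^+ n * cos th) measurableT hi) -mulrA.
Qed.

Lemma measurable_sinR : measurable_fun setT (@sin R).
Proof. exact: (continuous_measurable_fun (@continuous_sin R)). Qed.

Lemma normr_sin_le1 (t : R) : `|sin t| <= 1.
Proof. by rewrite ler_norml sin_geN1 sin_le1. Qed.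

Lemma integrable_sinM a xi : mu.-integrable setT (EFin \o a) ->
  mu.-integrable setT (EFin \o (fun x => sin (dotp x xi) * a x)).
Proof.
move=> ai; apply: integrableRM_bounded => //.
- by apply: (measurableT_comp measurable_sinR); exact: measurable_dotp.
- by move=> x; exact: normr_sin_le1.
Qed.

Lemma integrable_cosM0 a xi : mu.-integrable setT (EFin \o a) ->
  mu.-integrable setT (EFin \o (fun x => cos (dotp x xi) * a x)).
Proof.
by move=> /(integrable_cosM 0 xi); under eq_fun do rewrite add0r.
Qed.

Lemma Rintegral_mul a b : mu.-integrable setT (EFin \o a) ->
  mu.-integrable setT (EFin \o b) ->
  \int[mu]_x a x * \int[mu]_y b y = \int[mu2]_q (a q.1 * b q.2).
Proof.
move=> ai bi; rewrite (Rfubini1 (integrable_tensor ai bi) _).2 => [|x].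
  under [RHS]eq_Rintegral do rewrite /= RintegralZl//.
  by rewrite RintegralZr.
exact: (integrableRZ (a x) bi).
Qed.

(** The integral over pairs of the wave in the difference of the points: the
    products of transforms below reduce to it by the addition formulas. *)
Definition wave_form th a b xi : R :=
  \int[mu2]_q (cos (th + dotp (q.1 - q.2) xi) * (a q.1 * b q.2)).

Lemma transform_products a b xi : mu.-integrable setT (EFin \o a) ->
  mu.-integrable setT (EFin \o b) ->
  [/\ cos_transform a xi * cos_transform b xi +
       sin_transform a xi * sin_transform b xi = wave_form 0 a b xi,
      cos_transform a xi * sin_transform b xi -
       sin_transform a xi * cos_transform b xi = wave_form (pi / 2) a b xi &
      sin_transform a xi * cos_transform b xi -
       cos_transform a xi * sin_transform b xi = wave_form (- (pi / 2)) a b xi].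
Proof.
move=> ai bi.
have [ca sa] := (integrable_cosM0 xi ai, integrable_sinM xi ai).
have [cb sb] := (integrable_cosM0 xi bi, integrable_sinM xi bi).
rewrite /cos_transform /sin_transform !Rintegral_mul//; split.
- rewrite -RintegralD//; [|exact: (integrable_tensor ca cb)|exact: (integrable_tensor sa sb)].
  apply: eq_Rintegral => q _; rewrite add0r dotpBl cosB; ring.
- rewrite -RintegralB//; [|exact: (integrable_tensor ca sb)|exact: (integrable_tensor sa cb)].
  apply: eq_Rintegral => q _; rewrite [pi / 2 + _]addrC cosDpihalf dotpBl sinB; ring.
- rewrite -RintegralB//; [|exact: (integrable_tensor sa cb)|exact: (integrable_tensor ca sb)].
  apply: eq_Rintegral => q _; rewrite [- (pi / 2) + _]addrC cosBpihalf dotpBl sinB; ring.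
Qed.

(** The phase [th] decides what survives: the cosine part for [th = 0], nothing
    for [th = pi / 2], since the kernel is even. *)
Lemma gauss_wave_form s th a b : 0 < s ->
  mu.-integrable setT (EFin \o a) -> mu.-integrable setT (EFin \o b) ->
  mu.-integrable setT (EFin \o (fun xi => gauss_rV s xi * wave_form th a b xi)) /\
  \int[mu]_xi (gauss_rV s xi * wave_form th a b xi) =
  (2 * pi) ^+ n * (cos th * heat_form s a b).
Proof.
move=> s0 ai bi; have [i1 _ e] := gauss_cos_tensor th s0 ai bi.
have E xi : \int[mu2]_q (gauss_rV s xi *
      (cos (th + dotp (q.1 - q.2) xi) * (a q.1 * b q.2))) =
    gauss_rV s xi * wave_form th a b xi.
  rewrite RintegralZl//; apply: integrableRM_bounded; last exact: integrable_tensor.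
    apply: (measurableT_comp measurable_cosR); apply: measurable_funD => //.
    by apply: measurable_dotp => //; exact: measurable_subrV.
  by move=> q; exact: normr_cos_le1.
split; first by move: i1; under eq_fun do rewrite /= E.
by rewrite -e; apply: eq_Rintegral => xi _; rewrite -E.
Qed.

End cosine_transform.

Section heat_plancherel.
Context {R : realType} {n : nat}.
Local Open Scope complex_scope.
Local Notation mu := (@lebesgue_rV R n).
Local Notation V := 'rV[R]_n.
Implicit Types (f g : V -> R[i]) (xi : V).

(** The real part of [z * conj w]. *)
Definition cdot (z w : R[i]) : R :=
  complex.Re z * complex.Re w + complex.Im z * complex.Im w.

Definition cintegrable f := mu.-integrable setT (EFin \o (fun x => complex.Re (f x))) /\
  mu.-integrable setT (EFin \o (fun x => complex.Im (f x))).

Lemma fourier_integralE f xi : cintegrable f ->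
  fourier_integral f xi =
  let c := (Num.sqrt (2 * pi)) ^- n in
  (c * (cos_transform (fun x => complex.Re (f x)) xi +
        sin_transform (fun x => complex.Im (f x)) xi)) +i*
  (c * (cos_transform (fun x => complex.Im (f x)) xi -
        sin_transform (fun x => complex.Re (f x)) xi)).
Proof.
move=> [fr fi] /=; set c := (Num.sqrt (2 * pi)) ^- n; rewrite /fourier_integral /cintegral -/c.
have eRe x : complex.Re (expi (- dotp x xi) * f x) =
    cos (dotp x xi) * complex.Re (f x) + sin (dotp x xi) * complex.Im (f x).
  by case: (f x) => p q; rewrite /expi /= cosN sinN; ring.
have eIm x : complex.Im (expi (- dotp x xi) * f x) =
    cos (dotp x xi) * complex.Im (f x) - sin (dotp x xi) * complex.Re (f x).
  by case: (f x) => p q; rewrite /expi /= cosN sinN; ring.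
under eq_Rintegral do rewrite eRe.
under [X in _ +i* X]eq_Rintegral do rewrite eIm.
rewrite RintegralD//; [|exact: integrable_cosM0|exact: integrable_sinM].
rewrite RintegralB//; [|exact: integrable_cosM0|exact: integrable_sinM].
rewrite /cos_transform /sin_transform.
by apply/eqP; rewrite eq_complex /=; apply/andP; split; apply/eqP; ring.
Qed.

(** The Parseval identity with a Gaussian weight: no approximation is involved,
    only Fubini and the transform of the Gaussian. *)
Lemma gauss_parseval s f g : 0 < s -> cintegrable f -> cintegrable g ->
  mu.-integrable setT (EFin \o (fun xi =>
    gauss_rV s xi * cdot (fourier_integral f xi) (fourier_integral g xi))) /\
  \int[mu]_xi (gauss_rV s xi * cdot (fourier_integral f xi) (fourier_integral g xi)) =
  heat_form s (fun x => complex.Re (f x)) (fun x => complex.Re (g x)) +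
  heat_form s (fun x => complex.Im (f x)) (fun x => complex.Im (g x)).
Proof.
move=> s0 fi gi; have [[f1 f2] [g1 g2]] := (fi, gi).
pose c : R := (Num.sqrt (2 * pi)) ^- n.
have pi20 : 0 < 2 * pi :> R by rewrite mulr_gt0 ?pi_gt0.
have c2 : c ^+ 2 * (2 * pi) ^+ n = 1.
  rewrite /c -exprVn -exprM mulnC exprM exprVn sqr_sqrtr ?ltW// -exprMn mulVf ?gt_eqF//.
  by rewrite expr1n.
pose fr x := complex.Re (f x); pose fm x := complex.Im (f x).
pose gr x := complex.Re (g x); pose gm x := complex.Im (g x).
have E xi : gauss_rV s xi * cdot (fourier_integral f xi) (fourier_integral g xi) =
    c ^+ 2 * ((gauss_rV s xi * wave_form 0 fr gr xi + gauss_rV s xi * wave_form 0 fm gm xi) +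
    (gauss_rV s xi * wave_form (pi / 2) fr gm xi +
     gauss_rV s xi * wave_form (- (pi / 2)) fm gr xi)).
  have [<- _ _] := transform_products xi f1 g1.
  have [<- _ _] := transform_products xi f2 g2.
  have [_ <- _] := transform_products xi f1 g2.
  have [_ _ <-] := transform_products xi f2 g1.
  rewrite !fourier_integralE// /cdot /= -/c -/fr -/fm -/gr -/gm; ring.
have [i1 e1] := gauss_wave_form 0 s0 f1 g1.
have [i2 e2] := gauss_wave_form 0 s0 f2 g2.
have [i3 e3] := gauss_wave_form (pi / 2) s0 f1 g2.
have [i4 e4] := gauss_wave_form (- (pi / 2)) s0 f2 g1.
have i12 := integrableRD i1 i2; have i34 := integrableRD i3 i4.
split.
  by under eq_fun do rewrite /= E; apply: integrableRZ; exact: integrableRD.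
under eq_Rintegral do rewrite E.
rewrite RintegralZl//; last exact: integrableRD.
rewrite RintegralD// !RintegralD// e1 e2 e3 e4 cos0 cosN cos_pihalf !mul1r !mul0r !mulr0 !addr0.
by rewrite -mulrDr mulrA c2 mul1r.
Qed.

End heat_plancherel.

(** * Complex square integrable functions *)

Section complex_square_integrable.
Context {R : realType} {n : nat}.
Local Open Scope complex_scope.
Local Notation mu := (@lebesgue_rV R n).
Local Notation V := 'rV[R]_n.
Implicit Types (f g u : V -> R[i]) (x xi : V).

Local Notation re f := (fun x => complex.Re (f x)).
Local Notation im f := (fun x => complex.Im (f x)).

Definition csqint f := sqint mu (re f) /\ sqint mu (im f).

Definition sqnorm f : R :=
  \int[mu]_x (complex.Re (f x) ^+ 2) + \int[mu]_x (complex.Im (f x) ^+ 2).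

Lemma sqnorm_ge0 f : 0 <= sqnorm f.
Proof. by rewrite addr_ge0// Rintegral_ge0// => x _; exact: sqr_ge0. Qed.

Let normc2 (z : R[i]) : Normc.normc z ^+ 2 = complex.Re z ^+ 2 + complex.Im z ^+ 2.
Proof. by case: z => a b /=; rewrite sqr_sqrtr// addr_ge0 ?sqr_ge0. Qed.

Let normc_ge0 (z : R[i]) : 0 <= Normc.normc z.
Proof. by case: z => a b; exact: sqrtr_ge0. Qed.

Let cLnorm2_sqr f : (cLnorm 2 f `^ 2 =
  \int[mu]_x (complex.Re (f x) ^+ 2 + complex.Im (f x) ^+ 2)%:E)%E.
Proof.
rewrite /cLnorm poweR_Lnorm//; apply: eq_integral => x _.
by rewrite /= ger0_norm// powR_mulrn// normc2.
Qed.

Lemma csqint_inL2 f : csqint f <-> inL 2 f.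
Proof.
split=> [[[mr ir] [mi ii]]|[[mr mi] fin]].
  split=> //; have := cLnorm2_sqr f.
  have /integrableP[_] := integrableRD ir ii.
  rewrite (_ : (fun x => _) = (fun x => (complex.Re (f x) ^+ 2 + complex.Im (f x) ^+ 2)%:E)); last first.
    by apply/funext => x /=; rewrite ger0_norm// addr_ge0 ?sqr_ge0.
  move=> + E; rewrite -E; case: (cLnorm 2 f) => [r _|/=|//]; first by rewrite ltry.
  by rewrite pnatr_eq0.
have fin2 : (\int[mu]_x (complex.Re (f x) ^+ 2 + complex.Im (f x) ^+ 2)%:E < +oo)%E.
  rewrite -cLnorm2_sqr; move: fin.
  by have : (0 <= cLnorm 2 f)%E by [exact: Lnorm_ge0]; case: (cLnorm 2 f) => [r _ _||]//=; rewrite ?ltry.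
have i2 : mu.-integrable setT (EFin \o (fun x => complex.Re (f x) ^+ 2 + complex.Im (f x) ^+ 2)).
  apply/integrableP; split.
    by apply/measurable_EFinP; apply: measurable_funD; exact: measurable_funX.
  apply: le_lt_trans fin2; apply: ge0_le_integral => //.
  - apply: measurableT_comp => //; apply/measurable_EFinP.
    by apply: measurable_funD; exact: measurable_funX.
  - apply/measurable_EFinP.
    by apply: measurable_funD; exact: measurable_funX.
  - by move=> x _ /=; rewrite ger0_norm// addr_ge0 ?sqr_ge0.
split; split => //.
- apply: le_integrableR i2; first exact: measurable_funX.
  by move=> x; rewrite ger0_norm ?sqr_ge0// lerDl sqr_ge0.
- apply: le_integrableR i2; first exact: measurable_funX.
  by move=> x; rewrite ger0_norm ?sqr_ge0// lerDr sqr_ge0.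
Qed.

Lemma cLnorm2E f : csqint f -> cLnorm 2 f = (Num.sqrt (sqnorm f))%:E.
Proof.
move=> [[mr ir] [mi ii]]; have := cLnorm2_sqr f.
have -> : (\int[mu]_x (complex.Re (f x) ^+ 2 + complex.Im (f x) ^+ 2)%:E = (sqnorm f)%:E)%E.
  rewrite /sqnorm -RintegralD// /Rintegral fineK//.
  exact: integrable_fin_num (integrableRD ir ii).
have : (0 <= cLnorm 2 f)%E by exact: Lnorm_ge0.
case: (cLnorm 2 f) => [r|_|//] /=.
  rewrite lee_fin => r0 [] h; congr _%:E.
  by rewrite -h powR_mulrn// sqrtr_sqr ger0_norm.
by rewrite pnatr_eq0.
Qed.

Lemma csqintD f g : csqint f -> csqint g -> csqint (fun x => f x + g x).
Proof.
move=> [fr fi] [gr gi].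
have er : re (fun x => f x + g x) = (fun x => complex.Re (f x) + complex.Re (g x)).
  by apply/funext => x; case: (f x) => ? ?; case: (g x).
have ei : im (fun x => f x + g x) = (fun x => complex.Im (f x) + complex.Im (g x)).
  by apply/funext => x; case: (f x) => ? ?; case: (g x).
by split; rewrite ?er ?ei; exact: sqintD.
Qed.

Lemma ReMC (r : R) (z : R[i]) : complex.Re (r%:C * z) = r * complex.Re z.
Proof. by case: z => a b /=; rewrite mul0r subr0. Qed.

Lemma ImMC (r : R) (z : R[i]) : complex.Im (r%:C * z) = r * complex.Im z.
Proof. by case: z => a b /=; rewrite mul0r addr0. Qed.

Lemma ReD (z w : R[i]) : complex.Re (z + w) = complex.Re z + complex.Re w.
Proof. by case: z => ? ?; case: w. Qed.

Lemma ImD (z w : R[i]) : complex.Im (z + w) = complex.Im z + complex.Im w.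
Proof. by case: z => ? ?; case: w. Qed.

Lemma ReB (z w : R[i]) : complex.Re (z - w) = complex.Re z - complex.Re w.
Proof. by case: z => ? ?; case: w. Qed.

Lemma ImB (z w : R[i]) : complex.Im (z - w) = complex.Im z - complex.Im w.
Proof. by case: z => ? ?; case: w. Qed.

Lemma csqintZ (r : R) f : csqint f -> csqint (fun x => r%:C * f x).
Proof.
move=> [fr fi]; split.
- by under eq_fun do rewrite ReMC; exact: sqintZ.
- by under eq_fun do rewrite ImMC; exact: sqintZ.
Qed.

Lemma csqintB f g : csqint f -> csqint g -> csqint (fun x => f x - g x).
Proof.
move=> [fr fi] [gr gi]; split.
- by under eq_fun do rewrite ReB; exact: sqintB.
- by under eq_fun do rewrite ImB; exact: sqintB.
Qed.

Lemma inL1_cintegrable f : inL 1 f -> cintegrable f.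
Proof.
move=> [[mr mi]]; rewrite /cLnorm Lnorm1 => fin.
have le1 (z : R[i]) : `|complex.Re z| <= Normc.normc z.
  rewrite -(ger0_norm (normc_ge0 z)) -ler_sqr ?nnegrE// !real_normK ?num_real//.
  by rewrite normc2 lerDl sqr_ge0.
have le2 (z : R[i]) : `|complex.Im z| <= Normc.normc z.
  rewrite -(ger0_norm (normc_ge0 z)) -ler_sqr ?nnegrE// !real_normK ?num_real//.
  by rewrite normc2 lerDr sqr_ge0.
have mn : measurable_fun setT (fun x => Normc.normc (f x)).
  rewrite (_ : (fun x => _) = (fun x => Num.sqrt (complex.Re (f x) ^+ 2 + complex.Im (f x) ^+ 2))); last first.
    by apply/funext => x; case: (f x).
  apply: (measurableT_comp (continuous_measurable_fun (@sqrt_continuous R))).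
  by apply: measurable_funD; exact: measurable_funX.
have ni : mu.-integrable setT (EFin \o (fun x => Normc.normc (f x))).
  by apply/integrableP; split; first exact/measurable_EFinP.
split; apply: le_integrableR ni => //.
Qed.

Lemma cvg_sqnorm (f_ : nat -> V -> R[i]) f : (forall k, csqint (f_ k)) -> csqint f ->
  cLnorm 2 (fun x => f_ k x - f x) @[k --> \oo] --> 0%E ->
  sqnorm (fun x => f_ k x - f x) @[k --> \oo] --> (0 : R).
Proof.
move=> fk fi.
rewrite (_ : (fun k => cLnorm 2 _) = (fun k => (Num.sqrt (sqnorm (fun x => f_ k x - f x)))%:E)); last first.
  by apply/funext => k; rewrite cLnorm2E//; exact: csqintB.
move=> /fine_cvg/= h; pose w k := Num.sqrt (sqnorm (fun x => f_ k x - f x)).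
have {}h : w k @[k --> \oo] --> (0 : R) by exact: h.
have : w k * w k @[k --> \oo] --> (0 * 0 : R) by exact: cvgM.
rewrite mulr0; under eq_fun do rewrite /w -expr2 sqr_sqrtr ?sqnorm_ge0//.
by [].
Qed.


(** The real part of the heat form of [f] and the conjugate of [g]. *)
Definition cheat_form s f g : R :=
  heat_form s (re f) (re g) + heat_form s (im f) (im g).

Definition gauss_pairing s f g : R :=
  \int[mu]_xi (gauss_rV s xi * cdot (f xi) (g xi)).

Lemma gauss_rV_le1 s xi : 0 <= s -> gauss_rV s xi <= 1.
Proof.
by move=> s0; rewrite /gauss_rV -expR0 ler_expR oppr_le0 mulr_ge0// dotp_ge0.
Qed.

Lemma integrable_cdot f g : csqint f -> csqint g ->
  mu.-integrable setT (EFin \o (fun x => cdot (f x) (g x))).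
Proof.
by move=> [fr fi] [gr gi]; apply: integrableRD; exact: sqint_mul.
Qed.

Lemma integrable_gauss_cdot s f g : 0 <= s -> csqint f -> csqint g ->
  mu.-integrable setT (EFin \o (fun xi => gauss_rV s xi * cdot (f xi) (g xi))).
Proof.
move=> s0 fi gi; apply: integrableRM_bounded; last exact: integrable_cdot.
- exact: measurable_gauss_rV.
- by move=> xi; rewrite ger0_norm ?expR_ge0// gauss_rV_le1.
Qed.

Lemma cheat_form_young s f g (e : R) : 0 < s -> 0 < e -> csqint f -> csqint g ->
  2 * `|cheat_form s f g| <= e^-1 * sqnorm f + e * sqnorm g.
Proof.
move=> s0 e0 [fr fi] [gr gi].
have := heat_form_young s0 e0 fr gr; have := heat_form_young s0 e0 fi gi.
have := ler_normD (heat_form s (re f) (re g)) (heat_form s (im f) (im g)).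
rewrite /cheat_form /sqnorm !mulrDr; lra.
Qed.

Lemma gauss_pairing_young s f g (e : R) : 0 <= s -> 0 < e -> csqint f -> csqint g ->
  2 * `|gauss_pairing s f g| <= e^-1 * sqnorm f + e * sqnorm g.
Proof.
move=> s0 e0 fi gi; have h := integrable_gauss_cdot s0 fi gi.
have [[[_ fr2] [_ fi2]] [[_ gr2] [_ gi2]]] := (fi, gi).
apply: (@le_trans _ _ (2 * \int[mu]_xi `|gauss_rV s xi * cdot (f xi) (g xi)|)).
  by rewrite ler_wpM2l//; exact: le_normr_Rintegral.
rewrite /sqnorm -!RintegralD// -!RintegralZl//; last 3 first.
- exact: integrableRD.
- exact: integrable_norm.
- exact: integrableRD.
rewrite -RintegralD//; [|by apply: integrableRZ; exact: integrableRD..].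
apply: le_Rintegral => //.
- by apply: integrableRZ; exact: integrable_norm.
- by apply: integrableRD; apply: integrableRZ; exact: integrableRD.
- move=> xi _; rewrite normrM [`|gauss_rV _ _|]ger0_norm ?expR_ge0//.
  have := young (complex.Re (f xi)) (complex.Re (g xi)) e0.
  have := young (complex.Im (f xi)) (complex.Im (g xi)) e0.
  have := ler_normD (complex.Re (f xi) * complex.Re (g xi)) (complex.Im (f xi) * complex.Im (g xi)).
  rewrite -/(cdot (f xi) (g xi)) !mulrDr.
  have : gauss_rV s xi * `|cdot (f xi) (g xi)| <= `|cdot (f xi) (g xi)|.
    by rewrite ler_piMl// gauss_rV_le1.
  lra.
Qed.

Lemma cheat_formBl s f f' g : 0 < s -> csqint f -> csqint f' -> csqint g ->
  cheat_form s (fun x => f x - f' x) g = cheat_form s f g - cheat_form s f' g.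
Proof.
move=> s0 [fr fi] [fr' fi'] [gr gi]; rewrite /cheat_form.
under [X in heat_form s X _ + _]eq_fun do rewrite ReB -mulN1r.
under [X in _ + heat_form s X _]eq_fun do rewrite ImB -mulN1r.
by rewrite !heat_formDl ?heat_formZl//; [ring|exact: sqintZ..].
Qed.

Lemma cheat_formDr s f g g' : 0 < s -> csqint f -> csqint g -> csqint g' ->
  cheat_form s f (fun x => g x + g' x) = cheat_form s f g + cheat_form s f g'.
Proof.
move=> s0 [fr fi] [gr gi] [gr' gi']; rewrite /cheat_form.
under [X in heat_form s _ X + _]eq_fun do rewrite ReD.
under [X in _ + heat_form s _ X]eq_fun do rewrite ImD.
by rewrite !heat_formDr//; ring.
Qed.

Lemma cheat_formZr s f (k : R) g : 0 < s -> csqint f -> csqint g ->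
  cheat_form s f (fun x => k%:C * g x) = k * cheat_form s f g.
Proof.
move=> s0 [fr fi] [gr gi]; rewrite /cheat_form.
under [X in heat_form s _ X + _]eq_fun do rewrite ReMC.
under [X in _ + heat_form s _ X]eq_fun do rewrite ImMC.
by rewrite !heat_formZr//; ring.
Qed.

Lemma cheat_formBr s f g g' : 0 < s -> csqint f -> csqint g -> csqint g' ->
  cheat_form s f (fun x => g x - g' x) = cheat_form s f g - cheat_form s f g'.
Proof.
move=> s0 fi gi gi'.
rewrite (_ : (fun x => g x - g' x) = (fun x => g x + (-1)%:C * g' x)); last first.
  by apply/funext => x; rewrite rmorphN rmorph1 mulN1r.
by rewrite cheat_formDr ?cheat_formZr// ?mulN1r//; exact: csqintZ.
Qed.

Lemma gauss_pairingBl s f f' g : 0 <= s -> csqint f -> csqint f' -> csqint g ->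
  gauss_pairing s (fun x => f x - f' x) g = gauss_pairing s f g - gauss_pairing s f' g.
Proof.
move=> s0 fi fi' gi; rewrite /gauss_pairing -RintegralB//; [|exact: integrable_gauss_cdot..].
by apply: eq_Rintegral => xi _; rewrite /cdot ReB ImB; ring.
Qed.

Lemma gauss_pairingDr s f g g' : 0 <= s -> csqint f -> csqint g -> csqint g' ->
  gauss_pairing s f (fun x => g x + g' x) = gauss_pairing s f g + gauss_pairing s f g'.
Proof.
move=> s0 fi fi' gi; rewrite /gauss_pairing -RintegralD//; [|exact: integrable_gauss_cdot..].
by apply: eq_Rintegral => xi _; rewrite /cdot ReD ImD; ring.
Qed.

Lemma gauss_pairingBr s f g g' : 0 <= s -> csqint f -> csqint g -> csqint g' ->
  gauss_pairing s f (fun x => g x - g' x) = gauss_pairing s f g - gauss_pairing s f g'.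
Proof.
move=> s0 fi fi' gi; rewrite /gauss_pairing -RintegralB//; [|exact: integrable_gauss_cdot..].
by apply: eq_Rintegral => xi _; rewrite /cdot ReB ImB; ring.
Qed.

Lemma gauss_pairingZr s f (k : R) g : 0 <= s -> csqint f -> csqint g ->
  gauss_pairing s f (fun x => k%:C * g x) = k * gauss_pairing s f g.
Proof.
move=> s0 fi gi; rewrite /gauss_pairing -RintegralZl//; last exact: integrable_gauss_cdot.
by apply: eq_Rintegral => xi _; rewrite /cdot ReMC ImMC; ring.
Qed.

End complex_square_integrable.

(** * Plancherel transforms seen through Gaussian pairings *)

Section limn_einf_monotone.
Context {R : realType}.
Implicit Types u v : (\bar R)^nat.

Lemma le_limn_einf u v : (forall k, u k <= v k)%E ->
  (limn_einf u <= limn_einf v)%E.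
Proof.
move=> uv; rewrite !limn_einf_lim; apply: lee_lim.
- exact: is_cvg_einfs.
- exact: is_cvg_einfs.
- apply: nearW => k; apply: le_ereal_inf_tmp => _ [j kj <-].
  by apply: le_trans (uv j); apply: ereal_inf_lbound; exists j.
Qed.

Lemma limn_einf_le u (b : \bar R) : (forall k, u k <= b)%E -> (limn_einf u <= b)%E.
Proof.
move=> ub; have <- : limn_einf (fun=> b) = b.
  by apply: (cvg_limn_einf_sup _).1; exact: cvg_cst.
exact: le_limn_einf.
Qed.

Lemma limn_einf_ge u (a : (\bar R)^nat) l : (forall k, a k <= u k)%E ->
  a @ \oo --> l -> (l <= limn_einf u)%E.
Proof. by move=> au al; rewrite -(cvg_limn_einf_sup al).1; exact: le_limn_einf. Qed.

End limn_einf_monotone.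

Section fourier_duality.
Context {R : realType} {n : nat}.
Local Open Scope complex_scope.
Local Notation mu := (@lebesgue_rV R n).
Local Notation V := 'rV[R]_n.
Implicit Types (f g u : V -> R[i]) (x xi : V).

(** Fubini gives measurability of the transform times [exp (- |xi|^2)]; the
    weight makes the integrand integrable in both variables and is divided out
    afterwards. *)
Let measurable_gauss_transform (k : R -> R) (a : V -> R) :
  measurable_fun setT k -> (forall t, `|k t| <= 1) ->
  mu.-integrable setT (EFin \o a) ->
  measurable_fun setT (fun xi => \int[mu]_x (k (dotp x xi) * a x)).
Proof.
move=> mk k1 ai; have ma := integrable_measurableR ai.
pose J (p : V * V) := k (dotp p.2 p.1) * (gauss_rV 1 p.1 * a p.2).
have mphase : measurable_fun [set: V * V] (fun p => k (dotp p.2 p.1)).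
  apply: (measurableT_comp mk); apply: measurable_dotp; first exact: measurable_snd.
  exact: measurable_fst.
have Ji : (mu \x mu)%E.-integrable setT (EFin \o J).
  apply: integrableRM_bounded => //.
  exact: (integrable_tensor (@integrable_gauss_rV R n 1 ltr01) ai).
have Jxi xi : mu.-integrable setT (EFin \o (fun x => J (xi, x))).
  rewrite /J /=; apply: integrableRM_bounded.
  - by apply: (measurableT_comp mk); exact: measurable_dotp.
  - by [].
  - exact: integrableRZ.
have /integrable_measurableR m := (Rfubini1 Ji Jxi).1.
rewrite (_ : (fun xi => _) = (fun xi => expR (dotp xi xi) * \int[mu]_x J (xi, x))).
  apply: measurable_funM => //; apply: measurableT_comp => //.
  exact: measurable_dotp.
apply/funext => xi.
transitivity (expR (dotp xi xi) * \int[mu]_x (gauss_rV 1 xi * (k (dotp x xi) * a x))).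
  rewrite RintegralZl//.
    by rewrite mulrA /gauss_rV mul1r -expRD subrr expR0 mul1r.
  apply: integrableRM_bounded => //.
  by apply: (measurableT_comp mk); exact: measurable_dotp.
by congr (_ * _); apply: eq_Rintegral => x _; rewrite /J /=; ring.
Qed.

Lemma cmeasurable_fourier_integral f : cintegrable f -> cmeasurable (fourier_integral f).
Proof.
move=> fi; have [fr fm] := fi.
have mc (a : V -> R) : mu.-integrable setT (EFin \o a) ->
    measurable_fun setT (cos_transform a).
  by move=> ai; apply: measurable_gauss_transform => //;
    [exact: measurable_cosR|exact: normr_cos_le1].
have ms (a : V -> R) : mu.-integrable setT (EFin \o a) ->
    measurable_fun setT (sin_transform a).
  by move=> ai; apply: measurable_gauss_transform => //;
    [exact: measurable_sinR|exact: normr_sin_le1].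
split.
- under eq_fun do rewrite fourier_integralE//=.
  by apply: measurable_funM => //; apply: measurable_funD; [exact: mc|exact: ms].
- under eq_fun do rewrite fourier_integralE//=.
  by apply: measurable_funM => //; apply: measurable_funB; [exact: mc|exact: ms].
Qed.

Lemma gauss_pairing_fourier s f g : 0 < s -> cintegrable f -> cintegrable g ->
  gauss_pairing s (fourier_integral f) (fourier_integral g) = cheat_form s f g.
Proof. by move=> s0 fi gi; have [_] := gauss_parseval s0 fi gi. Qed.

Lemma cvg_gauss_rV xi : gauss_rV k.+1%:R^-1 xi @[k --> \oo] --> (1 : R).
Proof.
rewrite /gauss_rV -[X in _ --> X](@expR0 R).
apply: (@cvg_comp _ _ _ (fun k => - (k.+1%:R^-1 * dotp xi xi)) (@expR R) _ (nbhs (0 : R))); last first.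
  exact: continuous_expR.
rewrite -oppr0; apply: cvgN; rewrite -(mul0r (dotp xi xi)).
by apply: cvgM; [exact: cvg_harmonic|exact: cvg_cst].
Qed.

(** Bessel's inequality, qualitatively: the Gaussian-weighted norms of the
    transform stay below the norm of [f] because the heat semigroup is a
    contraction, and Fatou removes the weight. *)
Lemma csqint_fourier_integral f : cintegrable f -> csqint f ->
  csqint (fourier_integral f).
Proof.
move=> fi f2; have [mr mi] := cmeasurable_fourier_integral fi.
pose U xi := cdot (fourier_integral f xi) (fourier_integral f xi).
have U0 xi : 0 <= U xi by rewrite /U /cdot -!expr2 addr_ge0 ?sqr_ge0.
have mU : measurable_fun setT U.
  by apply: measurable_funD; apply: measurable_funM.
pose s k : R := k.+1%:R^-1.
have s0 k : 0 < s k by rewrite invr_gt0.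
have Ule k : (\int[mu]_xi (gauss_rV (s k) xi * U xi)%:E <= (sqnorm f)%:E)%E.
  have [ik ek] := gauss_parseval (s0 k) fi fi.
  rewrite -[leLHS]fineK; last exact: integrable_fin_num ik.
  rewrite lee_fin -[X in X <= _]/(Rintegral _ _ _) ek.
  have := cheat_form_young (s0 k) ltr01 f2 f2.
  have := ler_norm (cheat_form (s k) f f); rewrite /cheat_form invr1; lra.
have Ui : mu.-integrable setT (EFin \o U).
  apply/integrableP; split; first exact/measurable_EFinP.
  rewrite (_ : (fun x => _) = (fun x => (limn_einf (fun k => (gauss_rV (s k) x * U x)%:E)))); last first.
    apply/funext => xi /=; rewrite ger0_norm//; apply/esym.
    apply: (cvg_limn_einf_sup _).1; apply: cvg_EFin; first exact: nearW.
    rewrite -[X in _ --> X]mul1r; apply: cvgM; last exact: cvg_cst.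
    exact: cvg_gauss_rV.
  have := @fatou _ _ _ mu _ measurableT (fun k xi => (gauss_rV (s k) xi * U xi)%:E).
  move=> /(_ _ _)/le_lt_trans; apply => [k|k xi _|].
  - by apply/measurable_EFinP; apply: measurable_funM => //; exact: measurable_gauss_rV.
  - by rewrite lee_fin mulr_ge0 ?expR_ge0.
  - by apply: (@le_lt_trans _ _ (sqnorm f)%:E); [exact: limn_einf_le|rewrite ltry].
split; split => //.
- apply: le_integrableR Ui; first exact: measurable_funX.
  by move=> xi; rewrite /U /cdot ger0_norm ?sqr_ge0// -!expr2 lerDl sqr_ge0.
- apply: le_integrableR Ui; first exact: measurable_funX.
  by move=> xi; rewrite /U /cdot ger0_norm ?sqr_ge0// -!expr2 lerDr sqr_ge0.
Qed.

Lemma inL12 f : inL 1 f /\ inL 2 f -> cintegrable f /\ csqint f.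
Proof. by move=> [/inL1_cintegrable ? /csqint_inL2 ?]. Qed.

(** [uh] pairs with Fourier-Plancherel transforms as the transform of [u]
    should. The pairs that this relation describes are stable under the real
    linear operations and contain the transforms of integrable functions, which
    is all that is needed of the Fourier transform. *)
Definition fourier_dual u uh := [/\ csqint u, csqint uh &
  forall f fh, is_fourier f fh -> forall s : R, 0 < s ->
    cheat_form s f u = gauss_pairing s fh uh].

(** What the Young bounds give in the limit: [k] is sent to infinity for a
    fixed [e], and then [e] to zero. *)
Let young_bound_eq0 (D : R) (a : nat -> R) (b : R) : 0 <= b ->
  (forall k e, 0 < e -> `|D| <= e^-1 * a k + e * b) ->
  a k @[k --> \oo] --> (0 : R) -> D = 0.
Proof.
move=> b0 H a0; apply/eqP; rewrite -normr_le0; apply/ler_addgt0Pr => e e0.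
rewrite add0r; pose d := e / (2 * (b + 1)).
have b1 : 0 < b + 1 by rewrite ltr_wpDl.
have d0 : 0 < d by rewrite divr_gt0// mulr_gt0.
have h : d^-1 * a k @[k --> \oo] --> (0 : R).
  by rewrite -(mulr0 d^-1); apply: cvgM => //; exact: cvg_cst.
have /cvgrPdist_lt/(_ (e / 2)) := h; rewrite divr_gt0// => /(_ isT) [k _ /(_ k (leqnn k))].
rewrite sub0r normrN => hk.
apply: (le_trans (H k d d0)).
have : d * b <= e / 2.
  rewrite /d invfM mulrA -mulrA ler_piMr ?divr_ge0 ?(ltW e0)//.
  by rewrite mulrC ltW// ltr_pdivrMr// mul1r ltrDl.
have := ler_norm (d^-1 * a k); lra.
Qed.

(** For integrable approximations of [f] this is the Gaussian Parseval identity;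
    both sides are continuous in [L^2], uniformly by the Young bounds. The next
    lemma extends it to transforms of [u] in the same way. *)
Lemma fourier_dual_integrable u : inL 1 u -> inL 2 u ->
  fourier_dual u (fourier_integral u).
Proof.
move=> u1 u2; have [ui us] := inL12 (conj u1 u2).
have uhs := csqint_fourier_integral ui us.
split=> // f fh [/csqint_inL2 fs /csqint_inL2 fhs [f_ [f_L f_cvg fh_cvg]]] s s0.
have f_i k : cintegrable (f_ k) by have [] := inL12 (f_L k).
have f_s k : csqint (f_ k) by have [] := inL12 (f_L k).
have fh_s k : csqint (fourier_integral (f_ k)).
  exact: csqint_fourier_integral.
have c1 := cvg_sqnorm f_s fs f_cvg; have c2 := cvg_sqnorm fh_s fhs fh_cvg.
apply/eqP; rewrite -subr_eq0; apply/eqP.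
apply: (@young_bound_eq0 _ (fun k => sqnorm (fun x => f_ k x - f x) +
   sqnorm (fun xi => fourier_integral (f_ k) xi - fh xi)) (sqnorm u + sqnorm (fourier_integral u))).
- by rewrite addr_ge0 ?sqnorm_ge0.
- move=> k e e0.
  have -> : cheat_form s f u - gauss_pairing s fh (fourier_integral u) =
     gauss_pairing s (fun xi => fourier_integral (f_ k) xi - fh xi) (fourier_integral u)
     - cheat_form s (fun x => f_ k x - f x) u.
    rewrite cheat_formBl// gauss_pairingBl ?ltW// -(gauss_pairing_fourier s0 (f_i k) ui); ring.
  have := cheat_form_young s0 e0 (csqintB (f_s k) fs) us.
  have := gauss_pairing_young (ltW s0) e0 (csqintB (fh_s k) fhs) uhs.
  set A := gauss_pairing _ _ _; set B := cheat_form _ _ _.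
  have := ler_normB A B; have := normr_ge0 A; have := normr_ge0 B.
  rewrite !mulrDr; lra.
- by rewrite -[X in _ --> X](addr0 0); exact: cvgD.
Qed.

Lemma is_fourier_dual u uh : is_fourier u uh -> fourier_dual u uh.
Proof.
move=> [/csqint_inL2 us /csqint_inL2 uhs [u_ [u_L u_cvg uh_cvg]]].
split=> // f fh ffh s s0.
have [/csqint_inL2 fs /csqint_inL2 fhs _] := ffh.
have u_i k : cintegrable (u_ k) by have [] := inL12 (u_L k).
have u_s k : csqint (u_ k) by have [] := inL12 (u_L k).
have uh_s k : csqint (fourier_integral (u_ k)).
  exact: csqint_fourier_integral.
have c1 := cvg_sqnorm u_s us u_cvg; have c2 := cvg_sqnorm uh_s uhs uh_cvg.
apply/eqP; rewrite -subr_eq0; apply/eqP.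
apply: (@young_bound_eq0 _ (fun k => sqnorm (fun x => u_ k x - u x) +
   sqnorm (fun xi => fourier_integral (u_ k) xi - uh xi)) (sqnorm f + sqnorm fh)).
- by rewrite addr_ge0 ?sqnorm_ge0.
- move=> k e e0.
  have ei0 : 0 < e^-1 by rewrite invr_gt0.
  have [_ _ /(_ f fh ffh s s0) d] := fourier_dual_integrable (u_L k).1 (u_L k).2.
  have -> : cheat_form s f u - gauss_pairing s fh uh =
     gauss_pairing s fh (fun xi => fourier_integral (u_ k) xi - uh xi)
     - cheat_form s f (fun x => u_ k x - u x).
    by rewrite cheat_formBr// gauss_pairingBr ?ltW// d; ring.
  have := cheat_form_young s0 ei0 fs (csqintB (u_s k) us).
  have := gauss_pairing_young (ltW s0) ei0 fhs (csqintB (uh_s k) uhs).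
  set A := gauss_pairing _ _ _; set B := cheat_form _ _ _.
  have := ler_normB A B; have := normr_ge0 A; have := normr_ge0 B.
  rewrite !mulrDr invrK; lra.
- by rewrite -[X in _ --> X](addr0 0); exact: cvgD.
Qed.

Lemma fourier_dualD u uh v vh : fourier_dual u uh -> fourier_dual v vh ->
  fourier_dual (fun x => u x + v x) (fun xi => uh xi + vh xi).
Proof.
move=> [us uhs ud] [vs vhs vd]; split; [exact: csqintD|exact: csqintD|].
move=> f fh ffh s s0; have [/csqint_inL2 fs /csqint_inL2 fhs _] := ffh.
rewrite cheat_formDr// gauss_pairingDr ?ltW//.
by rewrite (ud _ _ ffh _ s0) (vd _ _ ffh _ s0).
Qed.

Lemma fourier_dualZ (k : R) u uh : fourier_dual u uh ->
  fourier_dual (fun x => k%:C * u x) (fun xi => k%:C * uh xi).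
Proof.
move=> [us uhs ud]; split; [exact: csqintZ|exact: csqintZ|].
move=> f fh ffh s s0; have [/csqint_inL2 fs /csqint_inL2 fhs _] := ffh.
by rewrite cheat_formZr// gauss_pairingZr ?ltW// (ud _ _ ffh _ s0).
Qed.

Lemma sqnorm_ae_eq0 u v : csqint u -> csqint v -> aeq u v ->
  sqnorm (fun x => u x - v x) = 0.
Proof.
move=> us vs uv.
have sqr0 (w : V -> R) : measurable_fun setT w -> {ae mu, forall x, w x = 0} ->
    \int[mu]_x (w x ^+ 2) = 0.
  move=> mw w0; rewrite /Rintegral (ae_eq_integral (cst 0%E))//.
  - by rewrite integral0.
  - by apply/measurable_EFinP; exact: measurable_funX.
  - by apply: filterS w0 => x wx _ /=; rewrite wx expr0n.
have [[mr _] [mi _]] := csqintB us vs.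
by rewrite /sqnorm !sqr0 ?addr0//; apply: filterS uv => x ->; rewrite subrr.
Qed.

Lemma cheat_form_ael s u v w : 0 < s -> csqint u -> csqint v -> csqint w ->
  aeq u v -> cheat_form s u w = cheat_form s v w.
Proof.
move=> s0 us vs ws uv; apply/eqP; rewrite -subr_eq0 -cheat_formBl//; apply/eqP.
apply: (@young_bound_eq0 _ (fun=> 0) (sqnorm w)); [exact: sqnorm_ge0| |exact: cvg_cst].
move=> k e e0; have := cheat_form_young s0 e0 (csqintB us vs) ws.
rewrite sqnorm_ae_eq0//; set B := cheat_form _ _ _; have := normr_ge0 B; lra.
Qed.

Lemma cheat_form_aer s u v w : 0 < s -> csqint u -> csqint v -> csqint w ->
  aeq u v -> cheat_form s w u = cheat_form s w v.
Proof.
move=> s0 us vs ws uv; apply/eqP; rewrite -subr_eq0 -cheat_formBr//; apply/eqP.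
apply: (@young_bound_eq0 _ (fun=> 0) (sqnorm w)); [exact: sqnorm_ge0| |exact: cvg_cst].
move=> k e e0; have ei0 : 0 < e^-1 by rewrite invr_gt0.
have := cheat_form_young s0 ei0 ws (csqintB us vs).
rewrite sqnorm_ae_eq0// invrK; set B := cheat_form _ _ _; have := normr_ge0 B; lra.
Qed.

Lemma fourier_dual_ae u v uh : csqint v -> aeq u v -> fourier_dual u uh ->
  fourier_dual v uh.
Proof.
move=> vs uv [us uhs ud]; split => // f fh ffh s s0.
have [/csqint_inL2 fs _ _] := ffh.
by rewrite -(ud _ _ ffh _ s0) (cheat_form_aer s0 us vs fs uv).
Qed.

End fourier_duality.

(** * The heat form at small times *)

Lemma measurable_limn_einf d (T : measurableType d) (R : realType)
    (F : nat -> T -> \bar R) : (forall k, measurable_fun setT (F k)) ->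
  measurable_fun setT (fun x => limn_einf (fun k => F k x)).
Proof.
move=> mF; rewrite (_ : (fun x => _) = (fun x => - limn_esup (fun k => - F k x))%E).
  apply: measurableT_comp => //; apply: measurable_fun_limn_esup => k.
  exact: measurableT_comp.
apply/funext => x; rewrite -limn_einfN; congr limn_einf.
by apply/funext => k /=; rewrite oppeK.
Qed.

Section approximate_identity.
Context {R : realType}.
Local Notation leb := (@lebesgue_measure R).
Local Notation mu := (@lebesgue_rV R _).

Lemma integrable_heat1 s : 0 < s -> leb.-integrable setT (EFin \o @heat1 R s).
Proof.
move=> s0; apply/integrableP; split.
  by apply/measurable_EFinP; exact: measurable_heat1.
under eq_integral do rewrite /= ger0_norm ?(ltW (heat1_gt0 _ s0))//.
by rewrite integral_heat1// ltry.
Qed.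

Let near0 (d t : R) : R := if `|t| < d then 1 else 0.

Let near0_itv d t : near0 d t = \1_(`](- d), d[%classic) t.
Proof. by rewrite /near0 indicE mem_setE in_itv/= -ltr_norml; case: ifP. Qed.

Let measurable_near0 d : measurable_fun setT (near0 d).
Proof.
rewrite (_ : near0 d = \1_(`](- d), d[%classic)); last first.
  by apply/funext => t; exact: near0_itv.
by apply: measurable_indic; exact: measurable_itv.
Qed.

Definition heat1_mass (s d : R) : R := \int[leb]_t (near0 d t * heat1 s t).

Let near0_le1 d t : `|near0 d t| <= 1.
Proof. by rewrite /near0; case: ifP => _; rewrite ?normr1 ?normr0. Qed.

Let near0_ge0 d t : 0 <= near0 d t.
Proof. by rewrite /near0; case: ifP. Qed.

Let integrable_near0_heat1 s d : 0 < s ->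
  leb.-integrable setT (EFin \o (fun t => near0 d t * heat1 s t)).
Proof.
move=> s0; exact: (@integrableRM_bounded _ _ R leb (near0 d) (heat1 s)
  (measurable_near0 d) (near0_le1 d) (integrable_heat1 s0)).
Qed.

(** Far from the origin one half of the Gaussian decay is spent on smallness,
    and the other half is the heat kernel at time [2 s]. *)
Let heat1_tail (s d t : R) : 0 < s -> 0 < d -> d <= `|t| ->
  heat1 s t <= 16 * s / d ^+ 2 * heat1 (2 * s) t.
Proof.
move=> s0 d0 dt.
have t0 : 0 < t ^+ 2 by rewrite -(real_normK (num_real t)) exprn_gt0// (lt_le_trans d0).
have d20 : 0 < d ^+ 2 by rewrite exprn_gt0.
have dt2 : d ^+ 2 <= t ^+ 2.
  by rewrite -(real_normK (num_real t)) lerXn2r// nnegrE ltW.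
pose e := expR (- (t ^+ 2 / (4 * (2 * s)))).
have e0 : 0 < e by exact: expR_gt0.
have E : expR (- (t ^+ 2 / (4 * s))) = e * e.
  by rewrite /e -expRD; congr expR; field; rewrite gt_eqF.
have le_e : e <= 8 * s / d ^+ 2.
  apply: (@le_trans _ _ (8 * s / t ^+ 2)); last first.
    by rewrite ler_wpM2l ?mulr_ge0 ?(ltW s0)// lef_pV2 ?posrE.
  have q0 : 0 < 8 * s / t ^+ 2 by rewrite divr_gt0// mulr_gt0.
  rewrite /e expRN -[leRHS]invrK lef_pV2 ?posrE ?expR_gt0 ?invr_gt0//.
  rewrite invf_div; apply: le_trans (expR_ge1Dx _).
  rewrite (_ : 4 * (2 * s) = 8 * s); last by ring.
  by rewrite lerDr.
have ls : Num.sqrt (pi / s) <= 2 * Num.sqrt (pi / (2 * s)).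
  have ps0 : 0 <= pi / s by rewrite divr_ge0 ?pi_ge0// ltW.
  rewrite -ler_sqr ?nnegrE ?mulr_ge0 ?sqrtr_ge0// exprMn !sqr_sqrtr//; last first.
    by rewrite divr_ge0 ?pi_ge0// mulr_ge0// ltW.
  rewrite (_ : 2 ^+ 2 * _ = 2 * (pi / s)); last by field; rewrite gt_eqF.
  lra.
rewrite /heat1 E -/e.
have p0 : 0 <= (2 * pi)^-1 :> R by rewrite invr_ge0 mulr_ge0 ?pi_ge0.
rewrite [leRHS]mulrCA ler_wpM2l//.
have q0 : 0 <= Num.sqrt (pi / (2 * s)) by exact: sqrtr_ge0.
apply: (@le_trans _ _ (2 * Num.sqrt (pi / (2 * s)) * ((8 * s / d ^+ 2) * e))).
  by rewrite ler_pM ?sqrtr_ge0// ?mulr_ge0 ?(ltW e0)// ler_wpM2r// ltW.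
rewrite le_eqVlt; apply/orP; left; apply/eqP; field.
by rewrite gt_eqF.
Qed.

Lemma heat1_mass_ge s d : 0 < s -> 0 < d -> 1 - 16 * s / d ^+ 2 <= heat1_mass s d.
Proof.
move=> s0 d0; have s20 : 0 < 2 * s by rewrite mulr_gt0.
have c0 : 0 <= 16 * s / d ^+ 2 by rewrite divr_ge0 ?sqr_ge0// mulr_ge0// ltW.
rewrite lerBlDr.
have one r : 0 < r -> \int[leb]_t heat1 r t = 1.
  by move=> r0; rewrite /Rintegral integral_heat1.
rewrite -[X in X <= _](one s s0) -[16 * s / d ^+ 2]mulr1 -[X in _ * X](one (2 * s) s20).
rewrite -RintegralZl//; last exact: integrable_heat1.
have i2 := integrableRZ (16 * s / d ^+ 2) (integrable_heat1 s20).
rewrite /heat1_mass -RintegralD//; last exact: integrable_near0_heat1.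
apply: le_Rintegral => //; first exact: integrable_heat1.
  by apply: integrableRD => //; exact: integrable_near0_heat1.
move=> t _; rewrite /near0; case: ltP => td.
  by rewrite mul1r lerDl mulr_ge0// ltW// heat1_gt0.
by rewrite mul0r add0r heat1_tail.
Qed.

Lemma heat1_mass_le1 s d : 0 < s -> heat1_mass s d <= 1.
Proof.
move=> s0; rewrite (_ : 1 = \int[leb]_t heat1 s t); last first.
  by rewrite /Rintegral integral_heat1.
apply: le_Rintegral => //; [exact: integrable_near0_heat1|exact: integrable_heat1|].
move=> t _; rewrite ler_piMl//; first exact/ltW/heat1_gt0.
exact: le_trans (ler_norm _) (near0_le1 _ _).
Qed.

Lemma cvg_heat1_mass d : 0 < d -> heat1_mass k.+1%:R^-1 d @[k --> \oo] --> (1 : R).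
Proof.
move=> d0; apply: (@squeeze_cvgr _ _ _ _ (fun k => 1 - 16 * k.+1%:R^-1 / d ^+ 2) (cst 1)).
- by apply: nearW => k; rewrite heat1_mass_ge ?heat1_mass_le1// invr_gt0.
- rewrite -[X in _ --> X](subr0 1); apply: cvgB; first exact: cvg_cst.
  rewrite -(mul0r (d ^+ 2)^-1); apply: cvgM; last exact: cvg_cst.
  by rewrite -(mulr0 16); apply: cvgM; [exact: cvg_cst|exact: cvg_harmonic].
- exact: cvg_cst.
Qed.

Section dimension.
Context {n : nat}.
Local Notation V := 'rV[R]_n.
Implicit Types (f g : V -> R) (x y : V).

(** Lower semicontinuity, with cubes instead of balls because the heat kernel
    factorises over cubes. *)
Definition lsc f := forall x (c : R), c < f x ->
  exists2 d, 0 < d & forall y, (forall i, `|x ord0 i - y ord0 i| < d) -> c < f y.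

(** The kernel restricted to the cube of side [2 d] around [x] is a product, so
    its mass is a power of the one-dimensional one. *)
Lemma heat_average_ge f x (c d s : R) : 0 < s -> 0 <= c ->
  measurable_fun setT f -> (forall y, 0 <= f y) ->
  (forall y, (forall i, `|x ord0 i - y ord0 i| < d) -> c < f y) ->
  ((c * heat1_mass s d ^+ n)%:E <= \int[mu]_y (heat s (x - y) * f y)%:E)%E.
Proof.
move=> s0 c0 mf f0 fc.
pose k i t := near0 d (-1 * t + x ord0 i) * heat1 s (-1 * t + x ord0 i).
have mk i : measurable_fun setT (k i).
  apply: (measurableT_comp (f := fun t => near0 d t * heat1 s t)); last exact: measurable_affine.
  by apply: measurable_funM => //; exact: measurable_heat1.
have k0 i t : 0 <= k i t by rewrite mulr_ge0 ?near0_ge0// ltW// heat1_gt0.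
have mkp : measurable_fun [set: V] (fun y => \prod_(i < n) k i (y ord0 i)).
  apply: measurable_prod => i _.
  exact: (measurableT_comp (mk i) (measurable_rV_coordR i)).
have kp0 y : 0 <= \prod_(i < n) k i (y ord0 i) by rewrite prodr_ge0.
have mass i : (\int[leb]_t (k i t)%:E = (heat1_mass s d)%:E)%E.
  rewrite (@ge0_integral_affine R (-1) (x ord0 i) (fun t => (near0 d t * heat1 s t)%:E))//.
  - rewrite normrN1 invr1 mul1e /heat1_mass /Rintegral fineK//.
    exact: integrable_fin_num (integrable_near0_heat1 d s0).
  - by apply/measurable_EFinP; apply: measurable_funM => //; exact: measurable_heat1.
  - by move=> t; rewrite lee_fin mulr_ge0// ltW// heat1_gt0.
have -> : ((c * heat1_mass s d ^+ n)%:E = \int[mu]_y (c * \prod_(i < n) k i (y ord0 i))%:E)%E.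
  under eq_integral do rewrite EFinM.
  rewrite ge0_integralZl//; last 2 first.
  - exact/measurable_EFinP.
  - by move=> y _; rewrite lee_fin.
  rewrite ge0_integral_rV_prod// (eq_bigr (fun=> (heat1_mass s d)%:E)) => [|i _]; last exact: mass.
  by rewrite prodEFin prodr_const card_ord.
apply: ge0_le_integral => //.
- by move=> y _; rewrite lee_fin mulr_ge0.
- by apply/measurable_EFinP; exact: measurable_funM.
- apply/measurable_EFinP; apply: measurable_funM => //.
  by apply: (measurableT_comp (@measurable_heat R n s)); exact: measurable_subrV.
- move=> y _; rewrite lee_fin.
  have [near|/existsNP[j /negP far]] := pselect (forall i, `|x ord0 i - y ord0 i| < d).
    rewrite mulrC ler_pM//; last exact/ltW/fc.
    rewrite /heat; apply: ler_prod => i _; rewrite k0 /k !mxE mulN1r [- _ + _]addrC.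
    by rewrite /near0 near mul1r lexx.
  rewrite (bigD1 j)//= {1}/k mulN1r [- _ + _]addrC /near0 (negbTE far) !mul0r mulr0.
  by rewrite mulr_ge0// heat_ge0.
Qed.

(** Strong continuity of the heat semigroup at time zero. For a nonnegative
    lower semicontinuous [f] it needs no approximation by test functions: near
    each point the heat average is bounded below, Fatou integrates these
    bounds, and contraction gives the converse inequality. *)
Lemma cvg_heat_form_sqr f : sqint mu f -> (forall x, 0 <= f x) -> lsc f ->
  heat_form k.+1%:R^-1 f f @[k --> \oo] --> \int[mu]_x (f x ^+ 2).
Proof.
move=> fs f0 flsc; have [mf f2] := fs.
pose s k : R := k.+1%:R^-1.
have s0 k : 0 < s k by rewrite invr_gt0.
pose J k (p : V * V) := (heat (s k) (p.1 - p.2) * (f p.1 * f p.2))%:E.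
have mJ k : measurable_fun setT (J k).
  exact: measurable_int (integrable_heat_form (s0 k) fs fs).
have J0 k p : (0 <= J k p)%E by rewrite lee_fin !mulr_ge0 ?heat_ge0.
have JE k : (\int[mu]_x \int[mu]_y J k (x, y) = (heat_form (s k) f f)%:E)%E.
  rewrite -(fubini_tonelli1 (J k))// /heat_form /Rintegral fineK//.
  exact: integrable_fin_num (integrable_heat_form (s0 k) fs fs).
have fatouJ : ((\int[mu]_x (f x ^+ 2))%:E <= limn_einf (fun k => (heat_form (s k) f f)%:E))%E.
  under [X in (_ <= limn_einf X)%E]eq_fun do rewrite -JE.
  have mF k := measurable_fun_fubini_tonelli_F (m2 := mu) (J k) (mJ k) (J0 k).
  have F0 k x : (0 <= \int[mu]_y J k (x, y))%E by exact: integral_ge0.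
  apply: le_trans; last first.
    by apply: (@fatou _ _ _ mu _ measurableT (fun k x => \int[mu]_y J k (x, y))%E).
  have fE : ((\int[mu]_x (f x ^+ 2))%:E = \int[mu]_x (f x ^+ 2)%:E)%E.
    by rewrite /Rintegral fineK//; exact: integrable_fin_num f2.
  rewrite fE; apply: ge0_le_integral => //.
  - by move=> x _; rewrite lee_fin sqr_ge0.
  - by apply/measurable_EFinP; exact: measurable_funX.
  - exact: measurable_limn_einf.
  - move=> x _; rewrite expr2.
    have [->|fx0] := eqVneq (f x) 0.
      by rewrite mulr0; apply: (limn_einf_ge (a := fun=> 0%E)) => //; exact: cvg_cst.
    have fx : 0 < f x by rewrite lt_def fx0 f0.
    apply/lee_mul01Pr; first by rewrite lee_fin mulr_ge0.
    move=> r /andP[r0 r1]; rewrite -EFinM.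
    have rfx : r * f x < f x by rewrite gtr_pMl.
    have [d d0 hd] := flsc x (r * f x) rfx.
    apply: (limn_einf_ge (a := fun k => (f x * (r * f x * heat1_mass (s k) d ^+ n))%:E)).
      move=> k.
      rewrite (_ : (\int[mu]_y J k (x, y) = (f x)%:E * \int[mu]_y (heat (s k) (x - y) * f y)%:E)%E).
        by rewrite EFinM lee_wpmul2l ?lee_fin// heat_average_ge// mulr_ge0// ltW.
      rewrite -ge0_integralZl//.
      - by apply: eq_integral => y _; rewrite /J -EFinM; congr _%:E; ring.
      - apply/measurable_EFinP; apply: measurable_funM => //.
        by apply: (measurableT_comp (@measurable_heat R n _)); exact: measurable_subrV.
      - by move=> y _; rewrite lee_fin mulr_ge0 ?heat_ge0.
      - by rewrite lee_fin.
    apply: cvg_EFin; first exact: nearW.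
    rewrite (_ : r * (f x * f x) = f x * (r * f x * 1 ^+ n)); last by rewrite expr1n; ring.
    apply: cvgM; first exact: cvg_cst.
    apply: cvgM; first exact: cvg_cst.
    apply: (@cvg_comp _ _ _ (fun k => heat1_mass (s k) d) (fun t : R => t ^+ n) _ (nbhs (1 : R))).
      exact: cvg_heat1_mass.
    exact: exprn_continuous.
have ub k : heat_form (s k) f f <= \int[mu]_x (f x ^+ 2).
  have := heat_form_young (s0 k) ltr01 fs fs.
  have := ler_norm (heat_form (s k) f f); rewrite invr1; lra.
have : (fun k => - (heat_form (s k) f f)%:E)%E @ \oo --> (- (\int[mu]_x (f x ^+ 2))%:E)%E.
  apply: limn_esup_le_cvg => [|k].
    rewrite leeNr -limn_einfN (_ : -%E \o _ = (fun k => (heat_form (s k) f f)%:E))//.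
    by apply/funext => k; exact: oppeK.
  by rewrite leeN2 lee_fin.
move=> /cvgeN; rewrite oppeK => /fine_cvg/=.
by under eq_fun do rewrite opprK.
Qed.

Lemma cvg_heat_form f g : sqint mu f -> (forall x, 0 <= f x) -> lsc f -> sqint mu g ->
  heat_form k.+1%:R^-1 f g @[k --> \oo] --> \int[mu]_x (f x * g x).
Proof.
move=> fs f0 flsc gs; have h := cvg_heat_form_sqr fs f0 flsc.
apply/cvgrPdist_lt => e e0.
set B := \int[mu]_x (g x ^+ 2).
have B0 : 0 <= B by apply: Rintegral_ge0 => x _; exact: sqr_ge0.
pose th := e / (B + 1).
have th0 : 0 < th by rewrite divr_gt0// ltr_wpDl.
have /cvgrPdist_lt/(_ (th * e / 2)) := h.
have the0 : 0 < th * e / 2 by rewrite divr_gt0// mulr_gt0.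
move=> /(_ the0) [K _ HK]; exists K => // k /HK /=.
have k0 : 0 < k.+1%:R^-1 :> R by rewrite invr_gt0.
have := heat_form_approx k0 th0 fs gs.
set A := \int[mu]_x (f x ^+ 2); set Q := heat_form _ f f.
set D := `|_ - _| => H1 H2.
have H3 : th^-1 * (2 * (A - Q)) < e.
  rewrite mulrC ltr_pdivrMr//; have := ler_norm (A - Q); lra.
have H4 : th * B <= e.
  by rewrite /th mulrAC ler_pdivrMr ?ltr_wpDl// ler_wpM2l ?(ltW e0)// lerDl.
rewrite -/B in H1; lra.
Qed.

End dimension.

End approximate_identity.

(** * Transforms of arbitrary square integrable functions *)

Section resolvent.
Context {R : realType} {n : nat}.
Local Open Scope complex_scope.
Local Notation mu := (@lebesgue_rV R n).
Local Notation V := 'rV[R]_n.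
Implicit Types (f g u : V -> R[i]) (x xi : V).

Definition ball0 (a : R) : set V := [set y | enorm y < a].

Lemma measurable_ball0 a : measurable (ball0 a).
Proof.
have mE : measurable_fun setT (fun x : V => enorm x).
  apply: (measurableT_comp (continuous_measurable_fun (@sqrt_continuous R))).
  exact: measurable_dotp.
rewrite (_ : ball0 a = enorm @^-1` [set t | t < a]); last by [].
rewrite -[X in measurable X]setTI; apply: mE => //.
rewrite (_ : [set t | t < a] = [set` `]-oo, a[]); first exact: measurable_itv.
by apply/seteqP; split => t; rewrite /= in_itv.
Qed.

Lemma coord_le_enorm x i : `|x ord0 i| <= enorm x.
Proof.
rewrite -sqrtr_sqr ler_wsqrtr// /dotp (bigD1 i)//= -expr2 lerDl.
by apply: sumr_ge0 => j _; rewrite -expr2 sqr_ge0.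
Qed.

Lemma finite_ball0 a : (mu (ball0 a) < +oo)%E.
Proof.
pose B : set V := [set x | forall i : 'I_n, [set` `[- a, a]] (x ord0 i)].
have mB : measurable B.
  by apply: (@measurable_box R n (fun=> [set` `[- a, a]])) => i; exact: measurable_itv.
apply: (@le_lt_trans _ _ (mu B)).
  apply: le_measure; rewrite ?inE//; first exact: measurable_ball0.
  move=> x xa i /=; rewrite in_itv/= -ler_norml.
  by rewrite ltW// (le_lt_trans (coord_le_enorm x i)).
rewrite [X in (X < _)%E](@lebesgue_rV_box R n (fun=> [set` `[- a, a]]))//.
rewrite ltey_eq; apply/orP; left; apply/prode_fin_num => i _.
by rewrite lebesgue_measure_itv; case: ifP.
Qed.

Lemma measurable_well v a : measurable_fun setT (@well R n v a).
Proof.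
apply: measurable_funM => //; apply: measurable_indic.
exact: measurable_ball0.
Qed.

Let integrable_wellM v a (w : V -> R) : sqint mu w ->
  mu.-integrable setT (EFin \o (fun x => well v a x * w x)).
Proof.
move=> [mw w2].
have i1 : mu.-integrable setT (EFin \o (\1_(ball0 a) : V -> R)).
  apply/integrableP; split.
    by apply/measurable_EFinP; apply: measurable_indic; exact: measurable_ball0.
  under eq_integral do rewrite /= ger0_norm//.
  by rewrite integral_indic ?setIT; [exact: finite_ball0| |exact: measurable_ball0].
apply: (@le_integrableR _ _ _ _ _ (fun x => `|v| * (\1_(ball0 a) x + w x ^+ 2))).
- by apply: measurable_funM => //; exact: measurable_well.
- move=> x; rewrite normrM /well normrM normrN -mulrA ler_wpM2l//.
  rewrite -/(ball0 a) indicE; case: (_ \in _) => /=.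
    rewrite normr1 mul1r -(real_normK (num_real (w x))); nra.
  by rewrite normr0 mul0r addr_ge0 ?sqr_ge0.
- by apply: integrableRZ; exact: integrableRD.
Qed.

Let sqint_wellM v a (w : V -> R) : 0 < v -> sqint mu w ->
  sqint mu (fun x => well v a x * w x).
Proof.
move=> v0 ws; have E x : well v a x * w x = v * (- \1_(ball0 a) x * w x).
  by rewrite /well -/(ball0 a); ring.
under eq_fun do rewrite E.
apply: sqintZ; apply: sqint_bounded => //.
- by apply: measurableT_comp => //; apply: measurable_indic; exact: measurable_ball0.
- by move=> x; rewrite normrN indicE; case: (_ \in _); rewrite ?normr1 ?normr0.
Qed.

Lemma inL1_of_integrable f : cintegrable f -> inL 1 f.
Proof.
move=> [fr fi]; have mr := integrable_measurableR fr.
have mi := integrable_measurableR fi; split; first by [].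
rewrite /cLnorm Lnorm1.
have /integrableP[_] := integrableRD (integrable_norm fr) (integrable_norm fi).
apply: le_lt_trans; apply: ge0_le_integral => //.
- apply: measurableT_comp => //; apply/measurable_EFinP.
  rewrite (_ : (fun x => _) = (fun x => Num.sqrt (complex.Re (f x) ^+ 2 + complex.Im (f x) ^+ 2))); last first.
    by apply/funext => x; case: (f x).
  apply: (measurableT_comp (continuous_measurable_fun (@sqrt_continuous R))).
  by apply: measurable_funD; exact: measurable_funX.
- apply: measurableT_comp => //; apply/measurable_EFinP.
  by apply: measurable_funD; exact: measurableT_comp.
- move=> x _ /=; rewrite lee_fin.
  rewrite (ger0_norm (_ : 0 <= Normc.normc (f x))); last by case: (f x) => ? ?; exact: sqrtr_ge0.
  rewrite [leRHS]ger0_norm ?addr_ge0//.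
  case: (f x) => p q /=.
  rewrite -[leRHS]ger0_norm ?addr_ge0// -sqrtr_sqr ler_wsqrtr//.
  rewrite sqrrD !real_normK ?num_real// -addrA [X in _ <= _ + X]addrC addrA lerDl.
  by rewrite mulrn_wge0// mulr_ge0.
Qed.

(** The well has finite measure, so the product is integrable and its transform
    is the Fourier integral. *)
Lemma fourier_dual_well v a w : 0 < v -> csqint w ->
  exists uh, fourier_dual (fun x => (well v a x)%:C * w x) uh.
Proof.
move=> v0 [wr wi]; exists (fourier_integral (fun x => (well v a x)%:C * w x)).
apply: fourier_dual_integrable.
  apply: inL1_of_integrable; split.
  - by under eq_fun do rewrite /= ReMC; exact: integrable_wellM.
  - by under eq_fun do rewrite /= ImMC; exact: integrable_wellM.
apply/csqint_inL2; split.
- by under eq_fun do rewrite ReMC; exact: sqint_wellM.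
- by under eq_fun do rewrite ImMC; exact: sqint_wellM.
Qed.

(** A resolvent point [z] turns every square integrable [g] into
    [(T + V) u - z u] with [u] in the domain of the multiplier [T], and each of
    the three terms has a transform: this replaces the completeness of [L^2] in
    the construction of the Fourier transform of [g]. *)
Lemma resolvent_fourier_dual (b : V -> R) v a (z : R) g : 0 < v ->
  resolvent_set (add_potential (multiplier b) (well v a)) z%:C ->
  csqint g -> exists gh, fourier_dual g gh.
Proof.
move=> v0 [_ [M /(_ g)/= surj]] gs.
have [|u [_ [w0 [uh uuh w0h]]] gE _] := surj; first exact/csqint_inL2.
have ud := is_fourier_dual uuh; have [us _ _] := ud.
have w0d := is_fourier_dual w0h; have [w0s _ _] := w0d.
have [vh vd] := fourier_dual_well a v0 us; have [vs _ _] := vd.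
exists (fun xi => ((b xi)%:C * uh xi + vh xi) + (- z)%:C * uh xi).
apply: (@fourier_dual_ae _ _ (fun x => (w0 x + (well v a x)%:C * u x) + (- z)%:C * u x)) => //.
- apply: filterS gE => x gE; rewrite -gE rmorphN mulNr; ring.
- by apply: fourier_dualD; [exact: fourier_dualD|exact: fourier_dualZ].
Qed.

End resolvent.

(** * The symbol as a mixture of heat symbols *)

Lemma Rintegral_gt0 d (T : measurableType d) (R : realType)
    (mu : {measure set T -> \bar R}) (f : T -> R) (A : set T) :
  measurable A -> mu A != 0%E -> mu.-integrable setT (EFin \o f) ->
  (forall x, 0 <= f x) -> (forall x, A x -> 0 < f x) -> 0 < \int[mu]_x f x.
Proof.
move=> mA muA fi f0 fA; rewrite lt_def Rintegral_ge0 ?andbT//.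
apply: contra muA => /eqP f_eq0.
have : (\int[mu]_x `|(f x)%:E| = 0)%E.
  under eq_integral do rewrite gee0_abs ?lee_fin//.
  rewrite -[LHS]fineK; first by rewrite [fine _]f_eq0.
  exact: integrable_fin_num fi.
move=> /(ae_eq_integral_abs mu measurableT (measurable_int _ fi))[N [mN N0 fN]].
rewrite -measure_le0 -N0 le_measure ?inE// => x Ax.
by apply: fN => /(_ I)[fx]; have := fA x Ax; rewrite fx ltxx.
Qed.

Section levy_khintchine.
Context {R : realType}.
Local Notation leb := (@lebesgue_measure R).

Lemma lebesgue_measureT_neq0 : leb setT != 0%E.
Proof.
have : leb setT != 0%E by rewrite -set_itvNyy lebesgue_measure_itv.
by [].
Qed.

Let integrable_exp_abs (c : R) : 0 < c ->
  leb.-integrable setT (EFin \o (fun x => expR (- (c * `|x|)))).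
Proof.
move=> c0.
have mp : measurable_fun setT (exponential_pdf c) by exact: measurable_exponential_pdf.
have p0 x : 0 <= exponential_pdf c x by rewrite exponential_pdf_ge0// ltW.
have i1 : leb.-integrable setT (EFin \o exponential_pdf c).
  apply/integrableP; split; first exact/measurable_EFinP.
  under eq_integral do rewrite /= ger0_norm//.
  by rewrite integral_exponential_pdf// ltry.
have mpN : measurable_fun setT (fun x : R => exponential_pdf c (-1 * x + 0)).
  exact: (measurableT_comp mp (measurable_affine _ _)).
have i2 : leb.-integrable setT (EFin \o (fun x : R => exponential_pdf c (-1 * x + 0))).
  apply/integrableP; split; first exact/measurable_EFinP.
  under eq_integral do rewrite /= ger0_norm//.
  rewrite (@ge0_integral_affine R (-1) 0 (fun t => (exponential_pdf c t)%:E))//.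
  - by rewrite integral_exponential_pdf// mule1 ltry.
  - exact/measurable_EFinP.
apply: (@le_integrableR _ _ R leb _ (fun x => c^-1 * (exponential_pdf c x + exponential_pdf c (-1 * x + 0)))).
- apply: measurableT_comp => //; apply: measurableT_comp => //.
  by apply: measurable_funM => //; exact: measurableT_comp.
- move=> x; rewrite ger0_norm ?expR_ge0// ler_pdivlMl//.
  have [x0|x0] := leP 0 x.
    rewrite ger0_norm// (exponential_pdfE c x0).
    by rewrite [- c * x]mulNr lerDl.
  rewrite ltr0_norm// addrC mulN1r addr0.
  rewrite (@exponential_pdfE _ _ (- x)) ?oppr_ge0 ?(ltW x0)//.
  by rewrite [- c * _]mulNr lerDl.
- by apply: integrableRZ; exact: integrableRD.
Qed.

(** In the variable [x = ln t], the Levy measure [t^(-1-b) dt] becomes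
    [exp (- b x) dx]: scaling becomes translation, and both tails are
    exponential. *)
Definition levy_integrand (b z x : R) : R :=
  expR (- (b * x)) * (1 - expR (- (expR x * z))).

Lemma levy_integrand_ge0 b z x : 0 <= z -> 0 <= levy_integrand b z x.
Proof.
move=> z0; rewrite mulr_ge0 ?expR_ge0// subr_ge0 -expR0 ler_expR oppr_le0.
by rewrite mulr_ge0// expR_ge0.
Qed.

Lemma measurable_levy_integrand b z : measurable_fun setT (levy_integrand b z).
Proof.
apply: measurable_funM.
  by apply: measurableT_comp => //; apply: measurableT_comp => //; apply: measurable_funM.
apply: measurable_funB => //; apply: measurableT_comp => //.
by apply: measurableT_comp => //; apply: measurable_funM => //.
Qed.

Let integrable_levy1 b : 0 < b -> b < 1 ->
  leb.-integrable setT (EFin \o levy_integrand b 1).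
Proof.
move=> b0 b1; pose c := Num.min b (1 - b).
have c0 : 0 < c by rewrite lt_min b0 subr_gt0.
have [cb cb1] : c <= b /\ c <= 1 - b by rewrite !ge_min !lexx orbT.
apply: le_integrableR (integrable_exp_abs c0); first exact: measurable_levy_integrand.
move=> x; rewrite ger0_norm ?levy_integrand_ge0// /levy_integrand mulr1.
have [x0|x0] := leP 0 x.
  rewrite ger0_norm//; apply: (@le_trans _ _ (expR (- (b * x)))).
    by rewrite ler_piMr ?expR_ge0// lerBlDr lerDl expR_ge0.
  by rewrite ler_expR lerN2 ler_wpM2r.
rewrite ltr0_norm//; apply: (@le_trans _ _ (expR (- (b * x)) * expR x)).
  rewrite ler_wpM2l ?expR_ge0// lerBlDr -lerBlDl.
  exact: expR_ge1Dx.
rewrite -expRD ler_expR; nra.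
Qed.

(** Translation by [y] in the logarithmic variable. *)
Let integral_levy (b y : R) :
  (\int[leb]_x (levy_integrand b (expR y) x)%:E =
   (expR (b * y))%:E * \int[leb]_x (levy_integrand b 1 x)%:E)%E.
Proof.
have := @ge0_integral_affine R 1 y (fun x => (levy_integrand b 1 x)%:E).
rewrite oner_neq0 normr1 invr1 mul1e => <- //; last 2 first.
- by apply/measurable_EFinP; exact: measurable_levy_integrand.
- by move=> x; rewrite lee_fin levy_integrand_ge0.
rewrite -ge0_integralZl//; last 2 first.
- apply/measurable_EFinP.
  exact: (measurableT_comp (measurable_levy_integrand b 1) (measurable_affine _ _)).
- by move=> x _; rewrite lee_fin levy_integrand_ge0.
apply: eq_integral => x _; rewrite -EFinM; congr _%:E.
rewrite /levy_integrand !mul1r mulr1 mulrA -expRD -expRD.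
by congr (expR _ * _); ring.
Qed.

(** [C] is the inverse of the integral at [z = 1], and homogeneity does the
    rest. *)
Lemma levy_power (b : R) : 0 < b -> b < 1 -> exists2 C, 0 < C &
  forall z, 0 <= z -> leb.-integrable setT (EFin \o levy_integrand b z) /\
    z `^ b = C * \int[leb]_x levy_integrand b z x.
Proof.
move=> b0 b1; have i1 := integrable_levy1 b0 b1.
pose K := \int[leb]_x levy_integrand b 1 x.
have KE : (\int[leb]_x (levy_integrand b 1 x)%:E = K%:E)%E.
  by rewrite /K /Rintegral fineK//; exact: integrable_fin_num i1.
have K0 : 0 < K.
  apply: (@Rintegral_gt0 _ _ _ leb _ setT) => //.
  - exact: lebesgue_measureT_neq0.
  - by move=> x; exact: levy_integrand_ge0.
  - move=> x _; rewrite mulr_gt0 ?expR_gt0// subr_gt0.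
    by rewrite expR_lt1 oppr_lt0 mulr1 expR_gt0.
exists K^-1; first by rewrite invr_gt0.
move=> z; rewrite le_eqVlt => /predU1P[<-|z0].
  have -> : levy_integrand b 0 = fun=> 0.
    by apply/funext => x; rewrite /levy_integrand mulr0 oppr0 expR0 subrr mulr0.
  split; first exact: integrable0.
  by rewrite Rintegral_cst// mul0r mulr0 powR0// gt_eqF.
have := integral_levy b (ln z); rewrite lnK ?posrE// KE -EFinM => E.
split.
  apply/integrableP; split.
    by apply/measurable_EFinP; exact: measurable_levy_integrand.
  under eq_integral do rewrite /= ger0_norm ?levy_integrand_ge0 ?(ltW z0)//.
  by rewrite E ltry.
rewrite /Rintegral E /= mulrCA mulVf ?gt_eqF// mulr1.
by rewrite /powR gt_eqF.
Qed.

(** [Phi m alpha z] is the difference of the powers of exponent [alpha / 2] at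
    [z + M] and at [M], where [M^(alpha / 2) = m]; subtracting the two
    representations tilts the weight by [exp (- t M)] at the time [t = expR x],
    which keeps it positive. *)
Lemma Phi_levy (m alpha : R) : 0 < alpha -> alpha < 2 -> 0 <= m ->
  exists w : R -> R, [/\ measurable_fun setT w, forall x, 0 < w x &
    forall z, 0 <= z ->
      leb.-integrable setT (EFin \o (fun x => w x * (1 - expR (- (expR x * z))))) /\
      Phi m alpha z = \int[leb]_x (w x * (1 - expR (- (expR x * z))))].
Proof.
move=> a0 a2 m0; pose b := alpha / 2; pose M := m `^ (2 / alpha).
have b0 : 0 < b by rewrite divr_gt0.
have b1 : b < 1 by rewrite ltr_pdivrMr// mul1r.
have M0 : 0 <= M by exact: powR_ge0.
have Mb : M `^ b = m.
  rewrite /M -powRrM (_ : 2 / alpha * b = 1) ?powRr1//.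
  by rewrite /b; field; rewrite gt_eqF.
have [C C0 H] := levy_power b0 b1.
exists (fun x => C * (expR (- (b * x)) * expR (- (expR x * M)))); split.
- apply: measurable_funM => //; apply: measurable_funM.
    by apply: measurableT_comp => //; apply: measurableT_comp => //; exact: measurable_funM.
  by apply: measurableT_comp => //; apply: measurableT_comp => //; apply: measurable_funM => //; exact: measurable_expR.
- by move=> x; rewrite !mulr_gt0 ?expR_gt0.
move=> z z0; have [iM eM] := H M M0.
have [iz ez] := H (z + M) (addr_ge0 z0 M0).
have E x : C * (expR (- (b * x)) * expR (- (expR x * M))) * (1 - expR (- (expR x * z))) =
    C * (levy_integrand b (z + M) x - levy_integrand b M x).
  have Ez : expR (- (expR x * (z + M))) = expR (- (expR x * z)) * expR (- (expR x * M)).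
    by rewrite -expRD; congr expR; ring.
  by rewrite /levy_integrand Ez; ring.
split.
  by under eq_fun do rewrite /= E; apply: integrableRZ; exact: integrableRB.
under eq_Rintegral do rewrite E.
rewrite RintegralZl//; last exact: integrableRB.
by rewrite RintegralB// mulrBr -ez -eM Mb.
Qed.

End levy_khintchine.

(** * Reflections and the two-point inequality *)

Section measure_preserving.
Context d (T : measurableType d) (R : realType) (mu : {measure set T -> \bar R}).

(** Invariance of the integrals of nonnegative functions; on a product this is
    checked by Tonelli, one factor at a time. *)
Definition preserving (h : T -> T) := measurable_fun setT h /\
  forall F : T -> \bar R, measurable_fun setT F -> (forall x, 0 <= F x)%E ->
    (\int[mu]_x F (h x) = \int[mu]_x F x)%E.

Lemma preserving_integrable h f : preserving h -> mu.-integrable setT (EFin \o f) ->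
  mu.-integrable setT (EFin \o (f \o h)).
Proof.
move=> [mh ph] fi; have mf := integrable_measurableR fi.
apply/integrableP; split; first by apply/measurable_EFinP; exact: measurableT_comp.
have /integrableP[_] := fi; rewrite -(ph (fun x => `|(f x)%:E|%E))//.
by apply: measurableT_comp => //; exact/measurable_EFinP.
Qed.

Lemma preserving_Rintegral h (f : T -> R) : preserving h -> measurable_fun setT f ->
  \int[mu]_x f (h x) = \int[mu]_x f x.
Proof.
move=> [mh ph] /measurable_EFinP mf; rewrite /Rintegral; congr fine.
rewrite [LHS]integralE [RHS]integralE; congr (_ - _)%E.
- rewrite -(ph ((EFin \o f)^\+)%E (measurable_funepos mf) (funepos_ge0 (EFin \o f))).
  by apply: eq_integral => x _; rewrite !funeposE.
- rewrite -(ph ((EFin \o f)^\-)%E (measurable_funeneg mf) (funeneg_ge0 (EFin \o f))).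
  by apply: eq_integral => x _; rewrite !funenegE.
Qed.

Lemma preserving_comp h1 h2 : preserving h1 -> preserving h2 ->
  preserving (h1 \o h2).
Proof.
move=> [m1 p1] [m2 p2]; split; first exact: measurableT_comp.
move=> F mF F0; rewrite -(p1 F mF F0).
apply: (p2 (F \o h1)); first exact: measurableT_comp.
by move=> x; exact: F0.
Qed.

End measure_preserving.

Section product_preserving.
Context d (T : measurableType d) (R : realType)
  (mu : {sigma_finite_measure set T -> \bar R}).
Local Notation mu2 := (mu \x mu)%E.

Lemma preserving_swap : preserving mu2 (fun p => (p.2, p.1)).
Proof.
have ms : measurable_fun setT (fun p : T * T => (p.2, p.1)).
  by apply/measurable_fun_pairP; split; [exact: measurable_snd|exact: measurable_fst].
split=> // F mF F0; rewrite [RHS]fubini_tonelli2// fubini_tonelli1//.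
exact: (measurableT_comp mF).
Qed.

Lemma preserving_left h : preserving mu h -> preserving mu2 (fun p => (h p.1, p.2)).
Proof.
move=> [mh ph].
have ms : measurable_fun setT (fun p : T * T => (h p.1, p.2)).
  apply/measurable_fun_pairP; split; last exact: measurable_snd.
  exact: (measurableT_comp mh measurable_fst).
split=> // F mF F0; have mFh := measurableT_comp mF ms.
rewrite (fubini_tonelli2 _ mFh (fun p => F0 _)) (fubini_tonelli2 F mF F0).
apply: eq_integral => y _; rewrite /fubini_G /=.
apply: (ph (fun x => F (x, y))) => //.
by apply: (measurableT_comp mF); exact: pair2_measurable.
Qed.

End product_preserving.

Section reflection.
Context {R : realType} {n : nat}.
Local Notation leb := (@lebesgue_measure R).
Local Notation mu := (@lebesgue_rV R n.+1).
Local Notation mu2 := (mu \x mu)%E.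
Local Notation V := 'rV[R]_n.+1.
Implicit Types (x y : V).
Variable c : R.

(** The reflection in the hyperplane [x_0 = c]. *)
Definition refl x : V := \row_i (if i == ord0 then 2 * c - x ord0 i else x ord0 i).

Lemma refl0 x : refl x ord0 ord0 = 2 * c - x ord0 ord0.
Proof. by rewrite mxE eqxx. Qed.

Lemma reflK : involutive refl.
Proof.
move=> x; apply/rowP => i; rewrite !mxE.
by case: (i == ord0); rewrite ?subKr.
Qed.

Lemma refl_cons (t : measurableTypeR R) (y : 'rV[R]_n) : refl (cons_rV (t, y)) = cons_rV (2 * c - t, y).
Proof.
apply/rowP => i; rewrite !mxE; case: unliftP => [j|] -> /=.
  by [].
by rewrite ?eqxx.
Qed.

Lemma measurable_refl : measurable_fun setT refl.
Proof.
apply: measurable_fun_rV => i.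
rewrite (_ : _ \o _ = fun x : V => if i == ord0 then 2 * c - x ord0 i else x ord0 i); last first.
  by apply/funext => x; rewrite /rV_coord /= mxE.
case: (i == ord0); last exact: measurable_rV_coordR.
by apply: measurable_funB => //; exact: measurable_rV_coordR.
Qed.

Lemma preserving_refl : preserving mu refl.
Proof.
split; first exact: measurable_refl.
move=> F mF F0; have mFr := measurableT_comp mF measurable_refl.
rewrite (ge0_integral_rV_cons mFr (fun x => F0 _)) (ge0_integral_rV_cons mF F0).
pose G t := (\int[@lebesgue_rV R n]_y F (cons_rV (t, y)))%E.
have mG : measurable_fun setT G.
  apply: (measurable_fun_fubini_tonelli_F (F \o @cons_rV R n)).
    by apply: (measurableT_comp mF); exact: measurable_cons_rV.
  by move=> p; exact: F0.
have G0 t : (0 <= G t)%E by exact: integral_ge0.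
have N1 : (-1 : R) != 0 by rewrite oppr_eq0 oner_neq0.
have := @ge0_integral_affine R (-1) (2 * c) G N1 mG G0.
rewrite normrN1 invr1 mul1e => <-.
apply: eq_integral => t _; apply: eq_integral => y _.
by rewrite /comp refl_cons mulN1r addrC.
Qed.

(** Points on the same side of the hyperplane are closer to each other than to
    the reflected points: this is the only geometry in the argument. *)
Lemma dotp_refl x y : dotp (refl x - y) (refl x - y) =
  dotp (x - y) (x - y) + 4 * ((c - x ord0 ord0) * (c - y ord0 ord0)).
Proof.
rewrite /dotp big_ord_recl [in RHS]big_ord_recl.
rewrite (eq_bigr (fun i => (x - y) ord0 (lift ord0 i) * (x - y) ord0 (lift ord0 i))); last first.
  by move=> i _; rewrite !mxE lift_eqF.
by rewrite !mxE eqxx; ring.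
Qed.

Lemma dotp_refl2 x y : dotp (refl x - refl y) (refl x - refl y) = dotp (x - y) (x - y).
Proof. by apply: eq_bigr => i _; rewrite !mxE; case: (i == ord0); ring. Qed.

Lemma heat_refl2 s x y : heat s (refl x - refl y) = heat s (x - y).
Proof. by rewrite !heatE dotp_refl2. Qed.

Lemma heat_reflC s x y : heat s (x - refl y) = heat s (refl x - y).
Proof. by rewrite -heat_refl2 reflK. Qed.

Lemma le_heat_refl s x y : 0 < s ->
  0 <= (c - x ord0 ord0) * (c - y ord0 ord0) -> heat s (refl x - y) <= heat s (x - y).
Proof.
move=> s0 h; rewrite !heatE ler_wpM2l//.
  by rewrite exprn_ge0// mulr_ge0 ?sqrtr_ge0// invr_ge0 mulr_ge0 ?pi_ge0.
rewrite ler_expR lerN2 ler_wpM2r ?invr_ge0 ?mulr_ge0 ?(ltW s0)//.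
by rewrite dotp_refl lerDl mulr_ge0.
Qed.

Lemma ge_heat_refl s x y : 0 < s ->
  (c - x ord0 ord0) * (c - y ord0 ord0) <= 0 -> heat s (x - y) <= heat s (refl x - y).
Proof.
move=> s0 h; have := @le_heat_refl s (refl x) y s0; rewrite reflK; apply.
by rewrite refl0; move: h; nra.
Qed.

Lemma dotp_refl_ge x : 0 <= c -> x ord0 ord0 <= c -> dotp x x <= dotp (refl x) (refl x).
Proof.
move=> c0 xc; have := dotp_refl x 0; rewrite !subr0 mxE subr0 => ->.
by rewrite lerDl !mulr_ge0// subr_ge0.
Qed.

Section two_point_inequality.
Variable phi : V -> R.
Hypothesis phi_gt0 : forall x, 0 < phi x.
Hypothesis phi_sqint : sqint mu phi.

Let psi x := phi (refl x).

Let bad x : R := if (x ord0 ord0 < c) && (phi x < psi x) then 1 else 0.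

Definition bad_set : set V := [set x : V | x ord0 ord0 < c /\ phi x < phi (refl x)].

Definition odd_bad x : R := bad x - bad (refl x).

(** The factor [phi (refl x)] makes the product with [phi] odd under the
    reflection, and lets the two-point inequality below apply to the symmetrised
    heat form. *)
Definition refl_test x : R := phi (refl x) * odd_bad x.

Let mphi : measurable_fun setT phi. Proof. by case: phi_sqint. Qed.

Let mpsi : measurable_fun setT psi.
Proof. exact: (measurableT_comp mphi measurable_refl). Qed.

Lemma measurable_bad_set : measurable bad_set.
Proof.
rewrite (_ : bad_set = [set x : V | x ord0 ord0 < c] `&` [set x : V | phi x < psi x])//.
apply: measurableI.
- rewrite -[X in measurable X]setTI.
  exact: (measurable_fun_ltr (measurable_rV_coordR ord0) (measurable_cst c)).
- rewrite -[X in measurable X]setTI.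
  exact: (measurable_fun_ltr mphi mpsi).
Qed.

Let badE x : bad x = \1_bad_set x.
Proof.
rewrite indicE /bad; case: ifP => [/andP[h1 h2]|/negP h].
  by rewrite mem_set//.
by rewrite memNset// => -[h1 h2]; apply: h; rewrite h1.
Qed.

Let measurable_bad : measurable_fun setT bad.
Proof.
rewrite (_ : bad = \1_bad_set); last by apply/funext => x; exact: badE.
by apply: measurable_indic; exact: measurable_bad_set.
Qed.

Lemma measurable_odd_bad : measurable_fun setT odd_bad.
Proof.
by apply: measurable_funB => //; exact: (measurableT_comp measurable_bad measurable_refl).
Qed.

Lemma odd_bad_refl x : odd_bad (refl x) = - odd_bad x.
Proof. by rewrite /odd_bad reflK opprB. Qed.

Lemma odd_bad_left x : x ord0 ord0 <= c ->
  (phi x < phi (refl x) /\ odd_bad x = 1) \/ (phi (refl x) <= phi x /\ odd_bad x = 0).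
Proof.
move=> xc; rewrite /odd_bad /bad /psi reflK refl0.
have -> : (2 * c - x ord0 ord0 < c) = false by apply/negbTE; rewrite -leNgt; lra.
rewrite subr0; move: xc; rewrite le_eqVlt => /predU1P[xc|xc].
  have -> : refl x = x.
    by apply/rowP => i; rewrite mxE; case: eqP => // ->; rewrite xc; ring.
  by right; rewrite ltxx andbF.
by rewrite xc /=; case: ltP => h; [left|right].
Qed.

Lemma odd_bad_right x : c <= x ord0 ord0 ->
  (phi (refl x) < phi x /\ odd_bad x = -1) \/ (phi x <= phi (refl x) /\ odd_bad x = 0).
Proof.
move=> xc; have := @odd_bad_left (refl x); rewrite odd_bad_refl reflK refl0.
case=> [|[h e]|[h e]]; first lra.
- by left; rewrite -e opprK.
- by right; split=> //; apply: oppr_inj; rewrite e oppr0.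
Qed.

Lemma odd_bad_le1 x : `|odd_bad x| <= 1.
Proof.
by rewrite /odd_bad /bad; do 2 case: ifP => _; rewrite ?subrr ?subr0 ?sub0r ?normrN ?normr0 ?normr1.
Qed.

Let sqint_psi : sqint mu psi.
Proof.
split; first exact: mpsi.
have [_ p2] := phi_sqint.
exact: (preserving_integrable preserving_refl p2).
Qed.

Lemma sqint_refl_test : sqint mu refl_test.
Proof.
rewrite (_ : refl_test = fun x => odd_bad x * psi x); last first.
  by apply/funext => x; rewrite /refl_test mulrC.
by apply: sqint_bounded; [exact: measurable_odd_bad|exact: odd_bad_le1|exact: sqint_psi].
Qed.

(** The integrand is odd under the reflection. *)
Lemma Rintegral_refl_test_eq0 : \int[mu]_x (phi x * refl_test x) = 0.
Proof.
have i := sqint_mul phi_sqint sqint_refl_test.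
have := preserving_Rintegral preserving_refl (integrable_measurableR i).
have E x : phi (refl x) * refl_test (refl x) = -1 * (phi x * refl_test x).
  by rewrite /refl_test odd_bad_refl reflK; ring.
under eq_Rintegral do rewrite E.
rewrite RintegralZl// mulN1r; lra.
Qed.

(** Adding to the integrand its reflection leaves
    [phi x * phi (refl x) * (q x - q (refl x)) * odd_bad x], and the last two
    factors have the same sign. *)
Lemma Rintegral_refl_test_ge0 (q : V -> R) :
  (forall x, x ord0 ord0 <= c -> q (refl x) <= q x) ->
  sqint mu (fun x => q x * phi x) ->
  0 <= \int[mu]_x (q x * phi x * refl_test x).
Proof.
move=> qc qs; have i := sqint_mul qs sqint_refl_test.
have ir := preserving_integrable preserving_refl i.
have e := preserving_Rintegral preserving_refl (integrable_measurableR i).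
have : 0 <= \int[mu]_x (q x * phi x * refl_test x) +
            \int[mu]_x (q (refl x) * phi (refl x) * refl_test (refl x)).
  rewrite -RintegralD//; apply: Rintegral_ge0 => x _.
  have -> : q x * phi x * refl_test x + q (refl x) * phi (refl x) * refl_test (refl x) =
      phi x * phi (refl x) * ((q x - q (refl x)) * odd_bad x).
    by rewrite /refl_test odd_bad_refl reflK; ring.
  apply: mulr_ge0; first by rewrite mulr_ge0// ltW.
  have [xc|xc] := leP (x ord0 ord0) c.
    have := qc x xc; have [[_ ->]|[_ ->]] := odd_bad_left xc; lra.
  have := qc (refl x); rewrite reflK refl0.
  have [[_ ->]|[_ ->]] := odd_bad_right (ltW xc); last lra.
  by move=> h; have := h (_ : 2 * c - x ord0 ord0 <= c); lra.
by rewrite e; lra.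
Qed.

(** For points [x], [y] with [x_0, y_0 <= c]: [a], [b] are the values of [phi]
    at [x] and at its reflection, [a'], [b'] those for [y], [f], [f'] say
    whether the points are bad, and [p], [p'] are the heat kernels between [x]
    and [y] and between the reflection of [x] and [y]. If exactly one point is
    bad the first term is nonnegative, and replacing [p] by [p'] in it leaves
    [p' * (b - a) * (a' + b')] or [p' * (b' - a') * (a + b)]. *)
Let two_point (p p' a b a' b' f f' : R) : 0 < p' -> p' <= p ->
  0 < a -> 0 < b -> 0 < a' -> 0 < b' ->
  (a < b /\ f = 1) \/ (b <= a /\ f = 0) ->
  (a' < b' /\ f' = 1) \/ (b' <= a' /\ f' = 0) ->
  0 <= p * (a * b' - b * a') * (f' - f) + p' * (b * b' - a * a') * (f + f').
Proof.
move=> p0 pp a0 b0 a0' b0' [[ab ->]|[ba ->]] [[ab' ->]|[ba' ->]].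
- rewrite subrr mulr0 add0r; apply: mulr_ge0; last by [].
  by apply: mulr_ge0; [exact: ltW|nra].
- have h : 0 <= b * a' - a * b' by nra.
  have h2 : 0 <= (p - p') * (b * a' - a * b') by rewrite mulr_ge0// subr_ge0.
  have h3 : 0 <= p' * ((b - a) * (a' + b')).
    by rewrite mulr_ge0 ?(ltW p0)// mulr_ge0 ?subr_ge0 ?addr_ge0 ?ltW.
  nra.
- have h : 0 <= a * b' - b * a' by nra.
  have h2 : 0 <= (p - p') * (a * b' - b * a') by rewrite mulr_ge0// subr_ge0.
  have h3 : 0 <= p' * ((b' - a') * (a + b)).
    by rewrite mulr_ge0 ?(ltW p0)// mulr_ge0 ?subr_ge0 ?addr_ge0 ?ltW.
  nra.
- by rewrite subrr addr0 !mulr0 addr0.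
Qed.

(** The sum of the integrand of [heat_form s phi refl_test] over the eight
    images of a pair of points under the reflection of either point and the
    exchange of the two. *)
Let sym s (p : V * V) : R :=
  heat s (p.1 - p.2) * (phi p.1 * psi p.2 - psi p.1 * phi p.2) * (odd_bad p.2 - odd_bad p.1)
  + heat s (refl p.1 - p.2) * (psi p.1 * psi p.2 - phi p.1 * phi p.2) *
    (odd_bad p.1 + odd_bad p.2).

(** A point beyond the hyperplane is replaced by its reflection, which exchanges
    the values of [phi] and [psi], changes the sign of [odd_bad] and exchanges
    the two kernels. *)
Let sym_ge0 s p : 0 < s -> 0 <= sym s p.
Proof.
move=> s0; case: p => x y; rewrite /sym /=.
have h := heat_gt0 (x - y) s0; have h' := heat_gt0 (refl x - y) s0.
have psi0 z : 0 < psi z by exact: phi_gt0.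
have [xc|xc] := leP (x ord0 ord0) c; have [yc|yc] := leP (y ord0 ord0) c.
- apply: two_point => //; [|exact: odd_bad_left|exact: odd_bad_left].
  by apply: le_heat_refl => //; rewrite mulr_ge0// subr_ge0.
- have := @two_point (heat s (refl x - y)) (heat s (x - y)) (phi x) (psi x) (psi y) (phi y)
    (odd_bad x) (- odd_bad y).
  move=> /(_ h _ (phi_gt0 x) (psi0 x) (psi0 y) (phi_gt0 y) (odd_bad_left xc)).
  move=> H; apply: le_trans (H _ _) _; last (rewrite le_eqVlt; apply/orP; left; apply/eqP; ring).
  + by apply: ge_heat_refl => //; rewrite nmulr_lle0 ?subr_lt0 ?subr_ge0 // mulrC; nra.
  + by have [[h1 ->]|[h1 ->]] := odd_bad_right (ltW yc); [left; rewrite opprK|right; rewrite oppr0].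
- have := @two_point (heat s (refl x - y)) (heat s (x - y)) (psi x) (phi x) (phi y) (psi y)
    (- odd_bad x) (odd_bad y).
  move=> /(_ h _ (psi0 x) (phi_gt0 x) (phi_gt0 y) (psi0 y)).
  move=> H; apply: le_trans (H _ _ (odd_bad_left yc)) _; last (rewrite le_eqVlt; apply/orP; left; apply/eqP; ring).
  + by apply: ge_heat_refl => //; nra.
  + by have [[h1 ->]|[h1 ->]] := odd_bad_right (ltW xc); [left; rewrite opprK|right; rewrite oppr0].
- have := @two_point (heat s (x - y)) (heat s (refl x - y)) (psi x) (phi x) (psi y) (phi y)
    (- odd_bad x) (- odd_bad y).
  move=> /(_ h' _ (psi0 x) (phi_gt0 x) (psi0 y) (phi_gt0 y)).
  move=> H; apply: le_trans (H _ _ _) _; last (rewrite le_eqVlt; apply/orP; left; apply/eqP; ring).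
  + by apply: le_heat_refl => //; nra.
  + by have [[h1 ->]|[h1 ->]] := odd_bad_right (ltW xc); [left; rewrite opprK|right; rewrite oppr0].
  + by have [[h1 ->]|[h1 ->]] := odd_bad_right (ltW yc); [left; rewrite opprK|right; rewrite oppr0].
Qed.

Let sym_gt0 s p : 0 < s -> (bad_set `*` bad_set) p -> 0 < sym s p.
Proof.
move=> s0; case: p => x y [[/= xc xb] [/= yc yb]]; rewrite /sym /=.
have ex : odd_bad x = 1.
  by have [[_ //]|[h _]] := odd_bad_left (ltW xc); move: h; rewrite leNgt xb.
have ey : odd_bad y = 1.
  by have [[_ //]|[h _]] := odd_bad_left (ltW yc); move: h; rewrite leNgt yb.
rewrite ex ey subrr mulr0 add0r !mulr_gt0 ?heat_gt0// subr_gt0 /psi.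
have := phi_gt0 x; have := phi_gt0 y; nra.
Qed.

(** The eight images are measure preserving, so [sym] integrates to eight times
    the heat form; it is nonnegative, and positive on pairs of bad points. *)
Lemma heat_form_refl_test_gt0 s : 0 < s -> mu bad_set != 0%E ->
  0 < heat_form s phi refl_test.
Proof.
move=> s0 N0.
pose J (p : V * V) := heat s (p.1 - p.2) * (phi p.1 * refl_test p.2).
have Ji : mu2.-integrable setT (EFin \o J).
  exact: (integrable_heat_form s0 phi_sqint sqint_refl_test).
have mJ := integrable_measurableR Ji.
pose sw (p : V * V) := (p.2, p.1); pose rl (p : V * V) := (refl p.1, p.2).
have psw : preserving mu2 sw by exact: preserving_swap.
have prl : preserving mu2 rl by exact/preserving_left/preserving_refl.
have pc := @preserving_comp _ _ _ mu2.
pose rr := sw \o (rl \o sw); have prr : preserving mu2 rr by exact/pc/pc.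
have copy h : preserving mu2 h -> mu2.-integrable setT (EFin \o (J \o h)) /\
    \int[mu2]_p J (h p) = heat_form s phi refl_test.
  by move=> ph; split; [exact: preserving_integrable|exact: preserving_Rintegral].
have pid : preserving mu2 id by split=> //; exact: measurable_id.
have [i1 e1] := copy _ pid; have [i2 e2] := copy _ prl.
have [i3 e3] := copy _ prr; have [i4 e4] := copy _ (pc _ _ prl prr).
have [i5 e5] := copy _ psw; have [i6 e6] := copy _ (pc _ _ psw prl).
have [i7 e7] := copy _ (pc _ _ psw prr); have [i8 e8] := copy _ (pc _ _ psw (pc _ _ prl prr)).
have i12 := integrableRD i1 i2; have i34 := integrableRD i3 i4.
have i56 := integrableRD i5 i6; have i78 := integrableRD i7 i8.
have i1234 := integrableRD i12 i34; have i5678 := integrableRD i56 i78.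
have symE p : sym s p = ((J p + J (rl p)) + (J (rr p) + J ((rl \o rr) p))) +
   ((J (sw p) + J ((sw \o rl) p)) + (J ((sw \o rr) p) + J ((sw \o (rl \o rr)) p))).
  case: p => x y; rewrite /sym /J /refl_test /rr /rl /sw /=.
  rewrite !odd_bad_refl !reflK !heat_refl2 !heat_reflC (heatC s y x) /psi.
  rewrite (_ : heat s (refl y - x) = heat s (refl x - y)); first ring.
  by rewrite -heat_reflC heatC.
have symi : mu2.-integrable setT (EFin \o sym s).
  have -> : sym s = fun p => ((J p + J (rl p)) + (J (rr p) + J ((rl \o rr) p))) +
      ((J (sw p) + J ((sw \o rl) p)) + (J ((sw \o rr) p) + J ((sw \o (rl \o rr)) p))).
    by apply/funext => p; exact: symE.
  exact: (integrableRD i1234 i5678).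
have symI : \int[mu2]_p sym s p = 8 * heat_form s phi refl_test.
  under eq_Rintegral do rewrite symE.
  rewrite (RintegralD measurableT i1234 i5678).
  rewrite (RintegralD measurableT i12 i34) (RintegralD measurableT i56 i78).
  rewrite (RintegralD measurableT i1 i2) (RintegralD measurableT i3 i4).
  rewrite (RintegralD measurableT i5 i6) (RintegralD measurableT i7 i8).
  move: e1 e2 e3 e4 e5 e6 e7 e8; rewrite /= => -> -> -> -> -> -> -> ->; ring.
have : 0 < \int[mu2]_p sym s p.
  have mN := measurable_bad_set; have mNN := measurableX mN mN.
  have NN0 : mu2 (bad_set `*` bad_set) != 0%E.
    by rewrite [X in X != _](product_measure1E mu mu mN mN) mule_eq0 negb_or N0.
  have S0 p : 0 <= sym s p by exact: sym_ge0.
  have S1 p : (bad_set `*` bad_set) p -> 0 < sym s p by exact: sym_gt0.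
  exact: (Rintegral_gt0 mNN NN0 symi S0 S1).
by rewrite symI pmulr_rgt0.
Qed.

End two_point_inequality.

End reflection.

(** * From the heat forms to the kinetic energy *)

Section heat_limit.
Context {R : realType} {n : nat}.
Local Open Scope complex_scope.
Local Notation leb := (@lebesgue_measure R).
Local Notation mu := (@lebesgue_rV R n).
Local Notation V := 'rV[R]_n.

Lemma cvg_gauss_pairing (f g : V -> R[i]) : csqint f -> csqint g ->
  gauss_pairing k.+1%:R^-1 f g @[k --> \oo] --> \int[mu]_xi cdot (f xi) (g xi).
Proof.
move=> fs gs; have fgi := integrable_cdot fs gs; have mfg := integrable_measurableR fgi.
have s0 k : 0 <= k.+1%:R^-1 :> R by rewrite invr_ge0.
have [||||//] := @Rdominated_cvg _ _ _ mu
  (fun k xi => gauss_rV k.+1%:R^-1 xi * cdot (f xi) (g xi))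
  (fun xi => cdot (f xi) (g xi)) (fun xi => `|cdot (f xi) (g xi)|).
- by move=> k; apply: measurable_funM => //; exact: measurable_gauss_rV.
- move=> xi; rewrite -[X in _ --> X]mul1r.
  by apply: cvgM; [exact: cvg_gauss_rV|exact: cvg_cst].
- exact: integrable_norm.
- move=> k xi; rewrite normrM ler_piMl// ger0_norm ?expR_ge0//.
  by rewrite gauss_rV_le1.
Qed.

(** As the Gaussian weight tends to one, the pairing of the transforms becomes
    unweighted, and the heat form converges by assumption: a Parseval identity
    for this pair of functions. *)
Lemma fourier_dual_limit (f fh u uh : V -> R[i]) (l : R) :
  is_fourier f fh -> fourier_dual u uh ->
  cheat_form k.+1%:R^-1 f u @[k --> \oo] --> l ->
  \int[mu]_xi cdot (fh xi) (uh xi) = l.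
Proof.
move=> ffh [us uhs ud] lim; have [_ /csqint_inL2 fhs _] := ffh.
have lim2 := cvg_gauss_pairing fhs uhs.
have E : (fun k => gauss_pairing k.+1%:R^-1 fh uh) =
         (fun k => cheat_form k.+1%:R^-1 f u).
  by apply/funext => k; rewrite (ud _ _ ffh)// invr_gt0.
rewrite E in lim2; exact: (cvg_unique _ lim2 lim).
Qed.

Lemma cheat_form_real s (F U : V -> R) :
  cheat_form s (fun x => (F x)%:C) (fun x => (U x)%:C) = heat_form s F U.
Proof.
rewrite /cheat_form [X in _ + X](_ : _ = 0) ?addr0//.
by rewrite /heat_form; under eq_Rintegral do rewrite mulr0 mulr0; exact: (congr1 fine (integral0 _ _)).
Qed.

Lemma csqint_real (F : V -> R) : sqint mu F -> csqint (fun x => (F x)%:C).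
Proof.
move=> Fs; split; first exact: Fs.
split; first exact: measurable_cst.
under eq_fun do rewrite /= expr0n; exact: integrable0.
Qed.

(** By Fubini the integral of the symbol against [G] is a mixture with positive
    weights of [int G - int exp (- t |xi|^2) G], and [int G = 0]. *)
Lemma levy_pairing_lt0 m alpha (G : V -> R) : 0 < alpha -> alpha < 2 -> 0 <= m ->
  mu.-integrable setT (EFin \o G) ->
  mu.-integrable setT (EFin \o (fun xi => Phi m alpha (enorm xi ^+ 2) * G xi)) ->
  \int[mu]_xi G xi = 0 ->
  (forall t, 0 < t -> 0 < \int[mu]_xi (gauss_rV t xi * G xi)) ->
  \int[mu]_xi (Phi m alpha (enorm xi ^+ 2) * G xi) < 0.
Proof.
move=> a0 a2 m0 Gi PGi G0 gG.
have [w [mw w0 wP]] := Phi_levy a0 a2 m0.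
have mG := integrable_measurableR Gi.
have en xi : enorm xi ^+ 2 = dotp xi xi :> R by rewrite sqr_sqrtr// dotp_ge0.
pose k x (xi : V) := w x * (1 - gauss_rV (expR x) xi).
have k0 x xi : 0 <= k x xi.
  by rewrite mulr_ge0 ?(ltW (w0 x))// subr_ge0 gauss_rV_le1// expR_ge0.
have kP xi : leb.-integrable setT (EFin \o k ^~ xi) /\
    Phi m alpha (enorm xi ^+ 2) = \int[leb]_x k x xi.
  by rewrite en; exact: wP (dotp_ge0 xi).
pose K (p : measurableTypeR R * V) := k p.1 p.2 * G p.2.
have mK : measurable_fun setT K.
  apply: measurable_funM; last exact: (measurableT_comp mG measurable_snd).
  apply: measurable_funM; first exact: (measurableT_comp mw measurable_fst).
  apply: measurable_funB => //; apply: measurableT_comp => //.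
  apply: measurableT_comp => //; apply: measurable_funM.
    by apply: measurableT_comp => //; exact: measurable_fst.
  by apply: measurable_dotp; exact: measurable_snd.
have Ki : (leb \x mu)%E.-integrable setT (EFin \o K).
  apply: (@integrable_prod2 _ _ _ _ _ leb mu _
    (fun xi => `|Phi m alpha (enorm xi ^+ 2) * G xi|)) => //.
    exact: integrable_norm.
  move=> xi; have [ki kE] := kP xi.
  under eq_integral do rewrite /K/= normrM ger0_norm// mulrC EFinM.
  rewrite (integralZl measurableT ki).
  rewrite -[X in (_ * X)%E]fineK; last exact: integrable_fin_num ki.
  by rewrite -EFinM lee_fin normrM mulrC kE ler_wpM2r ?ler_norm.
have Kx x : mu.-integrable setT (EFin \o (fun xi => K (x, xi))).
  rewrite /K/= /k; under eq_fun do rewrite -mulrA.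
  apply: integrableRZ; apply: integrableRM_bounded => //.
    by apply: measurable_funB => //; exact: measurable_gauss_rV.
  move=> xi; have g1 : gauss_rV (expR x) xi <= 1 by rewrite gauss_rV_le1// expR_ge0.
  by rewrite ger0_norm ?subr_ge0// gerBl expR_ge0.
have Kxi xi : leb.-integrable setT (EFin \o (fun x => K (x, xi))).
  rewrite /K/=; under eq_fun do rewrite mulrC.
  by apply: integrableRZ; have [] := kP xi.
have [Ii K1] := Rfubini1 Ki Kx; have K2 := Rfubini2 Ki Kxi.
pose h x := w x * \int[mu]_xi (gauss_rV (expR x) xi * G xi).
have hE x : \int[mu]_xi K (x, xi) = -1 * h x.
  have gGi : mu.-integrable setT (EFin \o (fun xi => gauss_rV (expR x) xi * G xi)).
    apply: integrableRM_bounded => //; first exact: measurable_gauss_rV.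
    by move=> xi; rewrite ger0_norm ?expR_ge0// gauss_rV_le1// expR_ge0.
  transitivity (w x * \int[mu]_xi (G xi - gauss_rV (expR x) xi * G xi)).
    rewrite -RintegralZl//; last exact: integrableRB.
    by apply: eq_Rintegral => xi _; rewrite /K/= /k; ring.
  by rewrite RintegralB// G0 /h; ring.
have hi : leb.-integrable setT (EFin \o h).
  apply: eq_integrable (integrableRZ (-1) Ii) => // x _ /=.
  by rewrite hE mulrA mulN1r opprK mul1r.
have -> : \int[mu]_xi (Phi m alpha (enorm xi ^+ 2) * G xi) = - \int[leb]_x h x.
  rewrite -mulN1r -RintegralZl//; under [RHS]eq_Rintegral do rewrite -hE.
  rewrite -K1 K2; apply: eq_Rintegral => xi _; have [ki ->] := kP xi.
  by rewrite mulrC -RintegralZl//; under eq_Rintegral do rewrite mulrC.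
rewrite oppr_lt0; apply: (@Rintegral_gt0 _ _ _ leb _ setT) => //.
- exact: lebesgue_measureT_neq0.
- by move=> x; rewrite ltW// mulr_gt0// gG// expR_gt0.
- by move=> x _; rewrite mulr_gt0// gG// expR_gt0.
Qed.

End heat_limit.

Section lower_semicontinuity.
Context {R : realType} {n : nat}.
Local Notation V := 'rV[R]_n.

Lemma nbhs_cube (x : V) (P : set V) : nbhs x P ->
  exists2 d, 0 < d & forall y : V, (forall i, `|x ord0 i - y ord0 i| < d) -> P y.
Proof.
move=> /nbhs_ballP[e e0 H]; exists e => // y Hy; apply: H; split=> //.
by move=> i j; rewrite ord1; exact: Hy.
Qed.

Lemma continuous_lsc (f : V -> R) : continuous f -> lsc f.
Proof.
by move=> cf x c cx; apply: nbhs_cube; exact: (cvgr_gt (f x) (cf x)).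
Qed.

Lemma cvg_enorm (x : V) : (fun y : V => enorm y) @ x --> enorm x.
Proof.
have FF : Filter (nbhs x) by exact: nbhs_filter.
have cd : (fun y : V => dotp y y) @ x --> dotp x x.
  rewrite /dotp; elim: (index_enum _) => [|i r IH].
    under eq_fun do rewrite big_nil.
    by rewrite big_nil; apply: cvg_cst.
  under eq_fun do rewrite big_cons.
  rewrite big_cons.
  by apply: cvgD; [apply: cvgM; exact: coord_continuous|exact: IH].
exact: (cvg_comp _ _ cd (@sqrt_continuous R (dotp x x))).
Qed.

Lemma continuousN_enorm : continuous (fun x : V => - enorm x).
Proof.
have c (x : V) : (fun y : V => - enorm y) @ x --> - enorm x.
  have FF : Filter (nbhs x) by exact: nbhs_filter.
  by apply: cvgN; apply: cvg_enorm.
by move=> x; exact: c.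
Qed.

(** The ball is open, and outside it the product vanishes. *)
Lemma lsc_ball0 (a : R) (f : V -> R) : lsc f -> (forall x, 0 <= f x) ->
  lsc (fun x => \1_(ball0 a) x * f x).
Proof.
move=> lf f0 x c; have [xB|xB] := pselect (ball0 a x); last first.
  rewrite indicE memNset// mul0r => c0; exists 1 => // y _.
  by apply: lt_le_trans c0 _; rewrite mulr_ge0.
rewrite indicE mem_set// mul1r => cx; have [d d0 dP] := lf _ _ cx.
have [e e0 eP] : exists2 e : R, 0 < e & forall y : V,
    (forall i, `|x ord0 i - y ord0 i| < e) -> ball0 a y.
  have [|e e0 eP] := @continuous_lsc _ continuousN_enorm x (- a); first by rewrite ltrN2.
  by exists e => // y /eP; rewrite ltrN2.
exists (Num.min d e); first by rewrite lt_min d0.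
move=> y Hy; rewrite indicE mem_set; last first.
  by apply: eP => i; apply: lt_le_trans (Hy i) _; rewrite ge_min lexx orbT.
by rewrite mul1r; apply: dP => i; apply: lt_le_trans (Hy i) _; rewrite ge_min lexx.
Qed.

Lemma lebesgue_cube_neq0 (A : set V) (x : V) d : measurable A -> 0 < d ->
  (forall y : V, (forall i, `|x ord0 i - y ord0 i| < d) -> A y) ->
  lebesgue_rV n A != 0%E.
Proof.
move=> mA d0 dA; pose I i : set (measurableTypeR R) := ball (x ord0 i) d.
have mI i : measurable (I i) by exact: measurable_ball.
pose C : set V := [set y | forall i, I i (y ord0 i)].
have mC : measurable C by exact: measurable_box.
have C0 : lebesgue_rV n C != 0%E.
  rewrite lebesgue_rV_box//.
  under eq_bigr do rewrite /I lebesgue_measure_ball ?ltW//.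
  rewrite prodEFin; apply/eqP => -[/eqP]; rewrite prodr_const expf_eq0.
  by rewrite mulrn_eq0/= [d == 0]gt_eqF// andbF.
apply: contra C0; rewrite -!measure_le0; apply: le_trans.
by apply: le_measure; rewrite ?inE.
Qed.

End lower_semicontinuity.

(** * Ground states and reflections *)

Section reflection_inequality.
Context {R : realType} {n : nat}.
Local Open Scope complex_scope.
Local Notation mu := (@lebesgue_rV R n.+1).
Local Notation V := 'rV[R]_n.+1.

(** A real point close to [l] and different from it. *)
Lemma isolated_resolvent (T : @operator R n.+1) (l : R) :
  isolated_in (spectrum T) l%:C -> exists z : R, resolvent_set T z%:C.
Proof.
move=> [_ [e e0 iso]]; exists (l + e / 2); apply: contrapT => spec.
have e2 : 0 < e / 2 by rewrite divr_gt0.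
have := iso _ spec; rewrite -rmorphB [l + _]addrC addrK /= expr0n addr0 sqrtr_sqr.
have lt_e : `|e / 2| < e by rewrite gtr0_norm//; lra.
by move=> /(_ lt_e)[/eqP]; rewrite -subr_eq0 addrK gt_eqF.
Qed.

(** Pair the eigenvalue equation with [u = refl_test c phi]. The kinetic side is
    the integral of the symbol against [G], the real pairing of the transforms
    of [phi] and [u]. It is negative by [levy_pairing_lt0], because the heat
    forms of [phi] and [u] are positive while [int phi u = 0]; it is
    nonnegative because it equals [int (l + v 1_B) phi u], where [l] drops out
    by oddness and the well is larger on the side [x_0 <= c]. *)
Lemma bad_set_null (m alpha v a c : R) (phi : V -> R) :
  0 < alpha -> alpha < 2 -> 0 <= m -> 0 < v -> 0 <= c ->
  ground_state (hamiltonian m alpha v a) phi -> mu (bad_set c phi) = 0%E.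
Proof.
move=> a0 a2 m0 v0 c0 [l [[iso _ _] _] [[[_ [w0 [ph phf w0f] w0E]] _] _ cphi phi0]].
have [z zr] := isolated_resolvent iso.
apply/eqP; apply: contrapT => /negP N0.
have [/csqint_inL2 [phis _] /csqint_inL2 phs _] := phf.
have [/csqint_inL2 w0s /csqint_inL2 w0hs _] := w0f.
have {}phis : sqint mu phi := phis.
pose U := refl_test c phi; have Us : sqint mu U by exact: sqint_refl_test.
have [uh ud] := resolvent_fourier_dual v0 zr (csqint_real Us).
have [us uhs udual] := ud.
have philsc := continuous_lsc cphi.
have phige0 x : 0 <= phi x by exact: ltW.
pose B x := \1_(ball0 a) x * phi x.
have Bs : sqint mu B.
  apply: sqint_bounded phis; first by apply: measurable_indic; exact: measurable_ball0.
  by move=> x; rewrite ger0_norm// indicE lern1 leq_b1.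
have B0 x : 0 <= B x by rewrite mulr_ge0.
pose W x := l * phi x + v * B x.
have Ws : sqint mu W by apply: sqintD; exact: sqintZ.
have w0W : aeq w0 (fun x => (W x)%:C).
  apply: filterS w0E => x /eqP; rewrite -subr_eq => /eqP <-.
  rewrite -!rmorphM -rmorphB /W /B /well; congr (_ %:C); ring.
pose G xi := cdot (ph xi) (uh xi).
have G0 : \int[mu]_xi G xi = 0.
  apply: (fourier_dual_limit phf ud).
  under eq_fun do rewrite cheat_form_real.
  rewrite -(Rintegral_refl_test_eq0 c phis).
  exact: cvg_heat_form.
have PGE xi : cdot ((Phi m alpha (enorm xi ^+ 2))%:C * ph xi) (uh xi) =
    Phi m alpha (enorm xi ^+ 2) * G xi.
  by rewrite /G /cdot ReMC ImMC; ring.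
have PG : \int[mu]_xi (Phi m alpha (enorm xi ^+ 2) * G xi) = v * \int[mu]_x (B x * U x).
  under eq_Rintegral do rewrite -PGE.
  apply: (fourier_dual_limit w0f ud).
  have s0 k : 0 < k.+1%:R^-1 :> R by rewrite invr_gt0.
  rewrite (_ : (fun k => _) = fun k => l * heat_form k.+1%:R^-1 phi U +
      v * heat_form k.+1%:R^-1 B U); last first.
    apply/funext => k; rewrite (cheat_form_ael (s0 k) w0s (csqint_real Ws) us w0W).
    by rewrite cheat_form_real heat_formDl ?heat_formZl//; exact: sqintZ.
  rewrite -[X in _ --> X]add0r -(mulr0 l) -(Rintegral_refl_test_eq0 c phis).
  apply: cvgD; apply: cvgM; [exact: cvg_cst|exact: cvg_heat_form|exact: cvg_cst|].
  by apply: cvg_heat_form => //; exact: lsc_ball0.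
have : 0 <= \int[mu]_xi (Phi m alpha (enorm xi ^+ 2) * G xi).
  rewrite PG mulr_ge0 ?(ltW v0)//.
  apply: (@Rintegral_refl_test_ge0 _ _ c phi phi0 phis \1_(ball0 a)) => // x xc.
  rewrite !indicE ler_nat; have [|//] := boolP (refl c x \in ball0 a).
  rewrite inE => xB; rewrite mem_set//; apply: le_lt_trans xB.
  by rewrite ler_wsqrtr// dotp_refl_ge.
rewrite leNgt => /negP; apply; apply: levy_pairing_lt0 => //.
- exact: integrable_cdot.
- have := integrable_cdot w0hs uhs; apply: eq_integrable => // xi _ /=.
  by rewrite PGE.
- move=> t t0.
  have := heat_form_refl_test_gt0 phi0 phis t0 N0.
  by rewrite -cheat_form_real (udual _ _ phf _ t0).
Qed.

(** By continuity a single bad point would have a cube of bad points around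
    it. *)
Lemma ground_state_refl (m alpha v a c : R) (phi : V -> R) (x : V) :
  0 < alpha -> alpha < 2 -> 0 <= m -> 0 < v -> 0 <= c ->
  ground_state (hamiltonian m alpha v a) phi ->
  x ord0 ord0 < c -> phi (refl c x) <= phi x.
Proof.
move=> a0 a2 m0 v0 c0 gs xc; rewrite leNgt; apply/negP => lt.
have N0 := bad_set_null a0 a2 m0 v0 c0 gs.
have [_ _ [_ _ cphi _]] := gs.
have cNphi : continuous (fun y => - phi y).
  have cN (y : V) : (fun y => - phi y) @ y --> - phi y.
    have FF : Filter (nbhs y) by exact: nbhs_filter.
    by apply: cvgN; apply: cphi.
  by move=> y; exact: cN.
pose k := (phi x + phi (refl c x)) / 2.
have [|d1 d10 H1] := @continuous_lsc _ _ _ cNphi x (- k).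
  by rewrite ltrN2 /k; lra.
have [|d2 d20 H2] := @continuous_lsc _ _ _ cphi (refl c x) k.
  by rewrite /k; lra.
pose d := Num.min (Num.min d1 d2) (c - x ord0 ord0).
have d0 : 0 < d by rewrite !lt_min d10 d20 subr_gt0.
have mB : measurable (bad_set c phi).
  apply: measurable_bad_set; have [_ _ [[[_ [w0 [ph phf _] _]] _] _ _ _]] := gs.
  by have [/csqint_inL2[phis _] _ _] := phf.
suff : mu (bad_set c phi) != 0%E by rewrite N0 eqxx.
apply: (lebesgue_cube_neq0 (x := x) mB d0) => y Hy.
have [dd1 [dd2 ddc]] : d <= d1 /\ d <= d2 /\ d <= c - x ord0 ord0.
  by rewrite !ge_min !lexx !orbT.
split.
  have := Hy ord0; rewrite distrC => /ltr_normlW; lra.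
have h1 : phi y < k.
  by rewrite -ltrN2; apply: H1 => i; exact: lt_le_trans (Hy i) dd1.
apply: lt_trans h1 _; apply: H2 => i; apply: lt_le_trans dd2.
rewrite !mxE; have := Hy i; case: (i == ord0) => //.
rewrite (_ : 2 * c - x ord0 i - (2 * c - y ord0 i) = - (x ord0 i - y ord0 i)).
  by rewrite normrN.
ring.
Qed.

End reflection_inequality.

Theorem theorem4p4 (R : realType) (d : nat) (alpha m v a : R)
  (d_ge1 : (1 <= d)%N) (alpha_gt0 : 0 < alpha) (alpha_lt2 : alpha < 2)
  (m_ge0 : 0 <= m) (v_gt0 : 0 < v) (a_gt0 : 0 < a)
  (phi : 'rV[R]_d -> R)
  (phi_ground_state : ground_state (hamiltonian m alpha v a) phi)
  (chi : R -> R)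
  (phi_chi : forall x : 'rV[R]_d, phi x = chi (enorm x)) :
  forall r s : R, 0 <= r -> r <= s -> chi s <= chi r.
Proof.
(* The reflection in [x_0 = (r + s) / 2] maps [(r, 0)] to [(s, 0)]. *)
case: d d_ge1 => // n _ in phi phi_ground_state phi_chi *.
move=> r s r0; rewrite le_eqVlt => /predU1P[->//|rs].
have chiE t : 0 <= t -> chi t = phi (cons_rV (t, 0)).
  move=> t0; rewrite phi_chi /enorm dotp_cons mxE unlift_none.
  rewrite [dotp _ _]big1 ?addr0; last by move=> i _; rewrite [_ _ i]mxE [X in _ * X]mxE mulr0.
  by rewrite -expr2 sqrtr_sqr ger0_norm.
have -> : s = 2 * ((r + s) / 2) - r by lra.
rewrite !chiE//; last lra.
rewrite -refl_cons; apply: (ground_state_refl alpha_gt0 alpha_lt2 m_ge0 v_gt0 _ phi_ground_state).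
  lra.
by rewrite mxE unlift_none /=; lra.
Qed.
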